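(* Let $T_{\mathbb{Z}}:\Delta_{\mathbb{Z}}\to\Delta_{\mathbb{Z}}$, with invariant probability measure $\mu_{\mathbb{Z}}$ and distance $d_{\mathbb{Z}}$, be the natural extension of a uniform Young tower $(\Delta,T,\mu)$ with exponential tails. Then $T_{\mathbb{Z}}$ satisfies an exponential concentration inequality: there exists $C>0$ such that, for any integer $n\ge1$ and any function $K:\Delta_{\mathbb{Z}}^n\to\mathbb{R}$ which is separately Lipschitz for $d_{\mathbb{Z}}$, $$\int e^{K(x,T_{\mathbb{Z}}x,\dots,T_{\mathbb{Z}}^{n-1}x)}\,d\mu_{\mathbb{Z}}(x)\le e^{\int K(x,T_{\mathbb{Z}}x,\dots,T_{\mathbb{Z}}^{n-1}x)\,d\mu_{\mathbb{Z}}(x)}\;e^{C\sum_{i=0}^{n-1}\mathrm{Lip}_i(K)^2}.$$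
   Context: Separately Lipschitz: for a space $X$ with distance $d$, a function $K$ on $X^n$ is separately Lipschitz if for each $i$ there is a constant $\mathrm{Lip}_i(K)$ with $|K(x_0,\dots,x_i,\dots,x_{n-1})-K(x_0,\dots,x_i',\dots,x_{n-1})|\le \mathrm{Lip}_i(K)\,d(x_i,x_i')$ for all points (the two arguments differ only in coordinate $i$). Uniform Young tower: a space $\Delta$ with a map $T:\Delta\to\Delta$ such that: (1) $\Delta$ is partitioned into (measurable) subsets $\Delta_{\alpha,\ell}$, for $\alpha\in\mathbb{N}$ and integers $0\le \ell\le\phi(\alpha)-1$, where $\phi$ is a positive integer-valued return time function. $T$ maps $\Delta_{\alpha,\ell}$ bijectively onto $\Delta_{\alpha,\ell+1}$ if $\ell<\phi(\alpha)-1$, and maps $\Delta_{\alpha,\phi(\alpha)-1}$ bijectively onto the basis $\Delta_0:=\bigcup_\alpha\Delta_{\alpha,0}$ (these bijections being bimeasurable). (2) The distance is $d(x,y)=\beta^{s(x,y)}$, where $0<\beta<1$ is fixed and $s(x,y)$ is the smallest $n\ge 0$ such that $T^nx$ and $T^ny$ are not in the same element of the partition. (3) There is a $T$-invariant probability measure $\mu$ such that the inverse $g$ of the jacobian of $T$ with respect to $\mu$ (i.e. $\int u\cdot v\circ T\,d\mu=\int \big(\sum_{Ty=x}g(y)u(y)\big)v(x)\,d\mu(x)$) satisfies, for some constant $C$, $|g(x)/g(y)-1|\le C\,d(Tx,Ty)$ for all $x,y$ in the same partition element. (4) $\gcd\{\phi(\alpha):\alpha\in\mathbb{N}\}=1$.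 Exponential tails: writing $\phi(x)=\phi(\alpha)$ for $x\in\Delta_{\alpha,0}$, there exists $c_0>0$ with $\int_{\Delta_0}e^{c_0\phi}\,d\mu<\infty$. Natural extension: $\Delta_{\mathbb{Z}}$ is the space of bi-infinite orbits $(x_k)_{k\in\mathbb{Z}}$, $Tx_k=x_{k+1}$, with $T_{\mathbb{Z}}$ the left shift and $\mu_{\mathbb{Z}}$ the unique $T_{\mathbb{Z}}$-invariant probability measure projecting to $\mu$ under $(x_k)\mapsto x_0$; it is partitioned according to the partition element containing $x_0$. The bilateral separation time $s_{\mathbb{Z}}(x,y)$ is the infimum of $|n|$, $n\in\mathbb{Z}$, such that $T_{\mathbb{Z}}^nx$ and $T_{\mathbb{Z}}^ny$ are not in the same partition element, and $d_{\mathbb{Z}}(x,y)=\beta^{s_{\mathbb{Z}}(x,y)}$ for some fixed $0<\beta<1$. *)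

(* Defs.v *)
From HB Require Import structures.
From mathcomp Require Import all_boot all_order all_algebra.
From mathcomp Require Import all_classical all_reals all_analysis.

Set Implicit Arguments.
Unset Strict Implicit.
Unset Printing Implicit Defensive.

Import Order.TTheory GRing.Theory Num.Theory.

Local Open Scope classical_set_scope.
Local Open Scope ring_scope.

(** ** Separation times and the associated distances *)

(* The smallest [n] satisfying [P]; [None] stands for infinity. *)
Definition first_time (P : nat -> Prop) : option nat :=
  if pselect (exists n, `[< P n >]) is left exP then Some (ex_minn exP)
  else None.

(* [beta ^ s], with [beta ^ oo = 0]. *)
Definition exp_time (R : realType) (beta : R) (s : option nat) : R :=
  if s is Some n then beta ^+ n else 0.

Definition same_cell (I X : Type) (D : set I) (F : I -> set X) (x y : X) :=
  exists i, [/\ D i, F i x & F i y].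

Definition separation_time (I X : Type) (D : set I) (F : I -> set X)
    (T : X -> X) (x y : X) : option nat :=
  first_time (fun n => ~ same_cell D F (iter n T x) (iter n T y)).

(** ** Maps, measures *)

Definition bimeasurable_bij d (X : measurableType d) (A B : set X)
    (f : X -> X) :=
  [/\ set_bij A B f,
      measurable_fun A f
    & forall E, measurable E -> E `<=` A -> measurable (f @` E)].

Definition preserves_measure d (X : measurableType d) (R : realType)
    (mu : set X -> \bar R) (T : X -> X) :=
  measurable_fun setT T /\
  forall A, measurable A -> mu (T @^-1` A) = mu A.

(* [g] is the inverse of the jacobian of [T] with respect to [mu]: the
   transfer operator is [u |-> \sum_(T y = x) g y * u y].  The duality is
   required for nonnegative [u] and [v], for which both sides always make sense
   in [0, +oo]. *)
Definition inverse_jacobian d (X : measurableType d) (R : realType)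
    (mu : {measure set X -> \bar R}) (T : X -> X) (g : X -> R) :=
  [/\ measurable_fun setT g,
      forall x, 0 < g x
    & forall u v : X -> R,
        measurable_fun setT u -> (forall x, 0 <= u x) ->
        measurable_fun setT v -> (forall x, 0 <= v x) ->
        (\int[mu]_x (u x * v (T x))%:E =
         \int[mu]_x ((\esum_(y in T @^-1` [set x]) (g y * u y)%:E)
                     * (v x)%:E))%E].

(* [m] is the gcd of a possibly infinite set of natural numbers. *)
Definition is_gcd (S : set nat) (m : nat) :=
  (forall n, S n -> (m %| n)%N) /\
  (forall e, (forall n, S n -> (e %| n)%N) -> (e %| m)%N).

(** ** Uniform Young towers *)

(* The cells are indexed by the pairs (alpha, l) with [l < phi alpha];
   [cell (alpha, l)] is meaningless for the other pairs. *)
Definition tower_index (phi : nat -> nat) : set (nat * nat) :=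
  [set i | (i.2 < phi i.1)%N].

Record uniform_young_tower (R : realType) d (X : measurableType d) := {
  tmap : X -> X;
  height : nat -> nat;
  cell : nat * nat -> set X;
  rate : R;
  tmeas : probability X R;
  invjac : X -> R;
  height_gt0 : forall a, (0 < height a)%N;
  cell_partition : partition (tower_index height) cell setT;
  cell_measurable : forall i, tower_index height i -> measurable (cell i);
  tmap_up : forall a l, (l.+1 < height a)%N ->
    bimeasurable_bij (cell (a, l)) (cell (a, l.+1)) tmap;
  tmap_top : forall a,
    bimeasurable_bij (cell (a, (height a).-1)) (\bigcup_b cell (b, 0%N)) tmap;
  rate_itv : 0 < rate < 1;
  tmeas_invariant : preserves_measure tmeas tmap;
  invjacP : inverse_jacobian tmeas tmap invjac;
  invjac_distortion : exists C : R, forall x y,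
    same_cell (tower_index height) cell x y ->
    `|invjac x / invjac y - 1| <=
      C * exp_time rate (separation_time (tower_index height) cell tmap
                           (tmap x) (tmap y));
  height_gcd : is_gcd (range height) 1%N
}.

Section tower.
Context (R : realType) d (X : measurableType d) (Y : uniform_young_tower R X).

Definition tower_base : set X := \bigcup_a cell Y (a, 0%N).

(* The return time [phi alpha] of a point of [cell (alpha, 0)]; only used on
   the base. *)
Definition return_time (x : X) : nat :=
  height Y (get [set a | cell Y (a, 0%N) x]).

Definition exponential_tails :=
  exists2 c0 : R, 0 < c0 &
    (\int[tmeas Y]_(x in tower_base)
       (expR (c0 * (return_time x)%:R))%:E < +oo)%E.

(** ** The natural extension *)

Lemma tmap_surj (x : X) : exists y, tmap Y y = x.
Proof.
have [cov _ _] := cell_partition Y.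
have : cover (tower_index (height Y)) (cell Y) x by rewrite cov.
case=> -[a [|l]] /= hl xal.
  have [[_ _ surj] _ _] := tmap_top Y a.
  have [y _ <-] : (tmap Y @` cell Y (a, (height Y a).-1)) x.
    by apply: surj; exists a.
  by exists y.
have [[_ _ surj] _ _] := tmap_up hl.
by have [y _ <-] := surj _ xal; exists y.
Qed.

Definition biorbits : set (int -> X) :=
  [set x | forall k, tmap Y (x k) = x (k + 1)].

Lemma biorbits_nonempty : biorbits !=set0.
Proof.
have [S TS] := choice tmap_surj.
exists (fun k : int => match k with
  | Posz n => iter n (tmap Y) point
  | Negz n => iter n.+1 S point end).
case=> [n|[|n]].
- by rewrite [Posz n + 1]addrC.
- by rewrite /= TS.
- have -> : Negz n.+1 + 1 = Negz n.
    by rewrite !NegzE -[n.+2]addn1 PoszD opprD addrNK.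
  by rewrite /= TS.
Qed.

Definition biorbit : Type := set_type biorbits.

HB.instance Definition _ := SubChoice.on biorbit.

Definition mk_biorbit (x : int -> X) (xP : biorbits x) : biorbit :=
  exist (fun x => x \in biorbits) x (mem_set xP).

HB.instance Definition _ := isPointed.Build biorbit
  (mk_biorbit (projT2 (cid biorbits_nonempty))).

Definition coord (k : int) (x : biorbit) : X := set_val x k.

Definition cylinders : set (set biorbit) :=
  \bigcup_k preimage_set_system setT (coord k) measurable.

(* The space of bi-infinite orbits, with the sigma-algebra generated by the
   coordinates. *)
Definition natural_extension := g_sigma_algebraType cylinders.

Lemma shift_subproof (k : int) (x : biorbit) :
  biorbits (fun j => coord (j + k) x).
Proof.
move=> j; rewrite /coord (set_mem (valP x) (j + k)).
by congr (_ _); rewrite addrAC.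
Qed.

Definition shiftZ (k : int) (x : natural_extension) : natural_extension :=
  mk_biorbit (@shift_subproof k x).

(* [T_Z]; its [k]-th iterate, for any [k : int], is [shiftZ k]. *)
Definition tmapZ : natural_extension -> natural_extension := shiftZ 1.

Lemma iter_tmapZ n x : iter n tmapZ x = shiftZ n%:Z x.
Proof.
elim: n => [|n IHn].
  by apply: val_inj; apply/funext => j; rewrite /= /coord addr0.
rewrite iterS IHn; apply: val_inj; apply/funext => j.
by change (coord (j + 1 + n%:Z) x = coord (j + n.+1%:Z) x); rewrite intS addrA.
Qed.

Definition cellZ (i : nat * nat) : set natural_extension :=
  [set x | cell Y i (coord 0 x)].

Definition separation_timeZ (x y : natural_extension) : option nat :=
  first_time (fun n => exists2 k : int, `|k|%N = n &
    ~ same_cell (tower_index (height Y)) cellZ (shiftZ k x) (shiftZ k y)).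

Definition distZ (beta : R) (x y : natural_extension) : R :=
  exp_time beta (separation_timeZ x y).

Definition natural_extension_measure (muZ : probability natural_extension R) :=
  preserves_measure muZ tmapZ /\
  forall A, measurable A -> muZ (coord 0 @^-1` A) = tmeas Y A.

End tower.

Arguments tmapZ {R d X} Y x.
Arguments distZ {R d X} Y beta x y.

(** ** Separately Lipschitz functions *)

(* [Lip i] is any admissible constant for the [i]-th variable. *)
Definition separately_lipschitz (R : realType) (X : Type) (dist : X -> X -> R)
    (n : nat) (K : ('I_n -> X) -> R) (Lip : 'I_n -> R) :=
  forall (i : 'I_n) (x x' : 'I_n -> X), (forall j, j != i -> x j = x' j) ->
    `|K x - K x'| <= Lip i * dist (x i) (x' i).

(* Main.v *)
Require Import Defs.
From mathcomp Require Import all_boot all_order all_algebra.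
From mathcomp Require Import all_classical all_reals all_analysis.
From mathcomp Require Import measurable_realfun zify ring lra.

Set Implicit Arguments.
Unset Strict Implicit.
Unset Printing Implicit Defensive.

Import Order.TTheory GRing.Theory Num.Theory.
Import numFieldNormedType.Exports.
Local Open Scope classical_set_scope.
Local Open Scope ring_scope.

(** The theorem follows from an exponential inequality for functions of finitely
    many letters of a one-sided orbit, where the letter of a point is the index of
    its cell ([one_sided_concentration]). Indeed the bilateral distance only sees
    the letters of a bi-infinite orbit, and a separately Lipschitz function of
    [x, T x, ..., T^(n-1) x] is, up to an error which is exponentially small in
    [m], a function of the letters between the times [-m] and [m + n], that is, of
    the one-sided orbit of the coordinate [-m], whose law is the invariant measure
    of the tower. Changing the letter of time [j] changes this function by at most
    the sum over [i] of [Lip i * beta ^ |i - j|], and the squares of these bounds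
    have a sum controlled by that of the [Lip i ^ 2]. The one-sided inequality
    requires these bounds to be small; the coordinates with a large constant are
    fixed first, at a price controlled by [Lip i ^ 2] ([lipschitz_concentration]).

    For the one-sided inequality, orbits are read backwards. Given a point, the
    previous one is chosen among its preimages with the probabilities given by the
    inverse of the jacobian: there is no choice above the base, and in the base a
    column is chosen ([backward_chain]). Let [f] be the function, [L] the operator
    averaging over the preimages, and [f_n = L^n f], the conditional expectation of
    [f] given the orbit from time [n] on. The main estimate ([exp_transfer]) is
    [L (exp f_n) <= exp (f_(n+1) + a_n)], where the sum of the [a_n] is at most a
    multiple of the sum of the [delta j ^ 2], for [delta j] the influence of the
    letter [j]. Since [L] preserves integrals and [f_n] converges to the integral
    of [f], the inequality follows by integration.

    The deviation of [f_n] from its mean on the preimages of a point has mean zero,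
    so it contributes through its square times its exponential ([exp_mean]). On two
    preimages [y] and [y'], the values of [f_n] differ by at most the sum over [k]
    of [delta (n - k)] times the probability that two coupled backward chains issued
    from [y] and [y'] disagree after [k] steps. This probability decays
    exponentially, with a prefactor exponential in the levels of [y] and [y'].
    Hence the deviation is linear in the influences and exponential in the levels,
    which is used for its square ([deviation_V]); it is also at most the largest
    influence times a linear function of the levels, which is used for its
    exponential ([deviation_level]). The exponential tails make everything
    integrable over the columns.

    The exponential decay of the disagreement is obtained by drawing the labels of
    the two chains from the maximal coupling of their laws, and by exhibiting a cost
    which contracts in mean at each step ([cost], [coupling_contraction]). Three
    facts are combined: chains that agreed for a long time separate with an
    exponentially small probability, by bounded distortion; far above the base, the
    exponential of the level decreases; and, as the heights of the columns have no
    common divisor, two chains close to the base return to it simultaneously with a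
    probability bounded below ([sync_time]), after which they choose the same column
    with a probability bounded below. *)

(** * Elementary inequalities *)

Lemma geometric_small {R : realType} (b K e : R) : 0 <= b < 1 -> 0 <= K -> 0 < e ->
  exists n, forall m, (n <= m)%N -> K * b ^+ m <= e.
Proof.
move=> /andP[b0 b1] K0 e0.
have /cvg_expr : `|b| < 1 by rewrite ger0_norm.
move=> /cvgrPdist_le /(_ (e / (K + 1))) /(_ _)[|n _ nb].
  by rewrite divr_gt0// ltr_wpDl.
exists n => m /nb /=; rewrite sub0r normrN ger0_norm ?exprn_ge0// => h.
apply: (@le_trans _ _ ((K + 1) * b ^+ m)); first by rewrite ler_wpM2r ?exprn_ge0// lerDl.
by rewrite mulrC -ler_pdivlMr// ltr_wpDl.
Qed.

Lemma finite_pos_min {R : realType} (w : nat -> R) n : (forall a, 0 < w a) ->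
  exists2 z, 0 < z & forall a, (a <= n)%N -> z <= w a.
Proof.
move=> w0; elim: n => [|n [z z0 IH]]; first by exists (w 0%N) => // a; case: a.
exists (Num.min z (w n.+1)); first by rewrite lt_min z0 w0.
move=> a; rewrite leq_eqVlt => /orP[/eqP ->|an]; first by rewrite ge_min lexx orbT.
by rewrite ge_min IH.
Qed.

Section elementary.
Context {R : realType}.
Implicit Types (u : nat -> R) (rho t : R).

Lemma sum_geometric_le rho n : 0 <= rho < 1 ->
  \sum_(k < n) rho ^+ k <= (1 - rho)^-1.
Proof.
move=> /andP[r0 r1]; rewrite -[leRHS]mul1r ler_pdivlMr ?subr_gt0//.
have := subrX1 rho n; have : 0 <= rho ^+ n by rewrite exprn_ge0.
lra.
Qed.

(** The first [m] terms cost at most one each, the others form a geometric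
    series. Applied with [m] proportional to the logarithm of an exponentially
    large prefactor, this replaces the prefactor by its logarithm. *)
Lemma sum_cut_geometric u rho m n : 0 <= rho < 1 -> (forall k, u k <= 1) ->
  (forall k, (m <= k)%N -> u k <= rho ^+ (k - m)) ->
  \sum_(k < n) u k <= m%:R + (1 - rho)^-1.
Proof.
move=> r01 u1 ur.
suff : \sum_(k < n) u k <= (minn n m)%:R + \sum_(k < n - m) rho ^+ k.
  move=> /le_trans; apply; apply: lerD; last exact: sum_geometric_le.
  by rewrite ler_nat geq_minr.
elim: n => [|n IH]; first by rewrite !big_ord0 min0n addr0.
rewrite big_ord_recr/=; have [nm|mn] := ltnP n m.
  have -> : (n.+1 - m = 0)%N by apply/eqP; rewrite subn_eq0.
  have -> : minn n.+1 m = n.+1 by apply/minn_idPl.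
  move: IH; have -> : (n - m = 0)%N by apply/eqP; rewrite subn_eq0 ltnW.
  have -> : minn n m = n by apply/minn_idPl; rewrite ltnW.
  by rewrite !big_ord0 !addr0 -natr1 => /lerD; apply.
rewrite subSn// big_ord_recr/= addrA.
have -> : minn n.+1 m = minn n m by rewrite !(minn_idPr _)// (leq_trans mn).
by apply: lerD => //; exact: ur.
Qed.

Lemma sum_convolution_le u N p : (forall k, 0 <= u k) ->
  \sum_(j < N | (j <= p)%N) u (p - j)%N <= \sum_(k < p.+1) u k.
Proof.
move=> u0.
have -> : \sum_(k < p.+1) u k = \sum_(k < p.+1) u (p - k)%N.
  rewrite (reindex_inj rev_ord_inj)/=; apply: eq_bigr => k _.
  by rewrite subSS.
rewrite (big_ord_widen_cond (maxn N p.+1) (fun j => j <= p)%N (fun j => u (p - j)%N)) ?leq_maxl//.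
rewrite (big_ord_widen (maxn N p.+1) (fun j => u (p - j)%N)) ?leq_maxr//.
rewrite [leRHS](bigID (fun i : 'I__ => (i < N)%N))/= lerDl.
by apply: sumr_ge0 => i _; exact: u0.
Qed.

(** The weighted variance of [a] is nonnegative. *)
Lemma weighted_cauchy (I : finType) (P : pred I) (k a : I -> R) :
  (forall i, 0 <= k i) ->
  (\sum_(i | P i) k i * a i) ^+ 2 <=
  (\sum_(i | P i) k i) * \sum_(i | P i) k i * a i ^+ 2.
Proof.
move=> k0; set M := \sum_(i | P i) k i * a i; set S := \sum_(i | P i) k i.
set Q := \sum_(i | P i) _.
have S0 : 0 <= S by apply: sumr_ge0.
have [S00|S00] := eqVneq S 0.
  rewrite S00 mul0r /M big1 ?expr0n// => i Pi.
  have /eqP := S00; rewrite psumr_eq0// => /allP /(_ i).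
  by rewrite mem_index_enum Pi/= => /(_ isT)/eqP ->; rewrite mul0r.
have Sp : 0 < S by rewrite lt_neqAle eq_sym S00.
rewrite -subr_ge0 -(pmulr_rge0 _ Sp).
have <- : \sum_(i | P i) k i * (S * a i - M) ^+ 2 = S * (S * Q - M ^+ 2).
  transitivity (\sum_(i | P i) (S ^+ 2 * (k i * a i ^+ 2) - 2 * S * M * (k i * a i) + M ^+ 2 * k i)).
    by apply: eq_bigr => i _; ring.
  rewrite big_split/= sumrB -!mulr_sumr -/Q -/M -/S; ring.
by apply: sumr_ge0 => i _; rewrite mulr_ge0// sqr_ge0.
Qed.

(** There is no restriction on [t], which is needed because the deviations
    to which this is applied are unbounded; the price is the last factor. *)
Lemma expR_le_quadratic t : expR t <= 1 + t + t ^+ 2 * expR `|t|.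
Proof.
have e0 (s : R) : expR s - 1 <= s * expR s.
  have h : 1 - s <= expR (- s) by have := expR_ge1Dx (- s).
  have := expR_gt0 s => es; have : (1 - s) * expR s <= 1.
    by rewrite -[leRHS](expRxMexpNx_1 s) [leRHS]mulrC ler_wpM2r// ltW.
  by lra.
have := e0 t; have := expR_ge1Dx t; have [t0|t0] := leP 0 t.
  rewrite ger0_norm// => h1 h2.
  have : t * (expR t - 1) <= t * (t * expR t) by rewrite ler_wpM2l.
  by rewrite expr2; lra.
rewrite ltr0_norm// => h1 h2.
have : t ^+ 2 * 1 <= t ^+ 2 * expR (- t).
  by rewrite ler_wpM2l ?sqr_ge0// -expR0 ler_expR; lra.
have : - t * t <= - t * (expR t - 1) by apply: ler_wpM2l; lra.
by rewrite expr2; lra.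
Qed.

End elementary.

Lemma sum_shift_le {R : realType} (u : nat -> R) j q : (forall k, 0 <= u k) ->
  \sum_(n < q | (j <= n)%N) u (n - j)%N <= \sum_(k < q) u k.
Proof.
move=> u0; rewrite -(big_geq_mkord _ _ xpredT (fun n => u (n - j)%N)).
rewrite -{1}[j]add0n big_addn big_mkord.
under eq_bigr do rewrite addnK.
rewrite (big_ord_widen q u) ?leq_subr//.
rewrite [leRHS](bigID (fun i : 'I__ => (i < q - j)%N))/= lerDl.
by apply: sumr_ge0 => i _; exact: u0.
Qed.

(** * Averages over a countable set of labels and maximal couplings *)

Section average.
Context {R : realType}.
Implicit Types (p q : nat -> R) (F G : nat -> \bar R).
Local Open Scope ereal_scope.

(** Averages of nonnegative functions, with values in the extended reals, can be
    compared and exchanged without any summability condition. *)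
Definition avg p F : \bar R := \sum_(0 <= a <oo) (p a)%:E * F a.

Lemma avg_ge0 p F : (forall a, (0 <= p a)%R) -> (forall a, 0 <= F a) ->
  0 <= avg p F.
Proof.
by move=> p0 F0; apply: nneseries_ge0 => a _ _; apply: mule_ge0; rewrite ?lee_fin.
Qed.

Lemma eq_avg p F G : (forall a, F a = G a) -> avg p F = avg p G.
Proof. by move=> FG; apply: eq_eseriesr => a _; rewrite FG. Qed.

Lemma le_avg p F G : (forall a, (0 <= p a)%R) -> (forall a, 0 <= F a) ->
  (forall a, F a <= G a) -> avg p F <= avg p G.
Proof.
move=> p0 F0 FG; apply: lee_nneseries => a _.
  by move=> _; apply: mule_ge0; rewrite ?lee_fin.
by apply: lee_wpmul2l; rewrite ?lee_fin.
Qed.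

Lemma le_avgl p q F : (forall a, (0 <= p a)%R) -> (forall a, 0 <= F a) ->
  (forall a, (p a <= q a)%R) -> avg p F <= avg q F.
Proof.
move=> p0 F0 FG; apply: lee_nneseries => a _.
  by move=> _; apply: mule_ge0; rewrite ?lee_fin.
by apply: lee_wpmul2r; rewrite ?lee_fin.
Qed.

Lemma avgD p F G : (forall a, (0 <= p a)%R) -> (forall a, 0 <= F a) ->
  (forall a, 0 <= G a) -> avg p (fun a => F a + G a) = avg p F + avg p G.
Proof.
move=> p0 F0 G0; rewrite -nneseriesD => [||]; last 2 first.
- by move=> a _ _; apply: mule_ge0; rewrite ?lee_fin.
- by move=> a _ _; apply: mule_ge0; rewrite ?lee_fin.
by apply: eq_eseriesr => a _; rewrite ge0_muleDr.
Qed.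

Lemma avgDl p q F : (forall a, (0 <= p a)%R) -> (forall a, (0 <= q a)%R) ->
  (forall a, 0 <= F a) -> avg (p \+ q)%R F = avg p F + avg q F.
Proof.
move=> p0 q0 F0; rewrite -nneseriesD => [||]; last 2 first.
- by move=> a _ _; apply: mule_ge0; rewrite ?lee_fin.
- by move=> a _ _; apply: mule_ge0; rewrite ?lee_fin.
by apply: eq_eseriesr => a _ /=; rewrite EFinD ge0_muleDl ?lee_fin.
Qed.

Lemma avgZ p k F : (forall a, (0 <= p a)%R) -> (forall a, 0 <= F a) ->
  avg p (fun a => k%:E * F a) = k%:E * avg p F.
Proof.
move=> p0 F0; rewrite -nneseriesZl.
  by apply: eq_eseriesr => a _; rewrite muleCA.
by move=> a _; apply: mule_ge0; rewrite ?lee_fin.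
Qed.

Lemma avgZl p k F : (forall a, (0 <= p a)%R) -> (forall a, 0 <= F a) ->
  avg (fun a => k * p a)%R F = k%:E * avg p F.
Proof.
move=> p0 F0; rewrite -nneseriesZl.
  by apply: eq_eseriesr => a _; rewrite EFinM muleA.
by move=> a _; apply: mule_ge0; rewrite ?lee_fin.
Qed.

Lemma avg_cst p k : (forall a, (0 <= p a)%R) ->
  avg p (cst k%:E) = k%:E * avg p (cst 1).
Proof.
move=> p0; rewrite -avgZ//.
by apply: eq_eseriesr => a _ /=; rewrite mule1.
Qed.

Lemma avg_single p (i : nat) F : (forall a, (0 <= p a)%R) ->
  (forall a, 0 <= F a) -> (p i)%:E * F i <= avg p F.
Proof.
move=> p0 F0; pose G a : \bar R := if a == i then F a else 0.
have -> : (p i)%:E * F i = avg p G.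
  rewrite /avg (@nneseriesD1 _ _ i)//; last first.
    by move=> a _; apply: mule_ge0; rewrite ?lee_fin// /G; case: ifP.
  rewrite {1}/G eqxx eseries0 ?adde0// => a _ ai.
  by rewrite /G (negbTE ai) mule0.
by apply: le_avg => // a; rewrite /G; case: ifP.
Qed.

Lemma avg_cst_ge0 p (y : \bar R) : (forall a, (0 <= p a)%R) -> 0 <= y ->
  avg p (fun=> y) = y * avg p (cst 1).
Proof.
case: y => [r| |]// p0 _; first exact: avg_cst.
have [[b pb]|np] := pselect (exists b, p b != 0%R).
  have pb0 : (0 < p b)%R by rewrite lt_neqAle eq_sym pb p0.
  have h : +oo <= avg p (fun=> +oo).
    apply: le_trans (@avg_single p b (fun=> +oo) p0 (fun=> leey 0)).
    by rewrite gt0_muley ?lte_fin.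
  have h1 : 0 < avg p (cst 1).
    apply: (@lt_le_trans _ _ ((p b)%:E * 1)); first by rewrite mule1 lte_fin.
    exact: (@avg_single p b (cst 1)).
  by rewrite gt0_mulye//; apply/eqP; rewrite -leye_eq.
have p00 a : p a = 0%R by apply/eqP; apply/negPn/negP => pa; apply: np; exists a.
by rewrite /avg !eseries0 ?mule0// => a _ _; rewrite p00 mul0e.
Qed.

Lemma avg_delta (i : nat) F : (forall a, 0 <= F a) ->
  avg (fun a => (a == i)%:R) F = F i.
Proof.
move=> F0; rewrite /avg (@nneseriesD1 _ _ i)//; last first.
  by move=> a _; apply: mule_ge0; rewrite ?lee_fin.
rewrite eqxx mul1e eseries0 ?adde0// => a _ ai.
by rewrite (negbTE ai) mul0e.
Qed.

Lemma avg_sum p I (r : seq I) (P : pred I) (F : I -> nat -> \bar R) :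
  (forall a, (0 <= p a)%R) -> (forall i a, 0 <= F i a) ->
  avg p (fun a => \sum_(i <- r | P i) F i a) =
  \sum_(i <- r | P i) avg p (F i).
Proof.
move=> p0 F0; rewrite -nneseries_sum; last first.
  by move=> i a _; apply: mule_ge0; rewrite ?lee_fin.
by apply: eq_eseriesr => a _; rewrite ge0_sume_distrr.
Qed.

End average.

Lemma avg_drop {R : realType} (p : nat -> R) (i : nat) (v : R) :
  (forall a, 0 <= p a) -> avg p (cst 1%E) = 1%E -> 0 <= v <= 1 ->
  avg p (fun a => (1 - (a == i)%:R * v)%:E) = (1 - p i * v)%:E.
Proof.
move=> p0 p1 /andP[v0 v1].
have iv a : 0 <= (a == i)%:R * v <= 1 by case: eqP; rewrite ?mul1r ?mul0r ?v0 ?v1 ?lexx ?ler01.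
have F0 a : (0 <= (1 - (a == i)%:R * v)%:E)%E.
  by rewrite lee_fin subr_ge0; case/andP: (iv a).
have G0 a : (0 <= ((a == i)%:R * v)%:E)%E by rewrite lee_fin; case/andP: (iv a).
have single : avg p (fun a => ((a == i)%:R * v)%:E) = (p i * v)%:E.
  rewrite /avg (@nneseriesD1 _ _ i)//; last first.
    by move=> a _; apply: mule_ge0; [rewrite lee_fin|exact: G0].
  rewrite eqxx mul1r eseries0 ?adde0// => a _ ai.
  by rewrite (negbTE ai) mul0r mule0.
have : (avg p (fun a => (1 - (a == i)%:R * v)%:E) + (p i * v)%:E = 1)%E.
  rewrite -single -avgD// -[RHS]p1; apply: eq_avg => a.
  by rewrite -EFinD subrK.
case: (avg _ _) => [r| |]; rewrite ?addye// -EFinD => -[] e.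
by congr EFin; lra.
Qed.

Section coupling.
Context {R : realType} (p q : nat -> R).
Hypotheses (p0 : forall a, 0 <= p a) (q0 : forall a, 0 <= q a).
Hypotheses (p1 : avg p (cst 1%E) = 1%E) (q1 : avg q (cst 1%E) = 1%E).
Local Open Scope ereal_scope.
Implicit Types (F G : nat -> \bar R) (H : nat -> nat -> \bar R).

Definition common a := Num.min (p a) (q a).
Definition excess a := (p a - common a)%R.
Definition deficit a := (q a - common a)%R.
Definition defect : R := fine (avg excess (cst 1)).

Lemma common_ge0 a : (0 <= common a)%R.
Proof. by rewrite /common le_min p0 q0. Qed.
Lemma excess_ge0 a : (0 <= excess a)%R.
Proof. by rewrite subr_ge0 /common ge_min lexx. Qed.
Lemma deficit_ge0 a : (0 <= deficit a)%R.
Proof. by rewrite subr_ge0 /common ge_min lexx orbT. Qed.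
Hint Resolve common_ge0 excess_ge0 deficit_ge0 : core.

Lemma avg_common_excess F : (forall a, 0 <= F a) ->
  avg p F = avg common F + avg excess F.
Proof.
move=> F0; rewrite -avgDl//; apply: eq_eseriesr => a _ /=.
by rewrite /excess addrC subrK.
Qed.

Lemma avg_common_deficit F : (forall a, 0 <= F a) ->
  avg q F = avg common F + avg deficit F.
Proof.
move=> F0; rewrite -avgDl//; apply: eq_eseriesr => a _ /=.
by rewrite /deficit addrC subrK.
Qed.

Lemma avg_common1_fin : avg common (cst 1) \is a fin_num.
Proof.
rewrite ge0_fin_numE ?avg_ge0//; apply: (@le_lt_trans _ _ (avg p (cst 1))).
  by apply: le_avgl => // a; rewrite /common ge_min lexx.
by rewrite p1 ltry.
Qed.

Lemma avg_excess1_fin : avg excess (cst 1) \is a fin_num.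
Proof.
rewrite ge0_fin_numE ?avg_ge0//; apply: (@le_lt_trans _ _ (avg p (cst 1))).
  by apply: le_avgl => // a; rewrite /excess gerBl.
by rewrite p1 ltry.
Qed.

Lemma avg_excess1 : avg excess (cst 1) = defect%:E.
Proof. by rewrite /defect fineK ?avg_excess1_fin. Qed.

Lemma defect_ge0 : (0 <= defect)%R.
Proof. by rewrite fine_ge0// avg_ge0. Qed.

Lemma avg_common1 : avg common (cst 1) = (1 - defect)%:E.
Proof.
have : avg common (cst 1) + avg excess (cst 1) = 1.
  by rewrite -avg_common_excess.
rewrite avg_excess1 -(fineK avg_common1_fin) -EFinD => -[] h.
by congr (_%:E); lra.
Qed.

Lemma avg_deficit1 : avg deficit (cst 1) = defect%:E.
Proof.
have : avg common (cst 1) + avg deficit (cst 1) = 1.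
  by rewrite -avg_common_deficit.
have : avg deficit (cst 1) \is a fin_num.
  rewrite ge0_fin_numE ?avg_ge0//; apply: (@le_lt_trans _ _ (avg q (cst 1))).
    by apply: le_avgl => // a; rewrite /deficit gerBl.
  by rewrite q1 ltry.
move=> /fineK <-; rewrite avg_common1 -EFinD => -[] h.
by congr (_%:E); lra.
Qed.

Lemma defect_eq0 a : defect = 0%R -> (excess a = 0%R) * (deficit a = 0%R).
Proof.
move=> d0.
have h r : (forall a, (0 <= r a)%R) -> avg r (cst 1) = defect%:E -> r a = 0%R.
  move=> r0 r1; apply/eqP; rewrite eq_le r0 andbT -lee_fin.
  rewrite d0 in r1; rewrite -r1 -[leLHS]mule1.
  exact: (@avg_single _ r a (cst 1)).
by rewrite (h excess) ?(h deficit) ?avg_excess1 ?avg_deficit1.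
Qed.

(** The maximal coupling of [p] and [q]: with probability [common a] both labels
    are [a]; otherwise, they are drawn independently from the normalised excess
    and deficit. If the defect is zero, then so are the excess and the deficit,
    whatever the value of the inverse of zero. *)
Definition couple H : \bar R :=
  avg common (fun a => H a a) +
  (defect^-1)%:E * avg excess (fun a => avg deficit (H a)).

Lemma le_couple H H' : (forall a b, 0 <= H a b) ->
  (forall a b, H a b <= H' a b) -> couple H <= couple H'.
Proof.
move=> H0 HH; apply: leeD; first exact: le_avg.
apply: lee_wpmul2l; first by rewrite lee_fin invr_ge0 defect_ge0.
by apply: le_avg => // a; [exact: avg_ge0|exact: le_avg].
Qed.

Lemma coupleD H H' : (forall a b, 0 <= H a b) -> (forall a b, 0 <= H' a b) ->
  couple (fun a b => H a b + H' a b) = couple H + couple H'.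
Proof.
move=> H0 H'0; rewrite /couple avgD// addeACA; congr (_ + _).
rewrite -ge0_muleDr; last 2 first.
- by apply: avg_ge0 => // a; exact: avg_ge0.
- by apply: avg_ge0 => // a; exact: avg_ge0.
rewrite -avgD//; last 2 first.
- by move=> a; exact: avg_ge0.
- by move=> a; exact: avg_ge0.
by congr (_ * _); apply: eq_avg => a; rewrite avgD.
Qed.

Lemma coupleZ k H : (forall a b, 0 <= H a b) ->
  couple (fun a b => k%:E * H a b) = k%:E * couple H.
Proof.
move=> H0; rewrite /couple avgZ// muleDr; last 2 first.
- by [].
- apply: ge0_adde_def; rewrite inE ?avg_ge0//.
  apply: mule_ge0; first by rewrite lee_fin invr_ge0 defect_ge0.
  by apply: avg_ge0 => // a; exact: avg_ge0.
congr (_ + _); rewrite muleCA; congr (_ * _).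
rewrite -avgZ//; last by move=> a; exact: avg_ge0.
by apply: eq_avg => a; rewrite avgZ.
Qed.

Lemma couple_sum I (r : seq I) (P : pred I) (H : I -> nat -> nat -> \bar R) :
  (forall i a b, 0 <= H i a b) ->
  couple (fun a b => \sum_(i <- r | P i) H i a b) =
  \sum_(i <- r | P i) couple (H i).
Proof.
move=> H0; rewrite /couple avg_sum// big_split/=; congr (_ + _).
rewrite -ge0_sume_distrr; last first.
  by move=> i _; apply: avg_ge0 => // a; exact: avg_ge0.
congr (_ * _); rewrite -avg_sum//; last by move=> i a; exact: avg_ge0.
by apply: eq_avg => a; rewrite avg_sum.
Qed.

Lemma couple_fst F : (forall a, 0 <= F a) ->
  couple (fun a _ => F a) = avg p F.
Proof.
move=> F0; rewrite avg_common_excess//; congr (_ + _).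
have [d0|d0] := eqVneq defect 0%R.
  rewrite d0 invr0 mul0e /avg eseries0// => a _ _.
  by rewrite defect_eq0// mul0e.
rewrite -avgZ//; last by move=> a; exact: avg_ge0.
apply: eq_avg => a.
rewrite avg_cst_ge0// avg_deficit1.
by rewrite muleCA -EFinM mulVf// mule1.
Qed.

Lemma couple_snd F : (forall a, 0 <= F a) ->
  couple (fun _ b => F b) = avg q F.
Proof.
move=> F0; rewrite avg_common_deficit//; congr (_ + _).
have [d0|d0] := eqVneq defect 0%R.
  rewrite d0 invr0 mul0e /avg eseries0// => a _ _.
  by rewrite defect_eq0// mul0e.
rewrite avg_cst_ge0//; last exact: avg_ge0.
by rewrite avg_excess1 muleCA -EFinM mulVf// mule1.
Qed.

(** A bound between the values at coupled labels integrates to a bound between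
    the averages. *)
Lemma couple_transport F G H : (forall a, 0 <= F a) -> (forall b, 0 <= G b) ->
  (forall a b, 0 <= H a b) -> (forall a b, F a <= G b + H a b) ->
  avg p F <= avg q G + couple H.
Proof.
move=> F0 G0 H0 FGH; rewrite -couple_fst// -couple_snd// -coupleD//.
exact: le_couple.
Qed.

(** Away from the diagonal the cost is bounded by a sum of functions of one label
    each, so that only the marginals of the residual coupling matter. *)
Lemma couple_le_defect (x y : R) F G H : (0 <= x)%R -> (0 <= y)%R ->
  (forall a, 0 <= F a) -> (forall b, 0 <= G b) -> (forall a b, 0 <= H a b) ->
  (forall a, H a a <= x%:E) -> (forall a b, H a b <= y%:E + (F a + G b)) ->
  couple H <= (x * (1 - defect) + y * defect)%:E + (avg excess F + avg deficit G).
Proof.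
move=> x0 y0 F0 G0 H0 Hx HFG; rewrite EFinD -addeA; apply: leeD.
  rewrite EFinM -avg_common1 -avg_cst//; exact: le_avg.
have [d0|d0] := eqVneq defect 0%R.
  by rewrite d0 invr0 mul0e mulr0 add0e adde_ge0// avg_ge0.
have dg0 : (0 < defect)%R by rewrite lt_neqAle eq_sym d0 defect_ge0.
have Fle a : avg deficit (H a) <=
    (y * defect)%:E + (defect%:E * F a + avg deficit G).
  apply: (@le_trans _ _ (avg deficit (fun b => y%:E + (F a + G b)))).
    exact: le_avg.
  rewrite avgD//; last by move=> b; apply: adde_ge0.
  rewrite avg_cst// avg_deficit1 -EFinM leeD2l// avgD//; apply: leeD => //.
  by rewrite avg_cst_ge0// avg_deficit1 muleC.
apply: (@le_trans _ _ ((defect^-1)%:E * avg excess (fun a =>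
    (y * defect)%:E + (defect%:E * F a + avg deficit G)))).
  apply: lee_wpmul2l; first by rewrite lee_fin invr_ge0 ltW.
  by apply: le_avg => // a; exact: avg_ge0.
have yd0 : (0 <= y * defect)%R by rewrite mulr_ge0// defect_ge0.
have dF0 a : 0 <= defect%:E * F a by apply: mule_ge0 => //; rewrite lee_fin ltW.
have dG0 : 0 <= avg deficit G by apply: avg_ge0.
rewrite avgD//; last by move=> a; apply: adde_ge0.
rewrite avgD// avg_cst// avg_excess1 avgZ//.
case: (avg deficit G) dG0 => [g g0|_|//]; last first.
  by rewrite addey ?addey ?leey// gt_eqF// (@lt_le_trans _ _ 0) ?ltNyr// avg_ge0.
rewrite avg_cst// avg_excess1.
have : 0 <= avg excess F by apply: avg_ge0.
case: (avg excess F) => [f f0|_|//]; last first.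
  by rewrite addye// addey// leey.
rewrite -[leRHS]/((y * defect + (f + g))%:E).
have -> : (y * defect + (f + g) =
    defect^-1 * (y * defect * defect + (defect * f + g * defect)))%R by field.
by [].
Qed.

End coupling.

(** * Synchronisation of two renewal processes *)

Section synchronisation.
Variable h : nat -> nat.
Hypothesis h_gt0 : forall a, (0 < h a)%N.
Local Open Scope nat_scope.

Inductive is_renewal (A : nat) : nat -> Prop :=
| renewal0 : is_renewal A 0
| renewalS a n : a <= A -> is_renewal A n -> is_renewal A (h a + n).

Lemma renewal_widen A B n : A <= B -> is_renewal A n -> is_renewal B n.
Proof.
move=> AB; elim=> [|a m aA _ IH]; first exact: renewal0.
by apply: renewalS => //; exact: leq_trans AB.
Qed.

Lemma renewal_mul A a k n :
  a <= A -> is_renewal A n -> is_renewal A (k * h a + n).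
Proof.
move=> aA rn; elim: k => [|k IH]; first by rewrite mul0n.
by rewrite mulSn -addnA; exact: renewalS.
Qed.

Definition height_gcdn A := \big[gcdn/0]_(a < A.+1) h a.

Lemma height_gcdnS A : height_gcdn A.+1 = gcdn (height_gcdn A) (h A.+1).
Proof. by rewrite /height_gcdn big_ord_recr. Qed.

Lemma height_gcdn0 : height_gcdn 0 = h 0.
Proof. by rewrite /height_gcdn big_ord_recr/= big_ord0 gcd0n. Qed.

Lemma height_gcdn_gt0 A : 0 < height_gcdn A.
Proof.
by elim: A => [|A IH]; rewrite ?height_gcdn0// height_gcdnS gcdn_gt0 IH.
Qed.

Lemma height_gcdn_dvd A B : A <= B -> height_gcdn B %| height_gcdn A.
Proof.
elim: B => [|B IH]; first by case: A.
rewrite leq_eqVlt => /orP[/eqP ->//|AB].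
by rewrite height_gcdnS; apply: dvdn_trans (IH AB); exact: dvdn_gcdl.
Qed.

Lemma height_gcdn_dvd_height A : height_gcdn A %| h A.
Proof. by case: A => [|A]; rewrite ?height_gcdn0// height_gcdnS dvdn_gcdr. Qed.

(** Large multiples of the gcd of finitely many generators are reached: by
    Bezout, subtracting boundedly many copies of the last generator reaches a
    multiple of the gcd of the previous ones. *)
Lemma renewal_large_multiples A :
  exists N, forall n, N <= n -> height_gcdn A %| n -> is_renewal A n.
Proof.
elim: A => [|A [N IH]].
  exists 0 => n _; rewrite height_gcdn0 => /dvdnP[k ->].
  by rewrite -[_ * _]addn0; apply: renewal_mul => //; exact: renewal0.
set g := height_gcdn A in IH *; set b := h A.+1.
have g0 : 0 < g by exact: height_gcdn_gt0.
exists (N + g * b) => n nN; rewrite height_gcdnS -/g -/b => /dvdnP[k nE].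
have [c cg cdvd] := Bezoutl b g0.
set j := (k * c * g.-1) %% g.
have jg : j < g by rewrite ltn_mod.
have jb : j * b <= g * b by rewrite leq_mul2r ltnW ?orbT.
have jbn : j * b <= n by apply: leq_trans jb (leq_trans _ nN); exact: leq_addl.
have dvd : g %| n - j * b.
  rewrite -eqn_mod_dvd// -(eqn_modDr (k * c * b)).
  rewrite -[X in _ == X]modnDml modnMml modnDml.
  have -> : n + k * c * b = k * (gcdn g b + c * b) by rewrite nE mulnDr mulnA.
  have -> : k * c * g.-1 * b + k * c * b = k * c * b * g.
    by rewrite -[in RHS](prednK g0) mulnS [RHS]addnC; congr (_ + _); exact: mulnAC.
  by rewrite modnMl -/(dvdn _ _) dvdn_mull.
rewrite -(subnKC jbn); apply: renewal_mul => //.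
apply: (renewal_widen (leqnSn A)); apply: IH => //.
by rewrite leq_subRL// addnC; apply: leq_trans nN; rewrite leq_add2l.
Qed.

Hypothesis h_gcd : is_gcd (range h) 1.

(** The gcds of the first generators decrease, so they stabilise at the gcd of
    all of them. *)
Lemma renewal_large : exists A N, forall n, N <= n -> is_renewal A n.
Proof.
have ex : exists d, `[< exists A, height_gcdn A = d >].
  by exists (height_gcdn 0); apply/asboolP; exists 0.
case: (ex_minnP ex) => d /asboolP[A dA] dmin.
have d1 : d %| 1.
  case: h_gcd => _; apply => _ [b _ <-].
  have dvdd : height_gcdn (maxn A b) %| d.
    by rewrite -dA height_gcdn_dvd// leq_maxl.
  have dle : d <= height_gcdn (maxn A b).
    by apply: dmin; apply/asboolP; exists (maxn A b).
  have d0 : 0 < d by rewrite -dA height_gcdn_gt0.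
  have -> : d = height_gcdn (maxn A b).
    by apply/eqP; rewrite eqn_leq dle dvdn_leq.
  apply: dvdn_trans (height_gcdn_dvd_height b).
  by rewrite height_gcdn_dvd// leq_maxr.
have [N HN] := renewal_large_multiples A.
by exists A, N => n nN; apply: HN => //; rewrite dA; apply: dvdn_trans (dvd1n n).
Qed.

Definition renewal_bound : nat := projT1 (cid renewal_large).

Definition syncs (l l' n : nat) := [/\ l <= n, l' <= n,
  is_renewal renewal_bound (n - l) & is_renewal renewal_bound (n - l')].

Lemma syncs_ex l l' : exists n, `[< syncs l l' n >].
Proof.
have [N HN] : exists N, forall n, N <= n -> is_renewal renewal_bound n.
  by rewrite /renewal_bound; case: cid.
by exists (N + l + l'); apply/asboolP; split; try apply: HN; lia.
Qed.

(** This measures how far two processes, that have to wait [l] and [l'] steps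
    before their next renewal, are from renewing together. Only finitely many
    waiting times are used afterwards, so that each step towards the meeting has
    a probability bounded below. *)
Definition sync_time l l' : nat := ex_minn (syncs_ex l l').

Lemma sync_timeP l l' : syncs l l' (sync_time l l').
Proof. by rewrite /sync_time; case: ex_minnP => n /asboolP. Qed.

Lemma sync_time_le l l' n : syncs l l' n -> sync_time l l' <= n.
Proof.
by rewrite /sync_time => s; case: ex_minnP => m _; apply; apply/asboolP.
Qed.

Lemma sync_time00 : sync_time 0 0 = 0.
Proof.
by apply/eqP; rewrite -leqn0 sync_time_le//; split => //; exact: renewal0.
Qed.

Lemma sync_timeC l l' : sync_time l l' = sync_time l' l.
Proof.
by apply/eqP; rewrite eqn_leq !sync_time_le//;
  [have [] := sync_timeP l l'|have [] := sync_timeP l' l].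
Qed.

Lemma sync_time_down l l' : sync_time l l' < sync_time l.+1 l'.+1.
Proof.
have [a b c d] := sync_timeP l.+1 l'.+1.
set n := sync_time _ _ in a b c d *.
have n0 : 0 < n by lia.
rewrite -[n](prednK n0) ltnS; apply: sync_time_le; split; try lia.
  by rewrite (_ : _ - _ = n - l.+1)//; lia.
by rewrite (_ : _ - _ = n - l'.+1)//; lia.
Qed.

(** The first column of a decomposition of the remaining time as a sum of heights
    leads towards the meeting. *)
Lemma sync_time_jump l : exists2 a, a <= renewal_bound &
  sync_time l (h a).-1 < sync_time l.+1 0.
Proof.
have [ln _ rl] := sync_timeP l.+1 0.
set n := sync_time _ _ in ln rl *.
rewrite subn0; case E : n / => [|a m aA rm]; first by rewrite E in ln.
exists a => //; have ha := h_gt0 a.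
rewrite -E -[n](prednK (leq_trans _ ln))// ltnS.
apply: sync_time_le; split; try lia.
  by rewrite (_ : _ - _ = n - l.+1)//; lia.
by rewrite (_ : _ - _ = m)//; lia.
Qed.

End synchronisation.

(** * Backward chains and their coupling *)

Definition label_sep (X : Type) (step : X -> X) (label : X -> nat * nat) x y :=
  first_time (fun n => label (iter n step x) <> label (iter n step y)).

(** An orbit of the tower, read backwards. A point above the base has a single
    preimage, one level below; a point of the base has one preimage at the top
    of each column [a], which is chosen with probability [weight x a]. By
    [weight_distortion] this choice depends little on the distant future of [x].
    The factor [3] in [weight_tail] makes the third power of the exponential of
    the level integrable. *)
Record backward_chain (R : realType) (X : Type) := {
  step : X -> X;
  label : X -> nat * nat;
  col_height : nat -> nat;
  branch : nat -> X -> X;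
  weight : X -> nat -> R;
  sep_ratio : R;
  distortion : R;
  tail_rate : R;
  tail_bound : R;
  col_height_gt0 : forall a, (0 < col_height a)%N;
  col_height_gcd : is_gcd (range col_height) 1%N;
  branchK : forall a x, step (branch a x) = x;
  label_branch : forall a x, label (branch a x) =
    if (label x).2 is l.+1 then ((label x).1, l) else (a, (col_height a).-1);
  branch_up : forall a b x l,
    (label x).2 = l.+1 -> branch a x = branch b x;
  weight_ge0 : forall x a, 0 <= weight x a;
  weight1 : forall x, avg (weight x) (cst 1%E) = 1%E;
  weight_gt0 : forall x a, (label x).2 = 0%N -> 0 < weight x a;
  sep_ratio_itv : 0 < sep_ratio < 1;
  distortion_ge0 : 0 <= distortion;
  weight_distortion : forall x y a, (label x).2 = 0%N -> (label y).2 = 0%N ->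
    weight x a <=
    (1 + distortion * exp_time sep_ratio (label_sep step label x y)) * weight y a;
  tail_rate_gt0 : 0 < tail_rate;
  weight_tail : forall x, (label x).2 = 0%N ->
    (avg (weight x) (fun a => (expR (3 * tail_rate * (col_height a)%:R))%:E)
     <= tail_bound%:E)%E
}.

Lemma first_timeS (P : nat -> Prop) : ~ P 0%N ->
  first_time P = omap succn (first_time (fun n => P n.+1)).
Proof.
move=> P0; rewrite /first_time; case: pselect => [ex|nex]; case: pselect => [ex'|nex'].
- congr Some; case: ex_minnP => n /asboolP Pn nmin.
  case: ex_minnP => m /asboolP Pm mmin; apply/eqP; rewrite eqn_leq.
  apply/andP; split; first by apply: nmin; exact/asboolP.
  by case: n Pn nmin => // n Pn _; rewrite ltnS; apply: mmin; exact/asboolP.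
- exfalso; case: ex => -[/asboolP //|n Pn]; by apply: nex'; exists n.
- by exfalso; case: ex' => n Pn; apply: nex; exists n.+1.
- by [].
Qed.

Lemma first_time0 (P : nat -> Prop) : P 0%N -> first_time P = Some 0%N.
Proof.
move=> P0; rewrite /first_time; case: pselect => [ex|[]]; last first.
  by exists 0%N; exact/asboolP.
by congr Some; case: ex_minnP => n _ /(_ 0%N) /=; rewrite leqn0 => /(_ (asboolT P0))/eqP.
Qed.

Section coupling_contraction.
Context {R : realType} {X : Type} (c : backward_chain R X).
Local Notation T := (step c).
Local Notation lab := (label c).
Local Notation h := (col_height c).
Local Notation br := (branch c).
Local Notation p := (weight c).
Local Notation beta := (sep_ratio c).
Local Notation C := (distortion c).
Local Notation B := (tail_bound c).

Definition level x := (lab x).2.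
Definition sep x y := label_sep T lab x y.
Definition dist x y : R := exp_time beta (sep x y).
(** A Lyapunov function: backwards in time, it contracts above the base and has a
    bounded mean after a jump from the base. *)
Definition tower_exp x : R := expR (tail_rate c * (level x)%:R).
Local Notation V := tower_exp.

Lemma sep_neq x y : lab x != lab y -> sep x y = Some 0%N.
Proof. by move=> /eqP xy; exact: first_time0. Qed.

Lemma sep_eq x y : lab x = lab y -> sep x y = omap succn (sep (T x) (T y)).
Proof.
move=> xy; rewrite /sep /label_sep first_timeS//=; congr omap.
by congr first_time; apply/funext => n; rewrite -!iterSr.
Qed.

Lemma sep_branch a b x y : lab (br a x) = lab (br b y) ->
  sep (br a x) (br b y) = omap succn (sep x y).
Proof. by move=> /sep_eq ->; rewrite !branchK. Qed.

Lemma beta_gt0 : 0 < beta. Proof. by case/andP: (sep_ratio_itv c). Qed.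
Lemma beta_lt1 : beta < 1. Proof. by case/andP: (sep_ratio_itv c). Qed.
Lemma C_ge0 : 0 <= C. Proof. exact: distortion_ge0. Qed.
Hint Resolve beta_gt0 beta_lt1 C_ge0 : core.

Lemma dist_ge0 x y : 0 <= dist x y.
Proof. by rewrite /dist; case: sep => //= n; rewrite exprn_ge0// ltW. Qed.

Lemma dist_le1 x y : dist x y <= 1.
Proof.
by rewrite /dist; case: sep => //= n; rewrite exprn_ile1// ltW.
Qed.

Lemma V_ge1 x : 1 <= V x.
Proof.
by rewrite /V -expR0 ler_expR mulr_ge0// ltW// tail_rate_gt0.
Qed.

Lemma V_gt0 x : 0 < V x. Proof. exact: expR_gt0. Qed.

Lemma level_branch_base a x : level x = 0%N -> level (br a x) = (h a).-1.
Proof. by rewrite /level label_branch => ->. Qed.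

Lemma level_branch_up a x l : level x = l.+1 -> level (br a x) = l.
Proof. by rewrite /level label_branch => ->. Qed.

Definition decay : R := expR (- tail_rate c).

Lemma V_branch_up a x l : level x = l.+1 -> V (br a x) = decay * V x.
Proof.
move=> xl; rewrite /V (level_branch_up _ xl) xl /decay -expRD; congr expR.
by rewrite -natr1; ring.
Qed.

Lemma V_branch_base_cube a x : level x = 0%N ->
  V (br a x) ^+ 3 <= expR (3 * tail_rate c * (h a)%:R).
Proof.
move=> x0; rewrite /V (level_branch_base _ x0) -expRM_natl ler_expR.
rewrite -mulrA; apply: ler_wpM2l => //; apply: ler_wpM2l.
  by rewrite ltW// tail_rate_gt0.
by rewrite ler_nat leq_pred.
Qed.

Lemma avg_V_cube x : level x = 0%N ->
  (avg (p x) (fun a => (V (br a x) ^+ 3)%:E) <= B%:E)%E.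
Proof.
move=> x0; apply: le_trans (weight_tail x0); apply: le_avg.
- exact: weight_ge0.
- by move=> a; rewrite lee_fin exprn_ge0// ltW// V_gt0.
- by move=> a; rewrite lee_fin V_branch_base_cube.
Qed.

Lemma avg_V x : level x = 0%N -> (avg (p x) (fun a => (V (br a x))%:E) <= B%:E)%E.
Proof.
move=> x0; apply: le_trans (avg_V_cube x0); apply: le_avg.
- exact: weight_ge0.
- by move=> a; rewrite lee_fin ltW// V_gt0.
- by move=> a; rewrite lee_fin; apply: ler_eXnr => //; exact: V_ge1.
Qed.

Lemma tail_bound_ge1 x : level x = 0%N -> 1 <= B.
Proof.
move=> x0; rewrite -lee_fin; apply: le_trans (avg_V x0).
rewrite -(weight1 c x); apply: le_avg => [a|a|a]; rewrite ?lee_fin ?V_ge1//.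
exact: weight_ge0.
Qed.

Section base_pair.
Variables x y : X.

(** If each of two probabilities is at most [1 + C d] times the other, then both
    are at most [1 + C d] times their minimum, and the part of each which exceeds
    the minimum is at most this fraction of it. *)
Definition mismatch : R := C * dist x y / (1 + C * dist x y).
Local Notation q := mismatch.

Let Cd0 : 0 <= C * dist x y. Proof. by rewrite mulr_ge0// dist_ge0. Qed.
Let den0 : 0 < 1 + C * dist x y. Proof. by rewrite ltr_pwDl. Qed.

Lemma mismatch_ge0 : 0 <= q. Proof. by rewrite divr_ge0// ltW. Qed.

Lemma mismatchE : 1 - q = (1 + C * dist x y)^-1.
Proof. by rewrite /q; field; rewrite gt_eqF. Qed.

Lemma mismatch_le_dist : q <= C * dist x y.
Proof. by rewrite ler_pdivrMr// ler_peMr// lerDl. Qed.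

Lemma mismatch_le : q <= 1 - (1 + C)^-1.
Proof.
suff : (1 + C)^-1 <= 1 - q by lra.
by rewrite mismatchE lef_pV2 ?posrE// ?ltr_pwDl// lerD2l ler_piMr// dist_le1.
Qed.

End base_pair.

Lemma sepC x y : sep x y = sep y x.
Proof.
rewrite /sep /label_sep; congr first_time; apply/funext => n.
by apply/propext; split => + e; apply.
Qed.

Lemma distC x y : dist x y = dist y x. Proof. by rewrite /dist sepC. Qed.

Lemma excess_le x y a : level x = 0%N -> level y = 0%N ->
  p x a - Num.min (p x a) (p y a) <= mismatch x y * p x a.
Proof.
move=> x0 y0; suff : (1 - mismatch x y) * p x a <= Num.min (p x a) (p y a) by lra.
have den0 : 0 < 1 + C * dist x y by rewrite ltr_pwDl// mulr_ge0// dist_ge0.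
rewrite le_min; apply/andP; split.
  by rewrite ler_piMl ?weight_ge0// gerBl mismatch_ge0.
by rewrite mismatchE ler_pdivrMl//; exact: weight_distortion.
Qed.

Lemma mismatchC x y : mismatch x y = mismatch y x.
Proof. by rewrite /mismatch distC. Qed.

(** The labels differ with probability at most [mismatch x y], and the mean of the
    tower function on this event is at most [mismatch x y * B], because excess and
    deficit are bounded by [mismatch x y] times the weights. *)
Lemma couple_base x y (m eta : R) (H : nat -> nat -> \bar R) :
  level x = 0%N -> level y = 0%N -> 0 <= m <= 1 -> 0 <= eta ->
  (forall a b, (0 <= H a b)%E) ->
  (forall a, (H a a <= m%:E)%E) ->
  (forall a b, (H a b <= (1 + eta * (V (br a x) + V (br b y)))%:E)%E) ->
  (couple (p x) (p y) H <=
   (m + mismatch x y * (1 - m + 2 * eta * B))%:E)%E.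
Proof.
move=> x0 y0 /andP[m0 m1] eta0 H0 Hm HV.
have px := @weight_ge0 _ _ c x; have py := @weight_ge0 _ _ c y.
pose F a := (eta * V (br a x))%:E; pose G a := (eta * V (br a y))%:E.
have F0 a : (0 <= F a)%E by rewrite lee_fin mulr_ge0// ltW// V_gt0.
have G0 a : (0 <= G a)%E by rewrite lee_fin mulr_ge0// ltW// V_gt0.
have := @couple_le_defect _ _ _ px py (weight1 _ x) (weight1 _ y)
  m 1 F G H m0 ler01 F0 G0 H0 Hm.
have HFG a b : (H a b <= 1%:E + (F a + G b))%E.
  by apply: le_trans (HV a b) _; rewrite -!EFinD mulrDr.
move=> /(_ HFG) /le_trans; apply.
have q0 := mismatch_ge0 x y.
have dq : defect (p x) (p y) <= mismatch x y.
  rewrite -lee_fin -avg_excess1//; last exact: weight1.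
  have -> : (mismatch x y)%:E = avg (fun a => mismatch x y * p x a) (cst 1%E).
    by rewrite avgZl// weight1 mule1.
  apply: le_avgl => [a|//|a]; last exact: excess_le.
  exact: excess_ge0.
have ex : (avg (excess (p x) (p y)) F <= (mismatch x y * (eta * B))%:E)%E.
  apply: (@le_trans _ _ (avg (fun a => mismatch x y * p x a) F)).
    apply: le_avgl => [a|//|a]; last exact: excess_le.
    exact: excess_ge0.
  rewrite avgZl// (EFinM (mismatch x y)); apply: lee_wpmul2l; first by rewrite lee_fin.
  rewrite /F [X in avg _ X](_ : _ = fun a => (eta%:E * (V (br a x))%:E)%E)//.
  rewrite avgZ// ?EFinM; last by move=> a; rewrite lee_fin ltW// V_gt0.
  by apply: lee_wpmul2l; rewrite ?lee_fin//; exact: avg_V.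
have de : (avg (deficit (p x) (p y)) G <= (mismatch x y * (eta * B))%:E)%E.
  apply: (@le_trans _ _ (avg (fun a => mismatch x y * p y a) G)).
    apply: le_avgl => [a|//|a]; first exact: deficit_ge0.
    by rewrite /deficit /common minC mismatchC; exact: excess_le.
  rewrite avgZl// (EFinM (mismatch x y)); apply: lee_wpmul2l; first by rewrite lee_fin.
  rewrite /G [X in avg _ X](_ : _ = fun a => (eta%:E * (V (br a y))%:E)%E)//.
  rewrite avgZ// ?EFinM; last by move=> a; rewrite lee_fin ltW// V_gt0.
  by apply: lee_wpmul2l; rewrite ?lee_fin//; exact: avg_V.
apply: le_trans (leeD (le_refl _) (leeD ex de)) _.
rewrite -!EFinD lee_fin.
suff : defect (p x) (p y) * (1 - m) <= mismatch x y * (1 - m) by lra.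
by apply: ler_wpM2r dq; rewrite subr_ge0.
Qed.

End coupling_contraction.

Section lyapunov.
Context {R : realType} {X : Type} (c : backward_chain R X).
Local Notation T := (step c).
Local Notation lab := (label c).
Local Notation h := (col_height c).
Local Notation br := (branch c).
Local Notation p := (weight c).
Local Notation beta := (sep_ratio c).
Local Notation C := (distortion c).
Local Notation B := (tail_bound c).
Local Notation V := (tower_exp c).
Local Notation lev := (level c).
Local Notation lambda := (decay c).
Let hgt0 := col_height_gt0 c.
Let hgcd := col_height_gcd c.
Local Notation st := (sync_time hgt0 hgcd).
Local Notation A := (renewal_bound hgt0 hgcd).

Let beta0 : 0 < beta. Proof. by case/andP: (sep_ratio_itv c). Qed.
Let beta1 : beta < 1. Proof. by case/andP: (sep_ratio_itv c). Qed.
Let C0 : 0 <= C. Proof. exact: distortion_ge0. Qed.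
(** Two points of the base choose the same label with at least this
    probability, whatever their futures. *)
Definition overlap : R := (1 + C)^-1.
Local Notation kappa := overlap.
Let kappa0 : 0 < kappa. Proof. by rewrite invr_gt0 ltr_pwDl. Qed.
Let kappa1 : kappa <= 1. Proof. by rewrite invf_le1 ?lerDl// ltr_pwDl. Qed.

Variables (s0 : nat) (zeta R0 vmin : R).
Hypothesis B1 : 1 <= B.
Hypothesis lambda_itv : 0 < lambda < 1.
Hypothesis s0_gt0 : (0 < s0)%N.
Hypothesis s0_large : 4 * C * beta ^+ s0 <= (1 - beta) / 2.
Hypothesis zeta_gt0 : 0 < zeta.
Hypothesis zeta_half : zeta <= 1 / 2.
Hypothesis weight_zeta : forall x a,
  lev x = 0%N -> (a <= A)%N -> 2 * zeta <= p x a.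

(** Here [k] is the number of agreements that are missing to reach [s0]. Since
    the labels agree with probability at least [kappa], the ratio [kappa / 2]
    makes the bonus double in mean at each jump. *)
Definition bonus (k : nat) : R := (kappa / 2) ^+ k / 2.
Local Notation v0 := (bonus s0).
(** A step towards a common renewal has probability at least [2 * zeta], so that
    this bonus doubles in mean too. *)
Definition sync_bonus l l' : R := v0 * zeta ^+ st l l'.

Hypothesis R0_large : 2 * B + 1 <= (1 - lambda) / 2 * R0.
Hypothesis vmin_gt0 : 0 < vmin.
Hypothesis vmin_le : forall x y, V x + V y <= R0 -> vmin <= sync_bonus (lev x) (lev y).

Variables eta rho : R.
Hypothesis etaE : eta = vmin / (4 * B).
Hypothesis rho_eta : 1 - rho <= eta.
Hypothesis rho_vmin : 1 - rho <= vmin / 2.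
Hypothesis rho_lambda : 1 - rho <= (1 - lambda) / 2.
Hypothesis rho_beta : 1 - rho <= (1 - beta) / 2.
Hypothesis rho_itv : 0 < rho < 1.
Hypothesis vmin_v0 : vmin <= v0.

Lemma bonus_gt0 k : 0 < bonus k.
Proof. by rewrite divr_gt0// exprn_gt0// divr_gt0. Qed.

Lemma bonus_le_half k : bonus k <= 1 / 2.
Proof.
rewrite ler_wpM2r//; apply: exprn_ile1.
- by rewrite divr_ge0// ltW.
- by rewrite ler_pdivrMr// mul1r; move: kappa1; lra.
Qed.

Lemma bonusS k : kappa * bonus k = 2 * bonus k.+1.
Proof. by rewrite /bonus exprS; field. Qed.

Lemma bonus_decr k l : (k <= l)%N -> bonus l <= bonus k.
Proof.
move=> kl; rewrite ler_wpM2r//; apply: ler_wiXn2l => //.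
- by rewrite divr_ge0// ltW.
- by rewrite ler_pdivrMr// mul1r; move: kappa1; lra.
Qed.

Let eta0 : 0 < eta. Proof. by rewrite etaE divr_gt0// mulr_gt0//; move: B1; lra. Qed.
Let etaB : 2 * eta * B = vmin / 2. Proof. by rewrite etaE; field; rewrite gt_eqF//; move: B1; lra. Qed.

Definition matched_cost (s : option nat) : R :=
  if s is Some n then
    if (n < s0)%N then 1 - bonus (s0 - n) else beta ^+ (n - s0) / 2
  else 0.

Lemma matched_cost_ge0 s : 0 <= matched_cost s.
Proof.
case: s => //= n; case: ifP => _.
  by have := bonus_le_half (s0 - n); lra.
by rewrite divr_ge0// exprn_ge0// ltW.
Qed.

Lemma matched_cost_le s : matched_cost s <= 1 - v0.
Proof.
case: s => /= [n|].
  case: ifP => _; first by rewrite lerD2l lerN2 bonus_decr// leq_subr.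
  have : beta ^+ (n - s0) <= 1 by rewrite exprn_ile1// ltW.
  by have := bonus_le_half s0; lra.
by have := bonus_le_half s0; lra.
Qed.

Lemma matched_costS n : matched_cost (Some n.+1) =
  if (n < s0)%N then 1 - bonus (s0 - n.+1) else beta * beta ^+ (n - s0) / 2.
Proof.
rewrite /=; case: (ltnP n s0) => ns.
  case: ltnP => // h1; have -> : s0 = n.+1 by apply/eqP; rewrite eqn_leq ns h1.
  by rewrite subnn /bonus !expr0; lra.
by rewrite ltnNge (leqW ns)/= subSn// exprS.
Qed.

Lemma matched_cost_up s :
  matched_cost (omap succn s) <= rho * matched_cost s.
Proof.
case: s => [n|]; last by rewrite /= mulr0.
rewrite [X in X <= _]matched_costS /=; case: ifP => ns.
  have := bonusS (s0 - n.+1); rewrite subnSK// => e.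
  have b1 := bonus_gt0 (s0 - n.+1).
  have b0 := bonus_gt0 (s0 - n).
  have : vmin <= bonus (s0 - n) by apply: le_trans vmin_v0 (bonus_decr (leq_subr _ _)).
  have : kappa * bonus (s0 - n.+1) <= bonus (s0 - n.+1) by rewrite ler_piMl// ltW.
  by have := rho_itv; move: rho_vmin; nra.
have : 0 <= beta ^+ (n - s0) by rewrite exprn_ge0// ltW.
by move: rho_beta beta1; nra.
Qed.

(** Here [q] stands for the probability that the labels differ. The bound
    [1 - kappa] is used for the first [s0] agreements, the bound by the distance
    afterwards. *)
Lemma matched_cost_base s q : 0 <= q -> q <= 1 - kappa ->
  q <= C * exp_time beta s ->
  matched_cost (omap succn s) + q * (1 - matched_cost (omap succn s) + 2 * eta * B)
  <= rho * matched_cost s.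
Proof.
move=> q0 qk; rewrite etaB; case: s => [n|] qC; last first.
  have -> : q = 0 by apply/eqP; rewrite eq_le q0 (le_trans qC) //= mulr0.
  by rewrite /= mul0r mulr0 addr0.
rewrite [omap _ _]/= matched_costS /= in qC *; case: ifP => ns.
  have := bonusS (s0 - n.+1); rewrite subnSK// => e.
  have b1 := bonus_gt0 (s0 - n.+1).
  have b0 := bonus_gt0 (s0 - n).
  have vb : vmin <= bonus (s0 - n).
    by apply: le_trans vmin_v0 (bonus_decr (leq_subr _ _)).
  have : q * bonus (s0 - n.+1) <= (1 - kappa) * bonus (s0 - n.+1).
    by rewrite ler_wpM2r// ltW.
  have : q * vmin <= vmin.
    apply: ler_piMl; first by rewrite ltW.
    by apply: le_trans qk _; rewrite gerBl ltW.
  by have := rho_itv; move: rho_vmin vmin_gt0; nra.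
have b0 : 0 < beta ^+ (n - s0) by rewrite exprn_gt0.
have bn : beta ^+ n = beta ^+ s0 * beta ^+ (n - s0).
  by rewrite -exprD subnKC// leqNgt ns.
have vm : vmin / 2 <= 1 by have := bonus_le_half s0; move: vmin_v0; lra.
have q2 : q * (1 - beta * beta ^+ (n - s0) / 2 + vmin / 2) <= 2 * q.
  by rewrite mulrC; apply: ler_wpM2r => //; have := mulr_gt0 beta0 b0; lra.
apply: le_trans (lerD (le_refl _) q2) _.
have : 2 * q <= (1 - beta) / 4 * beta ^+ (n - s0).
  by rewrite bn mulrA in qC; move: s0_large; nra.
have : (1 - rho) * beta ^+ (n - s0) <= (1 - beta) / 2 * beta ^+ (n - s0).
  by rewrite ler_wpM2r// ltW.
by lra.
Qed.

Definition free_cost x y : R :=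
  1 - sync_bonus (lev x) (lev y) + eta * (V x + V y).

(** The cost of a pair of points. In the same cell, this is the price of a future
    separation: it decays exponentially with the number of agreeing letters once
    there are [s0] of them, and before that it is one minus a bonus that grows at
    each agreement. In different cells, it is one, plus a multiple of the tower
    function, which contracts far from the base, minus a bonus that grows when a
    common return to the base gets closer. *)
Definition cost x y : R :=
  if lab x == lab y then matched_cost (sep c x y) else free_cost x y.

Lemma sync_bonus_gt0 l l' : 0 < sync_bonus l l'.
Proof. by rewrite mulr_gt0 ?bonus_gt0// exprn_gt0. Qed.

Lemma sync_bonus_le l l' : sync_bonus l l' <= v0.
Proof.
apply: ler_piMr; first by rewrite ltW// bonus_gt0.
by apply: exprn_ile1; [rewrite ltW|move: zeta_half; lra].
Qed.

Lemma sync_bonus_step l l' m m' : (st m m' < st l l')%N ->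
  sync_bonus l l' <= zeta * sync_bonus m m'.
Proof.
move=> lt; rewrite /sync_bonus mulrCA; apply: ler_wpM2l.
  by rewrite ltW// bonus_gt0.
rewrite -exprS; apply: ler_wiXn2l => //; first by rewrite ltW.
by move: zeta_half; lra.
Qed.

Lemma sync_bonusC l l' : sync_bonus l l' = sync_bonus l' l.
Proof. by rewrite /sync_bonus sync_timeC. Qed.

Let V1 := V_ge1 c.
Let V0 := V_gt0 c.

Lemma cost_free x y : cost x y <= free_cost x y.
Proof.
rewrite /cost; case: ifP => // _; apply: le_trans (matched_cost_le _) _.
rewrite -[leLHS]addr0; apply: lerD.
  by rewrite lerD2l lerN2 sync_bonus_le.
by rewrite ltW// mulr_gt0// addr_gt0.
Qed.

Lemma free_cost_le x y : free_cost x y <= 1 + eta * (V x + V y).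
Proof. by rewrite lerD2r gerBl ltW// sync_bonus_gt0. Qed.

Lemma cost_ge0 x y : 0 <= cost x y.
Proof.
rewrite /cost; case: ifP => _; first exact: matched_cost_ge0.
have := sync_bonus_le (lev x) (lev y); have := bonus_le_half s0.
have : 0 < eta * (V x + V y) by rewrite mulr_gt0// addr_gt0.
by rewrite /free_cost; lra.
Qed.

Lemma cost_neq x y : lab x != lab y -> 1 / 2 <= cost x y.
Proof.
move=> /negbTE xy; rewrite /cost xy.
have := sync_bonus_le (lev x) (lev y); have := bonus_le_half s0.
have : 0 < eta * (V x + V y) by rewrite mulr_gt0// addr_gt0.
by rewrite /free_cost; lra.
Qed.

(** Far from the base the tower function contracts; near the base the bonus
    doubles. *)
Lemma free_cost_drift x y :
  1 - 2 * sync_bonus (lev x) (lev y) + eta * (lambda * (V x + V y) + 2 * B)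
  <= rho * free_cost x y.
Proof.
rewrite /free_cost; set S := V x + V y; set vt := sync_bonus _ _.
have vt0 : 0 < vt := sync_bonus_gt0 _ _.
have S0 : 0 < S by rewrite addr_gt0.
have eB : eta * (lambda * S + 2 * B) = eta * lambda * S + vmin / 2.
  by rewrite -etaB; ring.
have eS : 0 < eta * S by rewrite mulr_gt0.
have := rho_itv; have := lambda_itv; have := rho_vmin; have := rho_lambda.
have := rho_eta; have [SR|SR] := leP S R0.
  have vv : vmin <= vt by exact: vmin_le.
  rewrite eB => re rl rv l1 r1.
  have : eta * S * lambda <= eta * S * rho.
    by apply: ler_wpM2l; [rewrite ltW|lra].
  by nra.
move=> re rl rv l1 r1; have SB : 2 * B + 1 <= (1 - lambda) / 2 * S.
  apply: le_trans R0_large _; apply: ler_wpM2l; last by rewrite ltW.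
  by lra.
have : eta * (2 * B + 1) <= eta * ((rho - lambda) * S).
  apply: ler_wpM2l; first by rewrite ltW.
  apply: le_trans SB _; apply: ler_wpM2r; first by rewrite ltW.
  by lra.
have : rho * vt <= vt by apply: ler_piMl; [rewrite ltW|lra].
by lra.
Qed.

(** Some column brings the pair closer to a common return to the base, and it is
    chosen with probability at least [2 * zeta]. *)
Lemma free_cost_jump l vx y : lev y = 0%N -> 0 <= vx ->
  (avg (p y) (fun b => (1 - sync_bonus l (h b).-1 + eta * (vx + V (br b y)))%:E)
   <= (1 - 2 * sync_bonus l.+1 0 + eta * (vx + B))%:E)%E.
Proof.
move=> y0 vx0; have [a aA lt] := sync_time_jump hgt0 hgcd l.
have py := @weight_ge0 _ _ c y.
set v := sync_bonus l (h a).-1.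
have v01 : 0 <= v <= 1.
  have := sync_bonus_le l (h a).-1; have := sync_bonus_gt0 l (h a).-1.
  by have := bonus_le_half s0; rewrite -/v; lra.
apply: (@le_trans _ _ (avg (p y) (fun b => (1 - (b == a)%:R * v)%:E +
   ((eta * vx)%:E + eta%:E * (V (br b y))%:E))%E)).
  apply: le_avg => // b.
    rewrite lee_fin; have := sync_bonus_le l (h b).-1; have := bonus_le_half s0.
    have : 0 < eta * (vx + V (br b y)) by rewrite mulr_gt0// ltr_wpDl.
    by lra.
  rewrite -EFinM -!EFinD lee_fin mulrDr lerD2r lerD2l lerN2.
  by case: eqP => [->|_]; rewrite ?mul1r// mul0r ltW// sync_bonus_gt0.
rewrite avgD//; last 2 first.
- move=> b; rewrite lee_fin subr_ge0; case: eqP => _; rewrite ?mul1r ?mul0r//.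
  by case/andP: v01.
- by move=> b; rewrite -EFinM -EFinD lee_fin addr_ge0// mulr_ge0// ltW.
rewrite avg_drop ?weight1// avgD//; last 2 first.
- by move=> b; rewrite lee_fin mulr_ge0// ltW.
- by move=> b; rewrite -EFinM lee_fin ltW// mulr_gt0.
rewrite avg_cst// weight1 mule1 avgZ//; last by move=> b; rewrite lee_fin ltW.
apply: (@le_trans _ _ ((1 - p y a * v)%:E + ((eta * vx)%:E + eta%:E * B%:E))%E).
  apply: leeD2l; apply: leeD2l; apply: lee_wpmul2l; last exact: avg_V.
  by rewrite lee_fin ltW.
rewrite -EFinM -!EFinD lee_fin mulrDr lerD2r lerD2l lerN2.
apply: (@le_trans _ _ (2 * (zeta * v))); first by rewrite ler_wpM2l// sync_bonus_step.
by rewrite mulrA; apply: ler_wpM2r; [case/andP: v01|exact: weight_zeta].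
Qed.

Lemma avg_weight_cst x (k : R) : avg (p x) (fun=> k%:E) = k%:E.
Proof. by rewrite (avg_cst _ (@weight_ge0 _ _ c x)) weight1 mule1. Qed.

Lemma cost_contracts x y :
  (couple (p x) (p y) (fun a b => (cost (br a x) (br b y))%:E)
   <= (rho * cost x y)%:E)%E.
Proof.
have px := @weight_ge0 _ _ c x; have py := @weight_ge0 _ _ c y.
have H0 a b : (0 <= (cost (br a x) (br b y))%:E)%E by rewrite lee_fin cost_ge0.
have vV u : 0 <= lambda * V u.
  by rewrite ltW// mulr_gt0//; case/andP: lambda_itv.
case lx : (lev x) => [|l]; case ly : (lev y) => [|l'].
(* With both points in the base, the letters disagree with probability at
   most [mismatch x y]. *)
- pose m := matched_cost (omap succn (sep c x y)).
  have m01 : 0 <= m <= 1.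
    rewrite /m matched_cost_ge0 (le_trans (matched_cost_le _))// gerBl.
    by rewrite ltW// bonus_gt0.
  apply: le_trans (couple_base lx ly m01 (ltW eta0) H0 _ _) _.
  + move=> a; rewrite lee_fin /cost.
    have e : lab (br a x) = lab (br a y).
      by rewrite !label_branch -!/(level _ _) lx ly.
    by rewrite e eqxx sep_branch.
  + by move=> a b; rewrite lee_fin (le_trans (cost_free _ _))// free_cost_le.
  rewrite lee_fin; apply: (@le_trans _ _ (rho * matched_cost (sep c x y))).
    apply: matched_cost_base; first exact: mismatch_ge0.
      exact: mismatch_le.
    exact: mismatch_le_dist.
  apply: ler_wpM2l; first by rewrite ltW//; case/andP: rho_itv.
  rewrite /cost; case: ifPn => // xy; rewrite sep_neq// /matched_cost s0_gt0 subn0.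
  rewrite /free_cost lx ly /sync_bonus sync_time00 expr0 mulr1 lerDl.
  by rewrite ltW// mulr_gt0// addr_gt0.
(* With only [x] in the base, its label is the only random one. *)
- have xy : lab x != lab y.
    by apply/eqP => e; move: lx ly; rewrite /level e => ->.
  pose G a := (1 - sync_bonus l' (h a).-1 + eta * (lambda * V y + V (br a x)))%:E.
  have HG a b : ((cost (br a x) (br b y))%:E <= G a)%E.
    rewrite lee_fin (le_trans (cost_free _ _))// /free_cost.
    rewrite (level_branch_base _ lx) (level_branch_up _ ly) sync_bonusC.
    by rewrite (V_branch_up _ ly) [lambda * _ + _]addrC.
  have G0 a : (0 <= G a)%E by apply: le_trans (HG a 0%N).
  apply: (@le_trans _ _ (avg (p x) G)).
    rewrite -(couple_fst px py (weight1 _ x) (weight1 _ y))//.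
    exact: le_couple.
  apply: le_trans (free_cost_jump l' lx (vV y)) _.
  rewrite lee_fin /cost (negbTE xy); apply: le_trans _ (free_cost_drift x y).
  rewrite lx ly sync_bonusC lerD2l; apply: ler_wpM2l; first by rewrite ltW.
  by have := vV x; move: B1; rewrite mulrDr; lra.
- have xy : lab x != lab y.
    by apply/eqP => e; move: lx ly; rewrite /level e => ->.
  pose G b := (1 - sync_bonus l (h b).-1 + eta * (lambda * V x + V (br b y)))%:E.
  have HG a b : ((cost (br a x) (br b y))%:E <= G b)%E.
    rewrite lee_fin (le_trans (cost_free _ _))// /free_cost.
    rewrite (level_branch_base _ ly) (level_branch_up _ lx).
    by rewrite (V_branch_up _ lx).
  have G0 b : (0 <= G b)%E by apply: le_trans (HG 0%N b).
  apply: (@le_trans _ _ (avg (p y) G)).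
    rewrite -(couple_snd px py (weight1 _ x) (weight1 _ y))//.
    exact: le_couple.
  apply: le_trans (free_cost_jump l ly (vV x)) _.
  rewrite lee_fin /cost (negbTE xy); apply: le_trans _ (free_cost_drift x y).
  rewrite lx ly lerD2l; apply: ler_wpM2l; first by rewrite ltW.
  by have := vV y; move: B1; rewrite mulrDr; lra.
(* With no point in the base, nothing is random and the cost of the only pair
   of preimages decreases. *)
- have cst_bound (k : R) : (forall a b, cost (br a x) (br b y) <= k) ->
    (couple (p x) (p y) (fun a b => (cost (br a x) (br b y))%:E) <= k%:E)%E.
    move=> ck; have k0 : 0 <= k by apply: le_trans (ck 0%N 0%N); exact: cost_ge0.
    rewrite -(avg_weight_cst x k).
    rewrite -(couple_fst px py (weight1 _ x) (weight1 _ y))//.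
    by apply: le_couple => // a b; rewrite lee_fin.
  apply: cst_bound => a b; rewrite [cost x y]/cost.
  case: ifPn => [/eqP xy|xy].
    have e : lab (br a x) = lab (br b y).
      by move: lx ly; rewrite !label_branch /level xy => ->.
    by rewrite /cost e eqxx sep_branch// matched_cost_up.
  apply: le_trans _ (free_cost_drift x y); apply: le_trans (cost_free _ _) _.
  rewrite /free_cost (V_branch_up _ lx) (V_branch_up _ ly).
  rewrite (level_branch_up _ lx) (level_branch_up _ ly) lx ly -mulrDr.
  have := sync_bonus_step (sync_time_down hgt0 hgcd l l').
  have b0 := sync_bonus_gt0 l l'.
  have : zeta * sync_bonus l l' <= 1 / 2 * sync_bonus l l' by rewrite ler_wpM2r// ltW.
  rewrite mulrDr; have : 0 < eta * (2 * B) by rewrite mulr_gt0//; move: B1; lra.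
  by lra.
Qed.

End lyapunov.

(** The parameters of the cost are fixed in this order: [s0], beyond which the
    distortion bound is effective; [ze], from the finitely many columns that are
    used to synchronise the chains; [R0], beyond which the contraction of the
    tower function wins over its mean after a jump; the least bonus [vmin] of the
    finitely many pairs of levels with [V x + V y <= R0]; and finally [eta] and
    [1 - rho], small with respect to [vmin]. *)
Lemma coupling_contraction {R : realType} {X : Type} (c : backward_chain R X) x0 :
  level c x0 = 0%N ->
  exists (W : X -> X -> R) (rho : R), [/\ 0 < rho < 1,
    forall x y, 0 <= W x y,
    forall x y, label c x != label c y -> 1 / 2 <= W x y,
    forall x y, W x y <= tower_exp c x + tower_exp c y &
    forall x y, (couple (weight c x) (weight c y)
       (fun a b => (W (branch c a x) (branch c b y))%:E) <= (rho * W x y)%:E)%E].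
Proof.
move=> lx0.
pose B := tail_bound c; pose C := distortion c; pose be := sep_ratio c.
have B1 : 1 <= B := tail_bound_ge1 lx0.
have C0 : 0 <= C := distortion_ge0 c.
have /andP[be0 be1] : 0 < be < 1 := sep_ratio_itv c.
have r0 : 0 < tail_rate c := tail_rate_gt0 c.
pose la := decay c.
have la0 : 0 < la by exact: expR_gt0.
have la1 : la < 1 by rewrite /la /decay -expR0 ltr_expR oppr_lt0.
pose h0 := col_height_gt0 c; pose hg := col_height_gcd c.
pose A := renewal_bound h0 hg.
have [n0 hn0] : exists n, forall m, (n <= m)%N -> 4 * C * be ^+ m <= (1 - be) / 2.
  by apply: geometric_small; [rewrite ltW|rewrite mulr_ge0|lra].
pose s0 := n0.+1.
have [z0 z0_gt0 hz0] := @finite_pos_min _ (weight c x0) A (fun a => weight_gt0 a lx0).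
pose z := Num.min 1 (z0 / (1 + C)).
have zpos : 0 < z by rewrite lt_min ltr01 divr_gt0// ltr_pwDl.
have zC : z * (1 + C) <= z0.
  by rewrite -ler_pdivlMr ?ltr_pwDl// ge_min lexx orbT.
have z1 : z <= 1 by rewrite ge_min lexx.
pose ze := z / 2.
have hze x a : level c x = 0%N -> (a <= A)%N -> 2 * ze <= weight c x a.
  move=> lx aA; rewrite /ze mulrCA mulfV// mulr1.
  have /le_trans := hz0 a aA => /(_ _ (weight_distortion a lx0 lx)) h.
  have C1 : 0 < 1 + C by rewrite ltr_pwDl.
  rewrite -(ler_pM2r C1) (le_trans zC)// (le_trans h)// mulrC.
  apply: ler_wpM2l; first exact: weight_ge0.
  by rewrite lerD2l ler_piMr//; exact: dist_le1.
pose v0 := bonus c s0.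
have v0_gt0 : 0 < v0 := bonus_gt0 c s0.
pose R0 := (2 * B + 1) * (2 / (1 - la)).
have R0E : 2 * B + 1 <= (1 - la) / 2 * R0.
  have l0 : 1 - la != 0 by rewrite gt_eqF// subr_gt0.
  suff -> : (1 - la) / 2 * R0 = 2 * B + 1 by [].
  by rewrite /R0; field.
pose N := (Num.truncn (R0 / tail_rate c)).+1.
pose tmax := (\max_(i < N) \max_(j < N) sync_time h0 hg i j)%N.
pose vmin := v0 * ze ^+ tmax.
have ze0 : 0 < ze by rewrite divr_gt0.
have ze1 : ze <= 1 / 2 by rewrite ler_wpM2r.
have vmin0 : 0 < vmin by rewrite mulr_gt0// exprn_gt0.
have vmin_v0 : vmin <= v0.
  apply: ler_piMr; first by rewrite ltW.
  by apply: exprn_ile1; [rewrite ltW|lra].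
have levN x : tower_exp c x <= R0 -> (level c x < N)%N.
  move=> xR; rewrite -(ltr_nat R); apply: le_lt_trans (truncnS_gt _).
  rewrite ler_pdivlMr// mulrC; apply: le_trans xR.
  by apply: le_trans (expR_ge1Dx _); rewrite lerDr.
have vmin_le x y : tower_exp c x + tower_exp c y <= R0 ->
    vmin <= sync_bonus c s0 ze (level c x) (level c y).
  move=> xyR; have Vx := V_ge1 c x; have Vy := V_ge1 c y.
  have xN : (level c x < N)%N by apply: levN; lra.
  have yN : (level c y < N)%N by apply: levN; lra.
  rewrite /sync_bonus; apply: ler_wpM2l; first by rewrite ltW.
  apply: ler_wiXn2l; [by rewrite ltW|lra|].
  apply: leq_trans (leq_bigmax (Ordinal xN)) => /=.
  exact: (leq_bigmax (F := fun j : 'I_N => sync_time h0 hg (level c x) j) (Ordinal yN)).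
pose eta := vmin / (4 * B).
have eta0 : 0 < eta by rewrite divr_gt0// mulr_gt0//; lra.
pose e := Num.min (Num.min eta (vmin / 2)) (Num.min ((1 - la) / 2) ((1 - be) / 2)).
have e0 : 0 < e by rewrite !lt_min eta0 !divr_gt0// subr_gt0.
have ee : e <= eta by rewrite !ge_min lexx.
have ev : e <= vmin / 2 by rewrite !ge_min lexx orbT.
have el : e <= (1 - la) / 2 by rewrite !ge_min lexx !orbT.
have eb : e <= (1 - be) / 2 by rewrite !ge_min lexx !orbT.
pose rho := 1 - e.
have rhoE : 1 - rho = e by rewrite /rho; ring.
have rho01 : 0 < rho < 1 by rewrite /rho; lra.
have la01 : 0 < decay c < 1 by rewrite la0.
have s0l : 4 * distortion c * sep_ratio c ^+ s0 <= (1 - sep_ratio c) / 2.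
  by apply: hn0; exact: leqnSn.
exists (cost c s0 ze eta), rho; split => //.
- by move=> x y; apply: (@cost_ge0 _ _ c s0 ze vmin).
- by move=> x y; apply: (@cost_neq _ _ c s0 ze vmin).
- move=> x y; apply: le_trans (@cost_free _ _ c s0 ze vmin B1 ze0 ze1 vmin0 eta erefl x y) _.
  apply: le_trans (@free_cost_le _ _ c s0 ze ze0 eta x y) _.
  have Vx := V_ge1 c x; have Vy := V_ge1 c y.
  have eta1 : eta <= 1 / 2.
    rewrite ler_pdivrMr ?mulr_gt0//; last by lra.
    have := bonus_le_half c s0; rewrite -/v0.
    by rewrite -/B; lra.
  have : eta * (tower_exp c x + tower_exp c y) <= 1 / 2 * (tower_exp c x + tower_exp c y).
    by apply: ler_wpM2r; lra.
  by lra.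
- by move=> x y; apply: (@cost_contracts _ _ c s0 ze R0 vmin); rewrite ?rhoE.
Qed.

(** * The transfer operator of a backward chain *)

Section transfer.
Context {R : realType} {X : Type} (c : backward_chain R X).
Local Notation T := (step c).
Local Notation lab := (label c).
Local Notation h := (col_height c).
Local Notation br := (branch c).
Local Notation p := (weight c).
Local Notation V := (tower_exp c).
Local Notation lev := (level c).
Implicit Types (f : X -> R) (M : R).

Definition transfer f x : R := fine (avg (p x) (fun a => (f (br a x))%:E)).

Definition bounded_by M f := forall x, 0 <= f x <= M.

Lemma avg_transfer M f x : bounded_by M f ->
  avg (p x) (fun a => (f (br a x))%:E) = (transfer f x)%:E /\
  0 <= transfer f x <= M.
Proof.
move=> fM; have px := @weight_ge0 _ _ c x.
have h0 : (0 <= avg (p x) (fun a => (f (br a x))%:E))%E.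
  by apply: avg_ge0 => // a; rewrite lee_fin; case/andP: (fM (br a x)).
have hM : (avg (p x) (fun a => (f (br a x))%:E) <= M%:E)%E.
  apply: (@le_trans _ _ (avg (p x) (cst M%:E))).
    by apply: le_avg => // a; rewrite lee_fin; case/andP: (fM (br a x)).
  by rewrite avg_cst// weight1 mule1.
have e : avg (p x) (fun a => (f (br a x))%:E) = (transfer f x)%:E.
  by rewrite /transfer fineK// ge0_fin_numE// (le_lt_trans hM)// ltry.
by split => //; rewrite -!lee_fin -e h0.
Qed.

Lemma bounded_transfer M f : bounded_by M f -> bounded_by M (transfer f).
Proof. by move=> fM x; have [] := avg_transfer x fM. Qed.

Lemma bounded_iter_transfer M f n :
  bounded_by M f -> bounded_by M (iter n transfer f).
Proof. by move=> fM; elim: n => //= n; exact: bounded_transfer. Qed.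

(** The bounded differences condition for the letters of the orbit. *)
Definition letterwise (N : nat) (delta : nat -> R) f := forall x y,
  f x <= f y + \sum_(j < N) delta j * (lab (iter j T x) != lab (iter j T y))%:R.

Variables (W : X -> X -> R) (rho : R).
Hypothesis rho01 : 0 < rho < 1.
Hypothesis W0 : forall x y, 0 <= W x y.
Hypothesis W_neq : forall x y, lab x != lab y -> 1 / 2 <= W x y.
Hypothesis W_le : forall x y, W x y <= V x + V y.
Hypothesis W_contracts : forall x y,
  (couple (p x) (p y) (fun a b => (W (br a x) (br b y))%:E) <= (rho * W x y)%:E)%E.

Let rho_gt0 : 0 < rho. Proof. by case/andP: rho01. Qed.
Let rho_lt1 : rho < 1. Proof. by case/andP: rho01. Qed.

(** A bound on the probability that two coupled backward chains disagree after
    [k] steps. *)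
Definition disagree k x y : R := Num.min 1 (2 * rho ^+ k * W x y).

Lemma disagree_ge0 k x y : 0 <= disagree k x y.
Proof. by rewrite le_min ler01 !mulr_ge0// exprn_ge0// ltW. Qed.

Lemma disagree_le1 k x y : disagree k x y <= 1.
Proof. by rewrite ge_min lexx. Qed.

Lemma disagree_le k x y : disagree k x y <= 2 * rho ^+ k * (V x + V y).
Proof.
rewrite ge_min; apply/orP; right; apply: ler_wpM2l => //.
by rewrite mulr_ge0// exprn_ge0// ltW.
Qed.

Lemma disagree0 x y : (lab x != lab y)%:R <= disagree 0 x y.
Proof.
have [e|ne] := eqVneq (lab x) (lab y); first exact: disagree_ge0.
by rewrite le_min lexx expr0 mulr1/=; have := W_neq ne; lra.
Qed.

Lemma couple_cst_le x y (k : R) (F : nat -> nat -> R) : (forall a b, 0 <= F a b <= k) ->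
  (couple (p x) (p y) (fun a b => (F a b)%:E) <= k%:E)%E.
Proof.
move=> Fk; have px := @weight_ge0 _ _ c x; have py := @weight_ge0 _ _ c y.
have -> : k%:E = avg (p x) (fun=> k%:E) by rewrite avg_cst// weight1 mule1.
have k0 : 0 <= k by case/andP: (Fk 0%N 0%N); exact: le_trans.
rewrite -(couple_fst px py (weight1 _ x) (weight1 _ y))//.
by apply: le_couple => // a b; rewrite lee_fin; case/andP: (Fk a b).
Qed.

Lemma couple_disagree k x y :
  (couple (p x) (p y) (fun a b => (disagree k (br a x) (br b y))%:E)
   <= (disagree k.+1 x y)%:E)%E.
Proof.
have px := @weight_ge0 _ _ c x; have py := @weight_ge0 _ _ c y.
rewrite [leRHS]EFin_min le_min; apply/andP; split.
  by apply: couple_cst_le => a b; rewrite disagree_ge0 disagree_le1.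
apply: (@le_trans _ _ (couple (p x) (p y) (fun a b =>
    ((2 * rho ^+ k)%:E * (W (br a x) (br b y))%:E)%E))).
  apply: le_couple => // a b; rewrite lee_fin; first exact: disagree_ge0.
  by rewrite ge_min lexx orbT.
have k0 : 0 <= 2 * rho ^+ k by rewrite mulr_ge0// exprn_ge0// ltW.
rewrite coupleZ//; last by move=> a b; rewrite lee_fin.
have -> : 2 * rho ^+ k.+1 * W x y = (2 * rho ^+ k) * (rho * W x y).
  by rewrite exprS; ring.
by rewrite (EFinM (2 * rho ^+ k)); apply: lee_wpmul2l; rewrite ?lee_fin.
Qed.

(** The letters of the orbit from time [n] on are those of the point itself, and
    are compared directly; the previous ones have been averaged out, and are
    compared along the coupled backward chains. *)
Definition influence n j x y : R :=
  if (j <= n)%N then disagree (n - j) x y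
  else (lab (iter (j - n) T x) != lab (iter (j - n) T y))%:R.

Lemma influence_ge0 n j x y : 0 <= influence n j x y.
Proof. by rewrite /influence; case: ifP => _ //; exact: disagree_ge0. Qed.

Lemma couple_influence n j x y :
  (couple (p x) (p y) (fun a b => (influence n j (br a x) (br b y))%:E)
   <= (influence n.+1 j x y)%:E)%E.
Proof.
rewrite /influence; have [jn|nj] := leqP j n.
  by rewrite (leqW jn) subSn//; exact: couple_disagree.
have e a z : iter (j - n) T (br a z) = iter (j - n.+1) T z.
  by rewrite subnS -[in LHS](@prednK (j - n)) ?subn_gt0// iterSr branchK.
have [jn|nj'] := leqP j n.+1.
  have -> : j = n.+1 by apply/eqP; rewrite eqn_leq jn.
  apply: couple_cst_le => a b.
  rewrite subnn subSnn/= !branchK disagree0.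
  by rewrite ler0n.
by apply: couple_cst_le => a b; rewrite !e lexx ler0n.
Qed.

Variables (N : nat) (delta : nat -> R) (M : R) (f : X -> R).
Hypothesis delta0 : forall j, 0 <= delta j.
Hypothesis fM : bounded_by M f.
Hypothesis f_letter : letterwise N delta f.
Local Notation "f_[ n ]" := (iter n transfer f) (at level 0, format "f_[ n ]").

(** Coupling the preimages of [x] and [y] turns the influences after [n] steps
    into the influences after [n.+1] steps. *)
Lemma iter_transfer_influence n x y :
  f_[n] x <= f_[n] y + \sum_(j < N) delta j * influence n j x y.
Proof.
elim: n x y => [x y|n IH x y].
  apply: le_trans (f_letter x y) _; rewrite lerD2l; apply: ler_sum => j _.
  apply: ler_wpM2l => //; rewrite /influence leqn0.
  by have [->|_] := eqVneq (j : nat) 0%N; [exact: disagree0|rewrite subn0].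
have px := @weight_ge0 _ _ c x; have py := @weight_ge0 _ _ c y.
have fnM := bounded_iter_transfer n fM.
have [ex _] := avg_transfer x fnM; have [ey _] := avg_transfer y fnM.
rewrite -lee_fin EFinD /= -ex -ey.
pose H a b := (\sum_(j < N) (delta j)%:E * (influence n j (br a x) (br b y))%:E)%E.
have I0 (j : 'I_N) a b : (0 <= (delta j)%:E * (influence n j (br a x) (br b y))%:E)%E.
  by apply: mule_ge0; rewrite lee_fin// influence_ge0.
have H0 a b : (0 <= H a b)%E by apply: sume_ge0 => j _.
apply: (@le_trans _ _ (avg (p y) (fun b => (f_[n] (br b y))%:E) + couple (p x) (p y) H)%E).
  apply: couple_transport => //; rewrite ?weight1//.
  - by move=> a; rewrite lee_fin; case/andP: (fnM (br a x)).
  - by move=> a; rewrite lee_fin; case/andP: (fnM (br a y)).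
  move=> a b; rewrite /H; under eq_bigr do rewrite -EFinM.
  by rewrite sumEFin -EFinD lee_fin.
apply: leeD2l; rewrite couple_sum//.
rewrite -sumEFin; apply: lee_sum => j _.
rewrite coupleZ ?EFinM//; last by move=> a b; rewrite lee_fin influence_ge0.
by apply: lee_wpmul2l; [rewrite lee_fin|exact: couple_influence].
Qed.

(** Two preimages of the same point have the same later letters. *)
Lemma iter_transfer_disagree n x y : T x = T y ->
  f_[n] x <= f_[n] y + \sum_(j < N | (j <= n)%N) delta j * disagree (n - j) x y.
Proof.
move=> xy; apply: le_trans (iter_transfer_influence n x y) _.
rewrite lerD2l [leRHS]big_mkcond/=; apply: ler_sum => j _.
rewrite /influence; case: leqP => // nj.
by rewrite -(@prednK (j - n)) ?subn_gt0// !iterSr xy eqxx mulr0.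
Qed.

Definition past_sum n : R := \sum_(j < N | (j <= n)%N) delta j * rho ^+ (n - j).

Lemma past_sum_ge0 n : 0 <= past_sum n.
Proof. by apply: sumr_ge0 => j _; rewrite mulr_ge0// exprn_ge0// ltW. Qed.

Lemma iter_transfer_V n x y : T x = T y ->
  f_[n] x <= f_[n] y + 2 * past_sum n * (V x + V y).
Proof.
move=> xy; apply: le_trans (iter_transfer_disagree n xy) _.
rewrite lerD2l mulr_sumr mulr_suml; apply: ler_sum => j _.
apply: le_trans (ler_wpM2l (delta0 j) (disagree_le _ x y)) _.
by rewrite le_eqVlt; apply/orP; left; apply/eqP; ring.
Qed.

End transfer.

Section exponential_mean.
Context {R : realType} (p : nat -> R).
Hypotheses (p0 : forall a, 0 <= p a) (p1 : avg p (cst 1%E) = 1%E).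
Variables (F : nat -> R) (A : R).
Hypothesis F0 : forall a, 0 <= F a.
Hypothesis avgF : avg p (fun a => (F a)%:E) = A%:E.

Lemma avg_affine (k : R) (G : nat -> R) : 0 <= k -> (forall a, 0 <= G a) ->
  avg p (fun a => (k + G a)%:E) = (k%:E + avg p (fun a => (G a)%:E))%E.
Proof.
move=> k0 G0; under eq_avg do rewrite EFinD.
by rewrite avgD// avg_cst// p1 mule1.
Qed.

Lemma mean_deviation (u b : R) (G : nat -> R) : 0 <= u -> (forall a, 0 <= G a) ->
  (avg p (fun a => (G a)%:E) <= b%:E)%E ->
  (forall i j, F i <= F j + (u + G i + G j)) ->
  forall i, `|F i - A| <= u + G i + b.
Proof.
move=> u0 G0 Gb FG i; have Gi := G0 i.
rewrite ler_norml; apply/andP; split.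
  suff : A <= F i + u + G i + b by lra.
  rewrite -lee_fin -avgF.
  apply: (@le_trans _ _ (avg p (fun j => ((F i + u + G i) + G j)%:E))).
    apply: le_avg => // j; rewrite lee_fin.
    by apply: le_trans (FG j i) _; lra.
  by rewrite avg_affine// ?addr_ge0// [leRHS]EFinD; exact: leeD2l.
suff : F i <= (u + G i) + (A + b) by lra.
rewrite -lee_fin EFinD (EFinD A) -avgF.
have -> : (F i)%:E = avg p (fun=> (F i)%:E) by rewrite avg_cst// p1 mule1.
apply: (@le_trans _ _ (avg p (fun j => (u + G i + (F j + G j))%:E))).
  by apply: le_avg => // j; rewrite lee_fin//; apply: le_trans (FG i j) _; lra.
rewrite avg_affine ?addr_ge0//; last by move=> j; rewrite addr_ge0.
by under eq_avg do rewrite EFinD; rewrite avgD//; apply: leeD2l; exact: leeD2l.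
Qed.

(** Since the deviations have mean zero, the quadratic remainder of the
    exponential is all that remains. *)
Lemma exp_mean (v : nat -> R) (s E b : R) : 0 <= A -> (forall a, 0 <= v a) ->
  0 <= E -> (avg p (fun a => (v a ^+ 3)%:E) <= b%:E)%E ->
  (forall a, `|F a - A| <= s * v a) ->
  (forall a, expR `|F a - A| <= E * v a) ->
  (avg p (fun a => (expR (F a))%:E) <= (expR (A + s ^+ 2 * E * b))%:E)%E.
Proof.
move=> A0 v0 E0 vb Fs FE; set k := s ^+ 2 * E.
have k0 : 0 <= k by rewrite mulr_ge0// sqr_ge0.
have v30 a : 0 <= v a ^+ 3 by rewrite exprn_ge0.
have D0 a : (0 <= (expR (F a - A))%:E)%E by rewrite lee_fin expR_ge0.
have key a : expR (F a - A) + A <= 1 + (F a + k * v a ^+ 3).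
  apply: le_trans (lerD (expR_le_quadratic _) (le_refl A)) _.
  suff : (F a - A) ^+ 2 * expR `|F a - A| <= k * v a ^+ 3 by lra.
  have -> : k * v a ^+ 3 = (s * v a) ^+ 2 * (E * v a) by rewrite /k; ring.
  apply: ler_pM => //; first exact: sqr_ge0.
  have := Fs a; rewrite ler_norml => /andP[h1 h2].
  rewrite -subr_ge0 subr_sqr mulr_ge0//; lra.
have : (avg p (fun a => (expR (F a - A))%:E) + A%:E <= 1 + (A%:E + (k * b)%:E))%E.
  have eA : avg p (fun=> A%:E) = A%:E by rewrite avg_cst// p1 mule1.
  rewrite -{1}eA -avgD//.
  apply: (@le_trans _ _ (avg p (fun a => (1 + (F a + k * v a ^+ 3))%:E))).
    by apply: le_avg => // a; exact: adde_ge0.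
  rewrite avg_affine//; last by move=> a; rewrite addr_ge0// mulr_ge0.
  apply: leeD2l; under eq_avg do rewrite EFinD.
  rewrite avgD// ?avg_cst// ?p1 ?mule1 ?avgF; last first.
    by move=> a; rewrite lee_fin mulr_ge0.
  apply: leeD2l; under eq_avg do rewrite EFinM.
  by rewrite avgZ// (EFinM k b); apply: lee_wpmul2l; rewrite ?lee_fin.
rewrite addeCA [leLHS]addeC leeD2lE// => h.
have -> : avg p (fun a => (expR (F a))%:E) =
    ((expR A)%:E * avg p (fun a => (expR (F a - A))%:E))%E.
  rewrite -avgZ//; apply: eq_avg => a; rewrite -EFinM -expRD; congr ((expR _)%:E).
  by rewrite addrC subrK.
rewrite expRD EFinM; apply: lee_wpmul2l; first by rewrite lee_fin expR_ge0.
by apply: le_trans h _; rewrite -EFinD lee_fin expR_ge1Dx.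
Qed.

End exponential_mean.

Section exp_transfer.
Context {R : realType} {X : Type} (c : backward_chain R X).
Local Notation T := (step c).
Local Notation lab := (label c).
Local Notation h := (col_height c).
Local Notation br := (branch c).
Local Notation p := (weight c).
Local Notation V := (tower_exp c).
Local Notation lev := (level c).
Local Notation r := (tail_rate c).
Local Notation B := (tail_bound c).

Lemma level_le_V x : (lev x)%:R <= V x / r.
Proof.
rewrite ler_pdivlMr ?tail_rate_gt0// mulrC.
by apply: le_trans (expR_ge1Dx _); rewrite lerDr.
Qed.

Section parameters.
Variables (W : X -> X -> R) (rho : R) (n1 : nat).
Hypothesis rho01 : 0 < rho < 1.
Hypothesis W0 : forall x y, 0 <= W x y.
Hypothesis W_neq : forall x y, lab x != lab y -> 1 / 2 <= W x y.
Hypothesis W_le : forall x y, W x y <= V x + V y.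
Hypothesis W_contracts : forall x y,
  (couple (p x) (p y) (fun a b => (W (br a x) (br b y))%:E) <= (rho * W x y)%:E)%E.
Hypothesis n1P : rho ^+ n1 <= expR (- r) / 4.

Let rho_gt0 : 0 < rho. Proof. by case/andP: rho01. Qed.
Let rho_lt1 : rho < 1. Proof. by case/andP: rho01. Qed.
Let rho_itv : 0 <= rho < 1. Proof. by rewrite ltW. Qed.
Let S := (1 - rho)^-1.
Let S_gt0 : 0 < S. Proof. by rewrite invr_gt0 subr_gt0. Qed.

(** The geometric decay absorbs [V x + V y], which is exponential in the levels,
    after a time linear in the levels; before that the chains may disagree. *)
Lemma sum_disagree n x y :
  \sum_(k < n) disagree W rho k x y <= (n1 * (1 + (lev x + lev y)))%:R + S.
Proof.
apply: (@sum_cut_geometric _ (fun k => disagree W rho k x y)) => // [k|k mk]; first exact: disagree_le1.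
apply: le_trans (disagree_le rho01 W_le k x y) _.
rewrite -{1}(subnK mk) exprD exprM mulrCA -mulrA.
rewrite -[leRHS]mulr1; apply: ler_wpM2l; first by rewrite exprn_ge0// ltW.
set l := (lev x + lev y)%N; set q := rho ^+ n1.
have q0 : 0 <= q by rewrite exprn_ge0// ltW.
have e0 : 0 < expR (- r) := expR_gt0 _.
have er1 : expR (- r) <= 1.
  by rewrite -expR0 ler_expR oppr_le0 ltW// tail_rate_gt0.
have q4 : q <= 1 / 4 by move: n1P; rewrite -/q; lra.
have ql : q ^+ l <= expR (- (r * l%:R)).
  rewrite -mulNr expRM_natr.
  by apply: lerXn2r; rewrite ?nnegrE//; move: n1P; rewrite -/q; lra.
have Vl z : (lev z <= l)%N -> q ^+ l * V z <= 1.
  move=> zl; rewrite -(expRxMexpNx_1 (r * l%:R)) mulrC.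
  apply: ler_pM => //; [by rewrite ltW// V_gt0|by rewrite exprn_ge0|].
  by rewrite /tower_exp ler_expR ler_wpM2l ?ler_nat// ltW// tail_rate_gt0.
have Vx := Vl x (leq_addr _ _); have Vy := Vl y (leq_addl _ _).
rewrite exprD expr1; have ql0 : 0 <= q ^+ l by rewrite exprn_ge0.
have -> : 2 * (q * q ^+ l) * (V x + V y) = 2 * q * (q ^+ l * V x + q ^+ l * V y).
  by ring.
have q0' : 0 <= q ^+ l * V x + q ^+ l * V y.
  by rewrite addr_ge0// mulr_ge0// ltW// V_gt0.
nra.
Qed.

Variable x0 : X.
Hypothesis lev_x0 : lev x0 = 0%N.
Let B1 : 1 <= B := tail_bound_ge1 lev_x0.
Let r_gt0 : 0 < r := tail_rate_gt0 c.
Let K2 : R := n1%:R + S + n1%:R * (B / r).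
Let K2_gt0 : 0 < K2.
Proof.
apply: ltr_pwDl; first exact: ltr_wpDl.
rewrite mulr_ge0// divr_ge0//; last exact: ltW.
by move: B1; lra.
Qed.

(** Below this threshold the deviations are at most [r * (1 + level)], and their
    exponential is controlled by the tower function. *)
Definition small_influence : R := r / K2.
Local Notation eps := small_influence.

Lemma small_influence_gt0 : 0 < eps.
Proof. exact: divr_gt0. Qed.

Variables (N : nat) (delta : nat -> R) (M : R) (f : X -> R).
Hypothesis delta0 : forall j, 0 <= delta j.
Hypothesis delta_small : forall j, delta j <= eps.
Hypothesis fM : bounded_by M f.
Hypothesis f_letter : letterwise c N delta f.
Local Notation "f_[ n ]" := (iter n (transfer c) f) (at level 0, format "f_[ n ]").
Local Notation past := (past_sum rho N delta).

Let fn0 n y : 0 <= f_[n] y.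
Proof. by have /(_ y)/andP[] := bounded_iter_transfer c n fM. Qed.

(** Two bounds on the same deviation are needed. This one is linear in the level
    and controls the exponential of the deviation; the next one is exponential in
    the level, but linear in the influences, and controls its square. *)
Lemma deviation_level n x a : lev x = 0%N ->
  `|f_[n] (br a x) - f_[n.+1] x| <= r * (1 + (lev (br a x))%:R).
Proof.
move=> lx; have px := @weight_ge0 _ _ c x; have e0 := small_influence_gt0.
have [ex _] := @avg_transfer _ _ c M _ x (bounded_iter_transfer c n fM).
have u0 : 0 <= eps * (n1%:R + S) by rewrite mulr_ge0 ?addr_ge0// ltW.
have en0 : 0 <= eps * n1%:R by rewrite mulr_ge0// ltW.
have G0 b : 0 <= eps * n1%:R * (lev (br b x))%:R by rewrite mulr_ge0.
have Gb : (avg (p x) (fun b => (eps * n1%:R * (lev (br b x))%:R)%:E)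
    <= (eps * n1%:R * (B / r))%:E)%E.
  apply: (@le_trans _ _ (avg (p x) (fun b => (eps * n1%:R / r)%:E * (V (br b x))%:E)%E)).
    apply: le_avg => // b; rewrite -EFinM lee_fin -[leRHS]mulrA; apply: ler_wpM2l => //.
    by rewrite mulrC level_le_V.
  rewrite avgZ//; last by move=> b; rewrite lee_fin ltW// V_gt0.
  have -> : eps * n1%:R * (B / r) = (eps * n1%:R / r) * B by ring.
  rewrite (EFinM (eps * n1%:R / r)); apply: lee_wpmul2l; last exact: avg_V.
  by rewrite lee_fin divr_ge0// ltW.
have dev := mean_deviation px (weight1 c x) (fun a => fn0 n (br a x)) ex u0 G0 Gb.
apply: le_trans (dev _ a) _.
  move=> i j; have ij : T (br i x) = T (br j x) by rewrite !branchK.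
  apply: le_trans (iter_transfer_disagree rho01 W0 W_neq W_contracts delta0 fM f_letter n ij) _.
  rewrite lerD2l; apply: (@le_trans _ _ (\sum_(j0 < N | (j0 <= n)%N)
      eps * disagree W rho (n - j0) (br i x) (br j x))).
    apply: ler_sum => k _; apply: ler_wpM2r; last exact: delta_small.
    exact: disagree_ge0.
  rewrite -mulr_sumr.
  have -> : eps * (n1%:R + S) + eps * n1%:R * (lev (br i x))%:R
      + eps * n1%:R * (lev (br j x))%:R
      = eps * ((n1 * (1 + (lev (br i x) + lev (br j x))))%:R + S).
    by rewrite natrM !natrD; ring.
  apply: ler_wpM2l; first exact: ltW.
  apply: le_trans (sum_disagree n.+1 _ _).
  apply: (sum_convolution_le (u := fun k => disagree W rho k (br i x) (br j x))) => k.
  exact: disagree_ge0.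
set L := (lev (br a x))%:R.
have L0 : 0 <= L by exact: ler0n.
have -> : r * (1 + L) = eps * K2 * (1 + L) by rewrite /small_influence divfK// gt_eqF.
have -> : eps * K2 * (1 + L) = eps * (K2 * (1 + L)) by ring.
have -> : eps * (n1%:R + S) + eps * n1%:R * L + eps * n1%:R * (B / r) =
  eps * (n1%:R + S + n1%:R * L + n1%:R * (B / r)) by ring.
apply: ler_wpM2l; first exact: ltW.
have : 0 <= S * L by rewrite mulr_ge0// ltW.
have : 0 <= n1%:R * (B / r) * L.
  rewrite mulr_ge0// mulr_ge0// divr_ge0//; last exact: ltW.
  by move: B1; lra.
by rewrite /K2; lra.
Qed.

Lemma deviation_V n x a : lev x = 0%N ->
  `|f_[n] (br a x) - f_[n.+1] x| <= 4 * past n * B * V (br a x).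
Proof.
move=> lx; have px := @weight_ge0 _ _ c x.
have [ex _] := @avg_transfer _ _ c M _ x (bounded_iter_transfer c n fM).
have ps0 : 0 <= 2 * past n by rewrite mulr_ge0// past_sum_ge0.
have G0 b : 0 <= 2 * past n * V (br b x) by rewrite mulr_ge0// ltW// V_gt0.
have Gb : (avg (p x) (fun b => (2 * past n * V (br b x))%:E) <= (2 * past n * B)%:E)%E.
  rewrite (EFinM (2 * past n)); under eq_avg do rewrite (EFinM (2 * past n)).
  rewrite avgZ//; last by move=> b; rewrite lee_fin ltW// V_gt0.
  by apply: lee_wpmul2l; [rewrite lee_fin|exact: avg_V].
have dev := mean_deviation px (weight1 c x) (fun a => fn0 n (br a x)) ex (lexx 0) G0 Gb.
apply: le_trans (dev _ a) _.
  move=> i j; have ij : T (br i x) = T (br j x) by rewrite !branchK.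
  rewrite add0r -mulrDr.
  exact: (iter_transfer_V rho01 W0 W_neq W_le W_contracts delta0 fM f_letter n ij).
have V1 := V_ge1 c (br a x).
rewrite add0r; have -> : 4 * past n * B * V (br a x) = 2 * past n * (2 * B * V (br a x)).
  by ring.
rewrite -mulrDr; apply: ler_wpM2l => //.
have := B1 => b1.
have : 0 <= (B - 1) * (V (br a x)) by rewrite mulr_ge0//; lra.
have : 0 <= B * (V (br a x) - 1) by rewrite mulr_ge0//; lra.
lra.
Qed.

Lemma exp_transfer_step n x :
  (avg (p x) (fun a => (expR (f_[n] (br a x)))%:E) <=
   (expR (f_[n.+1] x + 16 * B ^+ 3 * expR r * past n ^+ 2))%:E)%E.
Proof.
have px := @weight_ge0 _ _ c x.
have [ex _] := @avg_transfer _ _ c M _ x (bounded_iter_transfer c n fM).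
case lx : (lev x) => [|l].
  have V0 a : 0 <= V (br a x) by rewrite ltW// V_gt0.
  have E0 : 0 <= expR r by exact: expR_ge0.
  have FE a : expR `|f_[n] (br a x) - f_[n.+1] x| <= expR r * V (br a x).
    rewrite /tower_exp -expRD ler_expR; apply: le_trans (deviation_level n a lx) _.
    by rewrite mulrDr mulr1.
  have := exp_mean px (weight1 c x) (fun a => fn0 n (br a x)) ex (fn0 n.+1 x) V0 E0
    (avg_V_cube lx) (fun a => deviation_V n a lx) FE.
  by congr (_ <= (expR (_ + _))%:E)%E; ring.
have e a : br a x = br 0 x by exact: branch_up lx.
have ee : f_[n.+1] x = f_[n] (br 0 x).
  apply: EFin_inj; rewrite -ex; under eq_avg do rewrite e.
  by rewrite avg_cst// weight1 mule1.
under eq_avg do rewrite e.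
rewrite avg_cst// weight1 mule1 ee lee_fin ler_expR lerDl.
rewrite mulr_ge0 ?sqr_ge0// mulr_ge0 ?expR_ge0// mulr_ge0// exprn_ge0//.
by move: B1; lra.
Qed.

(** The sequence [past] is the convolution of [delta] with a geometric sequence. *)
Lemma sum_past_sq q : \sum_(n < q) past n ^+ 2 <= S ^+ 2 * \sum_(j < N) delta j ^+ 2.
Proof.
have rk k : 0 <= rho ^+ k by rewrite exprn_ge0// ltW.
apply: (@le_trans _ _ (\sum_(n < q) S * \sum_(j < N | (j <= n)%N) rho ^+ (n - j) * delta j ^+ 2)).
  apply: ler_sum => n _; rewrite /past_sum.
  under eq_bigr do rewrite mulrC.
  apply: le_trans (weighted_cauchy _ _ _) _ => //.
  apply: ler_wpM2r; first by apply: sumr_ge0 => j _; rewrite mulr_ge0// sqr_ge0.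
  apply: le_trans (sum_geometric_le n.+1 rho_itv).
  exact: (sum_convolution_le (u := fun k => rho ^+ k)).
rewrite -mulr_sumr expr2 -mulrA; apply: ler_wpM2l; first exact: ltW.
rewrite (exchange_big_dep xpredT)//= mulr_sumr; apply: ler_sum => j _.
rewrite -mulr_suml; apply: ler_wpM2r; first exact: sqr_ge0.
apply: le_trans (sum_geometric_le q rho_itv).
exact: (sum_shift_le (u := fun k => rho ^+ k)).
Qed.

(** After time [N] all the letters on which [f] depends recede into the past. *)
Lemma iter_transfer_merge x y e : 0 < e ->
  exists n0, forall n, (n0 <= n)%N -> `|f_[n] x - f_[n] y| <= e.
Proof.
move=> e0; pose D := \sum_(j < N) delta j.
have D0 : 0 <= D by apply: sumr_ge0.
have VV : 0 <= V x + V y by rewrite addr_ge0// ltW// V_gt0.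
have K0 : 0 <= D * (2 * (V x + V y)) by rewrite !mulr_ge0.
have [m hm] := geometric_small rho_itv K0 e0.
exists (m + N)%N => n mn.
have bnd u w : V u + V w = V x + V y -> f_[n] u <= f_[n] w + e.
  move=> uw.
  apply: le_trans (iter_transfer_influence rho01 W0 W_neq W_contracts delta0 fM f_letter n u w) _.
  rewrite lerD2l; apply: le_trans (hm (n - N)%N _); last by rewrite leq_subRL; lia.
  rewrite -mulrA mulr_suml; apply: ler_sum => j _.
  apply: ler_wpM2l => //; rewrite /influence.
  have jN := ltn_ord j.
  have -> : (j <= n)%N by lia.
  apply: le_trans (disagree_le rho01 W_le _ _ _) _.
  have pl : rho ^+ (n - j) <= rho ^+ (n - N).
    by apply: ler_wiXn2l; [exact: ltW|exact: ltW|lia].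
  have VV2 : 0 <= 2 * (V x + V y) by rewrite mulr_ge0.
  by have := ler_wpM2l VV2 pl; rewrite uw; lra.
have := bnd x y erefl; have := bnd y x (addrC _ _).
by rewrite ler_norml; lra.
Qed.

End parameters.

(** The transfer operator exchanges with the exponential up to errors whose sum is
    controlled by the squares of the influences. *)
Theorem exp_transfer x0 : lev x0 = 0%N -> exists eps K : R, [/\ 0 < eps, 0 < K &
  forall (N : nat) (delta : nat -> R) (M : R) (f : X -> R),
    (forall j, 0 <= delta j <= eps) -> bounded_by M f -> letterwise c N delta f ->
    [/\ exists a : nat -> R,
          (forall q, \sum_(n < q) a n <= K * \sum_(j < N) delta j ^+ 2) /\
          forall n x, (avg (p x) (fun b => (expR (iter n (transfer c) f (br b x)))%:E)
            <= (expR (iter n.+1 (transfer c) f x + a n))%:E)%E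
      & forall x y e, 0 < e -> exists n0, forall n, (n0 <= n)%N ->
          `|iter n (transfer c) f x - iter n (transfer c) f y| <= e]].
Proof.
move=> lx0; have [W [rho [rho01 W0 Wn Wl Wc]]] := coupling_contraction lx0.
have /andP[r0 r1] := rho01.
have [n1 hn1] : exists n, forall m, (n <= m)%N -> 1 * rho ^+ m <= expR (- r) / 4.
  by apply: geometric_small; rewrite ?(ltW r0)// divr_gt0// expR_gt0.
have n1P : rho ^+ n1 <= expR (- r) / 4 by have := hn1 n1 (leqnn _); rewrite mul1r.
have B1 := tail_bound_ge1 lx0.
have K0 : 0 < 16 * B ^+ 3 * expR r * (1 - rho)^-1 ^+ 2.
  have B3 : 0 < B ^+ 3 by rewrite exprn_gt0//; lra.
  have S2 : 0 < (1 - rho)^-1 ^+ 2 by rewrite exprn_gt0// invr_gt0 subr_gt0.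
  by rewrite mulr_gt0// mulr_gt0 ?expR_gt0// mulr_gt0.
exists (small_influence rho n1), (16 * B ^+ 3 * expR r * (1 - rho)^-1 ^+ 2).
split => //; first exact: (small_influence_gt0 n1 rho01 lx0).
move=> N delta M f de fM fl.
have d0 j : 0 <= delta j by case/andP: (de j).
have d1 j : delta j <= small_influence rho n1 by case/andP: (de j).
split; last first.
  exact: (iter_transfer_merge rho01 W0 Wn Wl Wc n1P lx0 d0 fM fl).
exists (fun n => 16 * B ^+ 3 * expR r * past_sum rho N delta n ^+ 2); split.
  move=> q; rewrite -mulr_sumr -[leRHS]mulrA; apply: ler_wpM2l.
    by rewrite mulr_ge0 ?expR_ge0// mulr_ge0// exprn_ge0//; lra.
  exact: sum_past_sq.
exact: (exp_transfer_step rho01 W0 Wn Wl Wc n1P lx0 d0 d1 fM fl).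
Qed.

End exp_transfer.

(** * The backward chain of a Young tower *)

Section tower_branches.
Context {R : realType} {d : measure_display} {X : measurableType d}.
Variable Y : uniform_young_tower R X.
Local Notation T := (tmap Y).
Local Notation h := (height Y).
Local Notation D := (tower_index h).
Local Notation mu := (tmeas Y).

Definition cell_index (x : X) : nat * nat := get [set i | D i /\ cell Y i x].
Local Notation idx := cell_index.

Lemma cell_indexP x : D (idx x) /\ cell Y (idx x) x.
Proof.
have [cov _ _] := cell_partition Y.
have [i Di ix] : cover D (cell Y) x by rewrite cov.
by have : [set i | D i /\ cell Y i x] (idx x) by apply: getPex; exists i.
Qed.

Lemma cell_indexE i x : D i -> cell Y i x -> idx x = i.
Proof.
move=> Di ix; have [_ tr _] := cell_partition Y; have [Dj jx] := cell_indexP x.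
by apply: tr => //; exists x.
Qed.

Lemma cell_index_setE i : D i -> cell Y i = [set x | idx x = i].
Proof.
move=> Di; apply/seteqP; split => [x ix|x <-]; first exact: cell_indexE.
by have [] := cell_indexP x.
Qed.

Lemma same_cellE x y : same_cell D (cell Y) x y <-> idx x = idx y.
Proof.
split=> [[i [Di ix iy]]|xy]; first by rewrite !(@cell_indexE i).
by have [Dx xx] := cell_indexP x; exists (idx x); split => //; rewrite xy;
  have [] := cell_indexP y.
Qed.

Lemma separation_timeE x y :
  separation_time D (cell Y) T x y = label_sep T idx x y.
Proof.
congr first_time; apply/funext => n; apply/propext.
by split=> + /same_cellE.
Qed.

Lemma D0 a : D (a, 0%N). Proof. exact: height_gt0. Qed.

Lemma Dtop a : D (a, (h a).-1).
Proof. by rewrite /tower_index /= prednK// height_gt0. Qed.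

Lemma tower_baseE : tower_base Y = [set x | (idx x).2 = 0%N].
Proof.
apply/seteqP; split => [x [a _ ax]|x /= x0]; first by rewrite /= (cell_indexE (D0 a) ax).
by have [_] := cell_indexP x; case: (idx x) x0 => a l /= -> ?; exists a.
Qed.

Definition pre_index (a : nat) (i : nat * nat) : nat * nat :=
  if i.2 is l.+1 then (i.1, l) else (a, (h a).-1).

Lemma D_pre_index a i : D i -> D (pre_index a i).
Proof.
by rewrite /pre_index; case: i => b [|l] Di; [exact: Dtop|exact: ltnW].
Qed.

Lemma tmap_cell a i : D i ->
  bimeasurable_bij (cell Y (pre_index a i))
    (if i.2 is l.+1 then cell Y i else tower_base Y) T.
Proof.
case: i => b [|l] Di /=; first exact: tmap_top.
exact: tmap_up.
Qed.

Lemma preimage_ex a x : exists y, T y = x /\ idx y = pre_index a (idx x).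
Proof.
have [Dx xx] := cell_indexP x.
have [[_ _ surj] _ _] := tmap_cell a Dx.
have : (if (idx x).2 is l.+1 then cell Y (idx x) else tower_base Y) x.
  by case E : (idx x).2 => //; rewrite tower_baseE.
move=> /surj[y yc yx]; exists y; split => //.
by apply: cell_indexE => //; exact: D_pre_index.
Qed.

Definition tower_branch a x : X := get [set y | T y = x /\ idx y = pre_index a (idx x)].
Local Notation br := tower_branch.

Lemma tower_branchP a x : T (br a x) = x /\ idx (br a x) = pre_index a (idx x).
Proof.
by have : [set y | T y = x /\ idx y = pre_index a (idx x)] (br a x)
  by apply: getPex; exact: preimage_ex.
Qed.

Lemma tower_branchK a x : T (br a x) = x.
Proof. by case: (tower_branchP a x). Qed.

Lemma idx_tower_branch a x : idx (br a x) = pre_index a (idx x).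
Proof. by case: (tower_branchP a x). Qed.

Lemma tmap_idx y : idx y = pre_index (idx y).1 (idx (T y)).
Proof.
have [Dy yy] := cell_indexP y; case E : (idx y) => [a l] /=.
rewrite E in Dy yy; have [lh|lh] := ltnP l.+1 (h a).
  have [[fn _ _] _ _] := tmap_up lh.
  by rewrite (@cell_indexE (a, l.+1)) //; apply: fn.
have el : l = (h a).-1.
  by apply/eqP; rewrite eqn_leq -ltnS prednK ?height_gt0// Dy -ltnS prednK ?height_gt0.
rewrite el in yy *; have [[fn _ _] _ _] := tmap_top Y a.
have : tower_base Y (T y) by exact: fn.
by rewrite tower_baseE /pre_index /= => ->.
Qed.

Lemma tmap_idx_inj y y' : T y = T y' -> idx y = idx y' -> y = y'.
Proof.
move=> TT yy; have [Dy cy] := cell_indexP y; have [Dy' cy'] := cell_indexP y'.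
have [Dx _] := cell_indexP (T y).
have := tmap_cell (idx y).1 Dx; rewrite -tmap_idx => -[[_ inj _] _ _].
by apply: inj => //; rewrite inE// yy.
Qed.

Lemma tower_branch_tmap y : br (idx y).1 (T y) = y.
Proof.
apply: tmap_idx_inj; first by rewrite tower_branchK.
by rewrite idx_tower_branch -tmap_idx.
Qed.

Lemma tower_branch_up a b x l : (idx x).2 = l.+1 -> br a x = br b x.
Proof.
move=> xl; apply: tmap_idx_inj; first by rewrite !tower_branchK.
by rewrite !idx_tower_branch /pre_index xl.
Qed.

Lemma measurable_level0 : measurable [set x | (idx x).2 = 0%N].
Proof.
rewrite -tower_baseE; apply: bigcupT_measurable => a.
by apply: cell_measurable; exact: D0.
Qed.

(** In each cell, the inverse image of a set by a branch is the direct image by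
    [T] of a part of a cell. *)
Lemma measurable_tower_branch a : measurable_fun setT (br a).
Proof.
move=> _ E mE; rewrite setTI.
have -> : br a @^-1` E = \bigcup_(i in [set: nat * nat]) (if i \in D then
    cell Y i `&` (T @` (E `&` cell Y (pre_index a i))) else set0).
  apply/seteqP; split => [x /= Ex|x [i _]].
    have [Dx xx] := cell_indexP x; exists (idx x) => //.
    rewrite mem_set//; split => //; exists (br a x); last exact: tower_branchK.
    split => //; rewrite -idx_tower_branch; by have [] := cell_indexP (br a x).
  case: ifPn => // /set_mem Di [ix [y [Ey yi] yx]] /=.
  suff -> : br a x = y by [].
  apply: tmap_idx_inj; rewrite ?tower_branchK// idx_tower_branch.
  by rewrite (cell_indexE Di ix) (cell_indexE (D_pre_index a Di) yi).
apply: countable_bigcupT_measurable => // i; case: ifPn => // /set_mem Di.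
apply: measurableI; first exact: cell_measurable.
have [_ _ mT] := tmap_cell a Di; apply: mT; last exact: subIsetr.
by apply: measurableI => //; apply: cell_measurable; exact: D_pre_index.
Qed.

End tower_branches.

Lemma measurable_avg {R : realType} {d : measure_display} {X : measurableType d}
  (w : X -> nat -> R) (F : X -> nat -> \bar R) :
  (forall x a, 0 <= w x a) -> (forall x a, (0 <= F x a)%E) ->
  (forall a, measurable_fun setT (w^~ a)) ->
  (forall a, measurable_fun setT (F^~ a)) ->
  measurable_fun setT (fun x => avg (w x) (F x)).
Proof.
move=> w0 F0 mw mF.
rewrite (_ : (fun _ => _) =
    (fun x => \sum_(i <oo | i \in xpredT) (w x i)%:E * F x i)%E); last first.
  by apply/funext => x; apply: eq_eseriesl => i; rewrite unfold_in.
apply: ge0_emeasurable_sum => [a x _ _|a _].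
  by apply: mule_ge0; rewrite ?lee_fin.
by apply: emeasurable_funM => //; exact/measurable_EFinP.
Qed.

Section tower_weights.
Context {R : realType} {d : measure_display} {X : measurableType d}.
Variable Y : uniform_young_tower R X.
Local Notation T := (tmap Y).
Local Notation h := (height Y).
Local Notation D := (tower_index h).
Local Notation mu := (tmeas Y).
Local Notation idx := (cell_index Y).
Local Notation br := (tower_branch Y).
Local Notation g := (invjac Y).

Lemma invjac_gt0 x : 0 < g x. Proof. by case: (invjacP Y). Qed.
Lemma measurable_invjac : measurable_fun setT g. Proof. by case: (invjacP Y). Qed.

(** Above the base, the single preimage gets the label [0]. *)
Definition raw_weight x a : R :=
  if (idx x).2 == 0%N then g (br a x) else (a == 0%N)%:R * g (br 0%N x).
Local Notation raw := raw_weight.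

Lemma raw_weight_ge0 x a : 0 <= raw x a.
Proof.
by rewrite /raw; case: ifP => _; rewrite ?mulr_ge0// ltW// invjac_gt0.
Qed.
Hint Resolve raw_weight_ge0 : core.

Lemma measurable_raw_weight a : measurable_fun setT (fun x => raw x a).
Proof.
have mg b : measurable_fun setT (fun x => g (br b x)).
  by apply: measurableT_comp; [exact: measurable_invjac|exact: measurable_tower_branch].
apply: measurable_fun_ifT => //; last exact: measurable_funM.
apply: (measurable_fun_bool true); rewrite setTI.
rewrite (_ : _ @^-1` _ = [set x | (idx x).2 = 0%N]); first exact: measurable_level0.
by apply/seteqP; split => x /= /eqP.
Qed.

Lemma avg_raw_up x (F : nat -> \bar R) : (forall a, 0 <= F a)%E ->
  (idx x).2 != 0%N -> avg (raw x) F = ((g (br 0%N x))%:E * F 0%N)%E.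
Proof.
move=> F0 x0; have -> : raw x = fun a => g (br 0%N x) * (a == 0%N)%:R.
  by apply/funext => a; rewrite /raw (negbTE x0) mulrC.
by rewrite avgZl// avg_delta.
Qed.

Lemma preimage_base x : (idx x).2 = 0%N ->
  set_bij setT (T @^-1` [set x]) (fun a => br a x).
Proof.
move=> x0; split.
- by move=> a _ /=; exact: tower_branchK.
- move=> a b _ _ ab; have := congr1 idx ab.
  by rewrite !idx_tower_branch /pre_index x0 => -[].
- move=> y /= yx; exists (idx y).1 => //.
  by rewrite -[in br _ _]yx tower_branch_tmap.
Qed.

Lemma preimage_up x : (idx x).2 != 0%N -> T @^-1` [set x] = [set br 0%N x].
Proof.
move=> x0; apply/seteqP; split => [y /= yx|y /= ->]; last exact: tower_branchK.
rewrite -(tower_branch_tmap Y y) yx.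
case E : (idx x).2 x0 => [//|l] _; exact: tower_branch_up E.
Qed.

Lemma esum_preimage (u : X -> R) x : (forall y, 0 <= u y) ->
  (\esum_(y in T @^-1` [set x]) (g y * u y)%:E =
   avg (raw x) (fun a => (u (br a x))%:E))%E.
Proof.
move=> u0; have gu y : (0 <= (g y * u y)%:E)%E.
  by rewrite lee_fin mulr_ge0// ltW// invjac_gt0.
have [x0|x0] := eqVneq (idx x).2 0%N; last first.
  by rewrite preimage_up// esum_set1// avg_raw_up// => a; rewrite lee_fin.
rewrite (reindex_esum _ _ _ _ (preimage_base x0))//.
rewrite -nneseries_esumT//; apply: eq_eseriesr => a _.
by rewrite /raw x0 eqxx EFinM.
Qed.

Definition total_weight x : \bar R := avg (raw x) (cst 1%E).
Local Notation G := total_weight.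

Lemma integral_raw (u : X -> R) : measurable_fun setT u -> (forall y, 0 <= u y) ->
  (\int[mu]_x (u x)%:E = \int[mu]_x avg (raw x) (fun a => (u (br a x))%:E))%E.
Proof.
move=> mu_ u0; have [_ _ /(_ u (cst 1))] := invjacP Y.
move=> /(_ mu_ u0 (measurable_cst _) (fun=> ler01)).
under eq_integral do rewrite /= mulr1; move=> ->.
by apply: eq_integral => x _; rewrite mule1 esum_preimage.
Qed.

Lemma measurable_total_weight : measurable_fun setT G.
Proof.
by apply: measurable_avg => // a; exact: measurable_raw_weight.
Qed.

Lemma total_weight_gt0 x : (0 < G x)%E.
Proof.
apply: (@lt_le_trans _ _ ((raw x 0%N)%:E * 1)%E).
  rewrite mule1 lte_fin /raw; case: ifP => _; rewrite ?mul1r; exact: invjac_gt0.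
exact: (@avg_single _ _ 0%N (cst 1%E)).
Qed.

(** This is the duality for the constant function [1] and the indicator of [A]. *)
Lemma integral_total_weight A : measurable A ->
  (\int[mu]_(x in A) 1 = \int[mu]_(x in A) G x)%E.
Proof.
move=> mA; have [mT muT] := tmeas_invariant Y.
have [_ _ /(_ (cst 1) (\1_A))] := invjacP Y.
have m1 : measurable_fun setT (\1_A : X -> R) by exact: measurable_indic.
have i0 (x : X) : 0 <= (\1_A x : R) by rewrite indicE.
move=> /(_ (measurable_cst _) (fun=> ler01) m1 i0).
under eq_integral do rewrite /= mul1r.
have e (x : X) : (\1_A (T x) : R)%:E = (\1_(T @^-1` A) x : R)%:E by [].
under eq_integral do rewrite e.
have mTA : measurable (T @^-1` A) by rewrite -[X in measurable X]setTI; exact: mT.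
rewrite integral_indic// setIT integral_cst// mul1e.
move=> e2; apply: etrans (etrans (esym (muT _ mA)) e2) _.
rewrite [RHS]integral_mkcond epatch_indic; apply: eq_integral => x _ /=.
by congr (_ * _)%E; rewrite esum_preimage.
Qed.

Lemma total_weight_ae1 : ae_eq mu setT (cst 1%E) G.
Proof.
apply: integral_ae_eq => //.
- exact: (@finite_measure_integrable_cst _ _ _ mu setT 1).
- exact: measurable_total_weight.
- by move=> E _ mE; exact: integral_total_weight.
Qed.

Lemma exists_good_base : (0 < mu (tower_base Y))%E ->
  exists2 x, (idx x).2 = 0%N & G x = 1%E.
Proof.
rewrite tower_baseE => mu0; apply/not_exists2P => nex.
have [N [mN N0 sub]] := total_weight_ae1.
have : mu [set x | (idx x).2 = 0%N] = 0%E.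
  apply: subset_measure0 N0 => //; first exact: measurable_level0.
  move=> x /= x0; apply: sub => /= /(_ I) e.
  by case: (nex x) => //; apply.
by move=> e; rewrite e ltxx in mu0.
Qed.

Lemma tmap_fiber_cell a l : (l.+1 < h a)%N ->
  T @^-1` (cell Y (a, l.+1)) = cell Y (a, l).
Proof.
move=> lh; rewrite !cell_index_setE//; last exact: ltnW.
apply/seteqP; split => y /= e.
  by rewrite tmap_idx e.
have [Dy yy] := cell_indexP Y y; have [[fn _ _] _ _] := tmap_up lh.
by apply: cell_indexE => //; apply: fn; rewrite -e.
Qed.

Lemma measure_cell a l : (l < h a)%N -> mu (cell Y (a, l)) = mu (cell Y (a, 0%N)).
Proof.
have [mT muT] := tmeas_invariant Y.
elim: l => // l IH lh; rewrite -IH; last exact: ltnW.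
rewrite -(tmap_fiber_cell lh); apply: esym; apply: muT.
exact: cell_measurable.
Qed.

(** By invariance the cells of a column have the same measure, so that the tower
    would be negligible if its base were. *)
Lemma base_measure_gt0 : (0 < mu (tower_base Y))%E.
Proof.
rewrite lt0e measure_ge0 andbT; apply/eqP => mu0.
have c0 a : mu (cell Y (a, 0%N)) = 0%E.
  apply: subset_measure0 mu0.
  - by apply: cell_measurable; exact: D0.
  - by rewrite tower_baseE; exact: measurable_level0.
  - by move=> x ax; exists a.
have : mu.-negligible (\bigcup_a \bigcup_(l in [set l | (l < h a)%N]) cell Y (a, l)).
  apply: negligible_bigcup => a; rewrite bigcup_mkcond.
  apply: negligible_bigcup => l; case: ifPn => [/set_mem/= lh|_]; last exact: negligible_set0.
  by apply/negligibleP; [exact: cell_measurable|exact: etrans (measure_cell lh) (c0 a)].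
have -> : \bigcup_a \bigcup_(l in [set l | (l < h a)%N]) cell Y (a, l) = setT.
  apply/seteqP; split => // x _; have [Dx xx] := cell_indexP Y x.
  by exists (idx x).1 => //; exists (idx x).2 => //; rewrite -surjective_pairing.
move=> /negligibleP -/(_ measurableT) /(etrans (esym (probability_setT mu)))/eqP.
by rewrite onee_eq0.
Qed.

(** The total weight is [1] almost everywhere only; dividing by it gives a
    probability at every point of the base, and preserves the distortion bound. *)
Definition tower_weight x a : R :=
  if (idx x).2 == 0%N then raw x a / fine (G x) else (a == 0%N)%:R.
Local Notation weight := tower_weight.

Lemma invjac_distortionE : exists2 C : R, 0 <= C & forall x y a,
  (idx x).2 = 0%N -> (idx y).2 = 0%N ->
  raw x a <= (1 + C * exp_time (rate Y) (label_sep T idx x y)) * raw y a.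
Proof.
have [C HC] := invjac_distortion Y; exists `|C| => // x y a x0 y0.
have sc : same_cell D (cell Y) (br a x) (br a y).
  by apply/same_cellE; rewrite !idx_tower_branch /pre_index x0 y0.
have := HC _ _ sc; rewrite separation_timeE !tower_branchK.
set e := exp_time _ _; have e0 : 0 <= e.
  rewrite /e; case: label_sep => //= n; rewrite exprn_ge0// ltW//.
  by case/andP: (rate_itv Y).
rewrite /raw x0 y0 /= => h1.
have gy := invjac_gt0 (br a y).
rewrite -ler_pdivrMr// addrC -lerBlDr.
apply: le_trans (ler_norm _) (le_trans h1 _).
by apply: ler_wpM2r => //; exact: ler_norm.
Qed.

Definition tower_distortion : R := sval (cid2 invjac_distortionE).
Local Notation C := tower_distortion.

Lemma tower_distortion_ge0 : 0 <= C.
Proof. by rewrite /C; case: cid2. Qed.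

Lemma raw_weight_distortion x y a : (idx x).2 = 0%N -> (idx y).2 = 0%N ->
  raw x a <= (1 + C * exp_time (rate Y) (label_sep T idx x y)) * raw y a.
Proof. by rewrite /C; case: cid2 => /= C0 _; apply. Qed.

Let e_itv x y : 0 <= exp_time (rate Y) (label_sep T idx x y) <= 1.
Proof.
have /andP[b0 b1] := rate_itv Y.
case: label_sep => /= [n|]; last by rewrite lexx ler01.
by rewrite exprn_ge0 ?exprn_ile1// ltW.
Qed.

Lemma total_weight_distortion x y : (idx x).2 = 0%N -> (idx y).2 = 0%N ->
  (G x <= (1 + C * exp_time (rate Y) (label_sep T idx x y))%:E * G y)%E.
Proof.
move=> x0 y0; rewrite -avgZl//; apply: le_avgl => // a.
exact: raw_weight_distortion.
Qed.

Lemma total_weight_fin x : (idx x).2 = 0%N -> G x \is a fin_num.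
Proof.
move=> x0; have [y y0 Gy] := exists_good_base base_measure_gt0.
rewrite ge0_fin_numE; last exact/ltW/total_weight_gt0.
by apply: le_lt_trans (total_weight_distortion x0 y0) _; rewrite Gy mule1 ltry.
Qed.

Lemma total_weight_fine_gt0 x : (idx x).2 = 0%N -> 0 < fine (G x).
Proof.
by move=> x0; rewrite -lte_fin fineK ?total_weight_fin// total_weight_gt0.
Qed.

Lemma tower_weight_ge0 x a : 0 <= weight x a.
Proof.
rewrite /weight; case: eqP => x0; last exact: ler0n.
by rewrite divr_ge0// ltW// total_weight_fine_gt0.
Qed.
Hint Resolve tower_weight_ge0 : core.

Lemma tower_weight_gt0 x a : (idx x).2 = 0%N -> 0 < weight x a.
Proof.
move=> x0; rewrite /weight x0 /= divr_gt0 ?total_weight_fine_gt0//.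
by rewrite /raw x0 invjac_gt0.
Qed.

Lemma tower_weight1 x : avg (weight x) (cst 1%E) = 1%E.
Proof.
have [x0|x0] := eqVneq (idx x).2 0%N.
  have -> : weight x = fun a => (fine (G x))^-1 * raw x a.
    by apply/funext => a; rewrite /weight x0 /= mulrC.
  rewrite avgZl// -/(total_weight x) -{2}(fineK (total_weight_fin x0)) -EFinM.
  by rewrite mulVf// gt_eqF// total_weight_fine_gt0.
have -> : weight x = fun a => (a == 0%N)%:R.
  by apply/funext => a; rewrite /weight (negbTE x0).
by rewrite avg_delta.
Qed.

Lemma tower_weight_distortion x y a : (idx x).2 = 0%N -> (idx y).2 = 0%N ->
  weight x a <=
  (1 + (2 * C + C ^+ 2) * exp_time (rate Y) (label_sep T idx x y)) * weight y a.
Proof.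
move=> x0 y0; have C0 := tower_distortion_ge0; have /andP[e0 e1] := e_itv x y.
have h1 := raw_weight_distortion a x0 y0.
have h2 : fine (G y) <= (1 + C * exp_time (rate Y) (label_sep T idx x y)) * fine (G x).
  rewrite -lee_fin EFinM !fineK ?total_weight_fin//.
  have := total_weight_distortion y0 x0; congr (_ <= (1 + C * exp_time _ _)%:E * _)%E.
  by congr first_time; apply/funext => n; apply/propext; split => + e; apply.
have Gx := total_weight_fine_gt0 x0; have Gy := total_weight_fine_gt0 y0.
set e := exp_time _ _ in e0 e1 h1 h2 *.
have k0 : 0 <= 1 + C * e by rewrite addr_ge0// mulr_ge0.
rewrite /weight x0 y0 /= ler_pdivrMr//.
apply: le_trans h1 _.
have -> : (1 + (2 * C + C ^+ 2) * e) * (raw y a / fine (G y)) * fine (G x) =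
  raw y a * ((1 + (2 * C + C ^+ 2) * e) * fine (G x) / fine (G y)) by ring.
rewrite mulrC; apply: ler_wpM2l => //.
rewrite ler_pdivlMr//; apply: (@le_trans _ _ ((1 + C * e) * ((1 + C * e) * fine (G x)))).
  exact: ler_wpM2l.
rewrite mulrA; apply: ler_wpM2r; first exact: ltW.
have : (C * e) * (C * e) <= C * C * e.
  have -> : C * e * (C * e) = C * C * e * e by ring.
  by apply: ler_piMr => //; rewrite mulr_ge0// mulr_ge0.
by lra.
Qed.

Lemma measurable_tower_weight a : measurable_fun setT (fun x => weight x a).
Proof.
apply: measurable_fun_ifT => //.
  apply: (measurable_fun_bool true); rewrite setTI.
  rewrite (_ : _ @^-1` _ = [set x | (idx x).2 = 0%N]); first exact: measurable_level0.
  by apply/seteqP; split => x /= /eqP.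
apply: measurable_funM; first exact: measurable_raw_weight.
rewrite (_ : (fun x => _) = (fun x => (fine (G x)) `^ (-1))); last first.
  by apply/funext => x; rewrite powR_inv1// fine_ge0// ltW// total_weight_gt0.
apply: (@measurableT_comp _ _ _ _ _ _ (fun t : R => t `^ (-1)) _ (fun x => fine (G x))) => //.
by apply: measurableT_comp => //; exact: measurable_total_weight.
Qed.

(** The normalisation of the weights does not affect the duality, since the total
    weight is [1] almost everywhere. *)
Lemma integral_tower_weight (u : X -> R) :
  measurable_fun setT u -> (forall y, 0 <= u y) ->
  (\int[mu]_x (u x)%:E = \int[mu]_x avg (weight x) (fun a => (u (br a x))%:E))%E.
Proof.
move=> mu_ u0; rewrite integral_raw//.
have mub a : measurable_fun setT (fun x => (u (br a x))%:E).
  apply/measurable_EFinP; apply: measurableT_comp => //.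
  exact: measurable_tower_branch.
have ub x a : (0 <= (u (br a x))%:E)%E by rewrite lee_fin.
apply: ge0_ae_eq_integral => //.
- by apply: measurable_avg => // a; exact: measurable_raw_weight.
- by apply: measurable_avg => // a; exact: measurable_tower_weight.
- by move=> x _; exact: avg_ge0.
- by move=> x _; exact: avg_ge0.
apply: filterS total_weight_ae1 => x /(_ I) /= Gx _; apply: eq_eseriesr => a _.
congr (_%:E * _)%E; rewrite /weight; case: ifP => x0; first by rewrite -Gx divr1.
rewrite /raw x0; have := Gx; rewrite /total_weight avg_raw_up ?x0// mule1.
by move=> [<-]; rewrite mulr1.
Qed.

(** By distortion, [tower_weight x a] is comparable with its mean over the base,
    which is given by the measure of the top of the column [a]. *)
Lemma weight_le_cell x a : (idx x).2 = 0%N ->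
  ((weight x a)%:E * mu (tower_base Y) <=
   (1 + (2 * C + C ^+ 2))%:E * mu (cell Y (a, 0%N)))%E.
Proof.
move=> x0; have C0 := tower_distortion_ge0.
have K0 : 0 <= 2 * C + C ^+ 2 by rewrite addr_ge0 ?mulr_ge0// sqr_ge0.
have mt : measurable (cell Y (a, (h a).-1)) by apply: cell_measurable; exact: Dtop.
have mb : measurable (tower_base Y) by rewrite tower_baseE; exact: measurable_level0.
have mw : measurable_fun setT (fun y => (weight y a)%:E).
  by apply/measurable_EFinP; exact: measurable_tower_weight.
have <- : mu (cell Y (a, (h a).-1)) = mu (cell Y (a, 0%N)).
  by apply: measure_cell; rewrite prednK// height_gt0.
rewrite -(setIT (cell Y (a, (h a).-1))) -integral_indic// integral_tower_weight; last 2 first.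
- exact: measurable_indic.
- by move=> y; rewrite indicE.
apply: (@le_trans _ _ ((1 + (2 * C + C ^+ 2))%:E *
    \int[mu]_(y in tower_base Y) (weight y a)%:E)%E).
  rewrite -integral_cst// -ge0_integralZl//=; last 3 first.
  - exact: measurable_funTS.
  - by move=> y _; rewrite lee_fin.
  - by rewrite lee_fin addr_ge0.
  apply: ge0_le_integral => //=.
  - by move=> y _; rewrite lee_fin.
  - by apply: measurable_funTS; apply: measurable_funeM.
  rewrite tower_baseE => y /= y0; rewrite -EFinM lee_fin.
  apply: le_trans (tower_weight_distortion a x0 y0) _; apply: ler_wpM2r => //.
  by rewrite lerD2l; apply: ler_piMr => //; case/andP: (e_itv x y).
apply: lee_wpmul2l; first by rewrite lee_fin addr_ge0.
rewrite integral_mkcond; apply: ge0_le_integral => //=.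
- by move=> y _; rewrite patchE; case: ifP => // _; rewrite lee_fin.
- by apply/(measurable_restrictT _ _).1 => //; exact: measurable_funTS.
- apply: measurable_avg => // b; first exact: measurable_tower_weight.
  apply/measurable_EFinP; apply: measurableT_comp; first exact: measurable_indic.
  exact: measurable_tower_branch.
move=> y _; rewrite patchE; case: ifPn => [|_]; last first.
  by apply: avg_ge0 => // b; rewrite lee_fin indicE.
rewrite inE tower_baseE /= => y0.
apply: le_trans (@avg_single _ _ a _ _ _) => //.
have cy : cell Y (a, (h a).-1) (br a y).
  by have [_] := cell_indexP Y (br a y); rewrite idx_tower_branch /pre_index y0.
by rewrite indicE (mem_set cy) mule1.
Qed.

End tower_weights.

Section tower_chain.
Context {R : realType} {d : measure_display} {X : measurableType d}.
Variable Y : uniform_young_tower R X.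
Local Notation T := (tmap Y).
Local Notation h := (height Y).
Local Notation mu := (tmeas Y).
Local Notation idx := (cell_index Y).
Local Notation br := (tower_branch Y).
Local Notation tweight := (tower_weight Y).
Local Notation C := (tower_distortion Y).

Lemma return_timeE a x : cell Y (a, 0%N) x -> return_time Y x = h a.
Proof.
move=> ax; rewrite /return_time; congr (height Y _).
have ex : [set b | cell Y (b, 0%N) x] !=set0 by exists a.
have := getPex ex; rewrite /= => gx.
have := cell_indexE (D0 Y a) ax; rewrite (cell_indexE (D0 Y _) gx).
by case.
Qed.

Lemma integral_return_time (c : R) :
  (\int[mu]_(x in tower_base Y) (expR (c * (return_time Y x)%:R))%:E =
   \sum_(0 <= a <oo) (expR (c * (h a)%:R))%:E * mu (cell Y (a, 0%N)))%E.
Proof.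
have mb : measurable (tower_base Y) by rewrite tower_baseE; exact: measurable_level0.
have mc a : measurable (cell Y (a, 0%N)) by apply: cell_measurable; exact: D0.
transitivity (\int[mu]_(x in tower_base Y) \sum_(0 <= a <oo)
    ((expR (c * (h a)%:R))%:E * (\1_(cell Y (a, 0%N)) x)%:E))%E.
  apply: eq_integral => x; rewrite inE => -[a _ ax].
  rewrite (return_timeE ax).
  have := @avg_delta R a (fun b => (expR (c * (h b)%:R))%:E) (fun b => ltac:(by rewrite lee_fin expR_ge0)).
  rewrite /avg => <-; apply: eq_eseriesr => b _; rewrite muleC; congr (_ * _%:E)%E.
  rewrite indicE; case: (eqVneq b a) => [->|ba]; first by rewrite mem_set.
  rewrite memNset// => bx; case/eqP : ba.
  by have := cell_indexE (D0 Y a) ax; rewrite (cell_indexE (D0 Y b) bx) => -[].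
rewrite integral_nneseries//; last first.
  by move=> a; apply: measurable_funTS; apply: measurable_funeM;
    apply/measurable_EFinP; exact: measurable_indic.
apply: eq_eseriesr => a _; rewrite ge0_integralZl//=; last first.
  by apply/measurable_EFinP; exact: measurable_indic.
rewrite integral_indic//; congr (_ * _)%E; congr (mu _).
by apply: setIidl => x ax; exists a.
Qed.

Lemma exists_tower_chain : exponential_tails Y ->
  exists c : backward_chain R X, [/\ step c = T, label c = idx, branch c = br &
    weight c = tweight].
Proof.
case=> c0 c0_gt0; rewrite integral_return_time => tail.
have C0 := tower_distortion_ge0 Y.
have K0 : 0 <= 2 * C + C ^+ 2 by rewrite addr_ge0 ?mulr_ge0// sqr_ge0.
have mb : measurable (tower_base Y) by rewrite tower_baseE; exact: measurable_level0.
have mc a : measurable (cell Y (a, 0%N)) by apply: cell_measurable; exact: D0.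
have mub : mu (tower_base Y) \is a fin_num by apply: fin_num_measure.
have muc a : mu (cell Y (a, 0%N)) \is a fin_num by apply: fin_num_measure.
pose m := fine (mu (tower_base Y)).
have m0 : 0 < m by rewrite -lte_fin fineK// base_measure_gt0.
pose k := (1 + (2 * C + C ^+ 2)) / m.
have k0 : 0 <= k by apply: divr_ge0; [exact: addr_ge0|exact: ltW].
pose q a := k * fine (mu (cell Y (a, 0%N))).
have q0 a : 0 <= q a by rewrite mulr_ge0// fine_ge0.
have wq x a : (idx x).2 = 0%N -> tweight x a <= q a.
  move=> x0; have := weight_le_cell a x0.
  rewrite -(fineK mub) -(fineK (muc a)) -!EFinM lee_fin -/m /q /k => wl.
  by rewrite mulrAC ler_pdivlMr.
pose S := (\sum_(0 <= a <oo) (expR (c0 * (h a)%:R))%:E * mu (cell Y (a, 0%N)))%E.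
have S0 : (0 <= S)%E.
  by apply: nneseries_ge0 => a _ _; rewrite mule_ge0// lee_fin expR_ge0.
have Sf : S \is a fin_num by rewrite ge0_fin_numE.
have tailB x : (idx x).2 = 0%N ->
    (avg (tweight x) (fun a => (expR (3 * (c0 / 3) * (h a)%:R))%:E) <= (k * fine S)%:E)%E.
  move=> x0; have -> : 3 * (c0 / 3) = c0 by field.
  have e0 a : (0 <= (expR (c0 * (h a)%:R))%:E)%E by rewrite lee_fin expR_ge0.
  apply: (@le_trans _ _ (avg q (fun a => (expR (c0 * (h a)%:R))%:E))).
    by apply: le_avgl => // [a|a]; [exact: tower_weight_ge0|exact: wq].
  rewrite EFinM fineK// /q avgZl//; last by move=> a; rewrite fine_ge0.
  apply: lee_wpmul2l; rewrite ?lee_fin//; apply: lee_nneseries => a _.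
    by rewrite mule_ge0// lee_fin fine_ge0.
  by rewrite fineK// muleC.
have K1 : 0 < c0 / 3 by rewrite divr_gt0.
exists (@Build_backward_chain R X T idx h br tweight (rate Y) (2 * C + C ^+ 2) (c0 / 3)
  (k * fine S) (@height_gt0 _ _ _ Y) (height_gcd Y) (@tower_branchK _ _ _ Y)
  (@idx_tower_branch _ _ _ Y) (@tower_branch_up _ _ _ Y) (@tower_weight_ge0 _ _ _ Y)
  (@tower_weight1 _ _ _ Y) (@tower_weight_gt0 _ _ _ Y) (rate_itv Y) K0
  (@tower_weight_distortion _ _ _ Y) K1 tailB).
by [].
Qed.

End tower_chain.

Lemma bounded_convergence {R : realType} {d : measure_display}
  {X : measurableType d} (mu : probability X R) (u : nat -> X -> R) (v : X -> R) (M : R) :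
  (forall n, measurable_fun setT (u n)) -> measurable_fun setT v ->
  (forall n x, `|u n x| <= M) -> (forall x, u ^~ x @ \oo --> v x) ->
  (\int[mu]_x (u n x)%:E @[n --> \oo] --> \int[mu]_x (v x)%:E)%E.
Proof.
move=> mun mv uM uv.
have [] := @dominated_convergence _ _ _ mu setT measurableT
  (fun n x => (u n x)%:E) (fun x => (v x)%:E) (cst M%:E) => //.
- by move=> n; exact/measurable_EFinP.
- exact/measurable_EFinP.
- by apply: aeW => x _; apply: cvg_EFin; [exact: nearW|exact: uv].
- exact: (@finite_measure_integrable_cst _ _ _ mu setT M).
- by apply: aeW => x n _; rewrite lee_fin.
Qed.

Lemma integral_cst_probability {R : realType} {d : measure_display}
  {X : measurableType d} (mu : probability X R) (k : R) :
  (\int[mu]_x k%:E = k%:E)%E.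
Proof. rewrite (integral_cst mu measurableT k%:E) -[RHS]mule1; congr (_ * _)%E; exact: probability_setT. Qed.

Section one_sided.
Context {R : realType} {d : measure_display} {X : measurableType d}.
Variable Y : uniform_young_tower R X.
Local Notation T := (tmap Y).
Local Notation mu := (tmeas Y).
Local Notation idx := (cell_index Y).
Local Notation br := (tower_branch Y).
Local Notation tw := (tower_weight Y).

Section chain.
Variable c : backward_chain R X.
Hypotheses (cbr : branch c = br) (cw : weight c = tw).

Lemma measurable_transfer (M : R) (f : X -> R) : measurable_fun setT f ->
  bounded_by M f -> measurable_fun setT (transfer c f).
Proof.
move=> mf fM; apply: measurableT_comp => //.
apply: measurable_avg => [x a|x a|a|a]; rewrite ?cw ?cbr.
- exact: tower_weight_ge0.
- by rewrite lee_fin; case/andP: (fM (br a x)).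
- exact: measurable_tower_weight.
- apply/measurable_EFinP; apply: measurableT_comp => //.
  exact: measurable_tower_branch.
Qed.

Lemma measurable_iter_transfer (M : R) (f : X -> R) n : measurable_fun setT f ->
  bounded_by M f -> measurable_fun setT (iter n (transfer c) f).
Proof.
move=> mf fM; elim: n => //= n IH; apply: (measurable_transfer IH).
exact: bounded_iter_transfer.
Qed.

Lemma integral_transfer (M : R) (f : X -> R) : measurable_fun setT f ->
  bounded_by M f ->
  (\int[mu]_x (transfer c f x)%:E = \int[mu]_x (f x)%:E)%E.
Proof.
move=> mf fM; rewrite [RHS]integral_tower_weight//; last first.
  by move=> x; case/andP: (fM x).
apply: eq_integral => x _; have [<- _] := avg_transfer c x fM.
by rewrite cw cbr.
Qed.

Lemma integral_iter_transfer (M : R) (f : X -> R) n : measurable_fun setT f ->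
  bounded_by M f ->
  (\int[mu]_x (iter n (transfer c) f x)%:E = \int[mu]_x (f x)%:E)%E.
Proof.
move=> mf fM; elim: n => //= n IH; rewrite (@integral_transfer M)//.
  exact: measurable_iter_transfer mf fM.
exact: bounded_iter_transfer.
Qed.

(** Since the images of [f] have all the same integral and their oscillation
    vanishes, they converge to this integral. *)
Lemma iter_transfer_cvg (M : R) (f : X -> R) : measurable_fun setT f ->
  bounded_by M f ->
  (forall x y e, 0 < e -> exists n0, forall n, (n0 <= n)%N ->
     `|iter n (transfer c) f x - iter n (transfer c) f y| <= e) ->
  forall x, (iter n (transfer c) f x @[n --> \oo] --> fine (\int[mu]_x (f x)%:E)%E).
Proof.
move=> mf fM merge; pose F n := iter n (transfer c) f; pose z : X := point.
have FM n x : 0 <= F n x <= M by exact: (bounded_iter_transfer c n fM).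
have mF n : measurable_fun setT (F n) by exact: measurable_iter_transfer mf fM.
have If0 : (0 <= \int[mu]_x (f x)%:E)%E.
  by apply: integral_ge0 => x _; rewrite lee_fin; case/andP: (fM x).
have IfM : (\int[mu]_x (f x)%:E <= M%:E)%E.
  apply: (@le_trans _ _ (\int[mu]_x (cst M%:E) x)%E).
    apply: ge0_le_integral => //.
    - by move=> x _; rewrite lee_fin; case/andP: (fM x).
    - exact/measurable_EFinP.
    - by move=> x _; rewrite lee_fin; case/andP: (fM x).
  by rewrite integral_cst_probability.
have Iff : (\int[mu]_x (f x)%:E)%E \is a fin_num.
  by rewrite ge0_fin_numE// (le_lt_trans IfM)// ltry.
set m := fine _; have mE : (m%:E = \int[mu]_x (f x)%:E)%E by rewrite fineK.
pose w n x := F n x + (M - F n z).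
have merge0 x y : F n x - F n y @[n --> \oo] --> (0 : R).
  apply/cvgrPdist_le => e e0; have [n0 hn0] := merge x y e e0.
  by exists n0 => // n /hn0; rewrite sub0r normrN.
have wM : forall x, w ^~ x @ \oo --> M.
  move=> x; rewrite -[M]add0r.
  rewrite [X in X @ _](_ : _ = fun n => (F n x - F n z) + M); last first.
    by apply/funext => n; rewrite /w; ring.
  by apply: cvgD; [exact: merge0|exact: cvg_cst].
have Iw n : (\int[mu]_x (w n x)%:E = (m + (M - F n z))%:E)%E.
  under eq_integral do rewrite /w EFinD.
  have IF : (\int[mu]_x (F n x)%:E = m%:E)%E.
    by rewrite mE; exact: integral_iter_transfer mf fM.
  rewrite ge0_integralD//.
  - by rewrite IF integral_cst_probability.
  - by move=> x _; rewrite lee_fin; case/andP: (FM n x).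
  - exact/measurable_EFinP.
  - by move=> x _; rewrite lee_fin subr_ge0; case/andP: (FM n z).
have : (\int[mu]_x (w n x)%:E @[n --> \oo] --> \int[mu]_x (cst M x)%:E)%E.
  apply: (@bounded_convergence _ _ _ mu w (cst M) (2 * M)) => //.
    by move=> n; apply: measurable_funD.
  move=> n x; have /andP[a0 a1] := FM n x; have /andP[b0 b1] := FM n z.
  by rewrite ler_norml /w; lra.
under eq_fun do rewrite Iw.
rewrite [X in _ --> X -> _](_ : _ = M%:E); last first.
  by rewrite integral_cst_probability.
move=> /fine_cvgP[_]; rewrite [fine \o _](_ : _ = fun n => m + (M - F n z)); last first.
  by apply/funext.
move=> cz x; have -> : m = M + 0 - (M - m) by ring.
rewrite [X in X @ _](_ : _ = fun n => ((F n x - F n z) + m - (m + (M - F n z)) + M)); last first.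
  by apply/funext => n; rewrite -/(F n); ring.
have -> : M + 0 - (M - m) = 0 + m - M + M by ring.
apply: cvgD; last exact: cvg_cst; apply: cvgB => //.
by apply: cvgD; [exact: merge0|exact: cvg_cst].
Qed.

Lemma integral_exp_iter_transfer (M : R) (f : X -> R) (a : nat -> R) n :
  measurable_fun setT f -> bounded_by M f ->
  (forall n x, (avg (tw x) (fun b => (expR (iter n (transfer c) f (br b x)))%:E)
            <= (expR (iter n.+1 (transfer c) f x + a n))%:E)%E) ->
  (\int[mu]_x (expR (f x))%:E <=
   (expR (\sum_(k < n) a k))%:E * \int[mu]_x (expR (iter n (transfer c) f x))%:E)%E.
Proof.
move=> mf fM step; have me u : measurable_fun setT u -> measurable_fun setT (fun x : X => expR (u x) : R).
  by move=> mu_; apply: measurableT_comp.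
elim: n => [|n IH]; first by rewrite big_ord0 expR0 mul1e.
apply: (le_trans IH); rewrite big_ord_recr/= expRD EFinM -muleA.
apply: lee_wpmul2l; first by rewrite lee_fin expR_ge0.
have mn k := measurable_iter_transfer k mf fM.
rewrite integral_tower_weight; [|exact: me|by move=> x; exact: expR_ge0].
rewrite -ge0_integralZl//; last first.
  by apply/measurable_EFinP; apply: me; exact: (mn n.+1).
apply: ge0_le_integral => //.
- by move=> x _; apply: avg_ge0 => [b|b]; [exact: tower_weight_ge0|rewrite lee_fin expR_ge0].
- apply: measurable_avg => [x b|x b|b|b].
  + exact: tower_weight_ge0.
  + by rewrite lee_fin expR_ge0.
  + exact: measurable_tower_weight.
  + apply/measurable_EFinP; apply: me; apply: measurableT_comp => //.
    exact: measurable_tower_branch.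
- by apply: measurable_funeM; apply/measurable_EFinP; apply: me; exact: (mn n.+1).
by move=> x _; rewrite -EFinM -expRD addrC; exact: step.
Qed.

End chain.

(** The integral of the exponential grows at each application of the transfer
    operator by a factor which is controlled by [exp_transfer], and it converges
    to the exponential of the integral. *)
Theorem one_sided_concentration : exponential_tails Y ->
  exists eps K : R, [/\ 0 < eps, 0 < K &
  forall (N : nat) (delta : nat -> R) (M : R) (f : X -> R),
    (forall j, 0 <= delta j <= eps) -> bounded_by M f -> measurable_fun setT f ->
    (forall x y, f x <= f y +
       \sum_(j < N) delta j * (idx (iter j T x) != idx (iter j T y))%:R) ->
    (\int[mu]_x (expR (f x))%:E <=
     (expR (fine (\int[mu]_x (f x)%:E) + K * \sum_(j < N) delta j ^+ 2))%:E)%E].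
Proof.
move=> tails; have [c [cT cl cb cw]] := exists_tower_chain tails.
have [x0 lx0 _] := exists_good_base (base_measure_gt0 Y).
have [|eps [K [e0 K0 H]]] := @exp_transfer _ _ c x0; first by rewrite /level cl.
exists eps, K; split => // N delta M f de fM mf fl.
have fl' : letterwise c N delta f by rewrite /letterwise cT cl.
have [[a [aS step]] merge] := H N delta M f de fM fl'.
rewrite cb cw in step.
have cvg := iter_transfer_cvg cb cw mf fM merge.
set m := fine _ in cvg *; set S := \sum_(j < N) _.
have mF n := measurable_iter_transfer cb cw n mf fM.
have FM n x : 0 <= iter n (transfer c) f x <= M := bounded_iter_transfer c n fM x.
have cvgI : (\int[mu]_x (expR (iter n (transfer c) f x))%:E @[n --> \oo]
    --> \int[mu]_x (cst (expR m) x)%:E)%E.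
  apply: (@bounded_convergence _ _ _ mu _ _ (expR M)) => //.
  - by move=> n; apply: measurableT_comp.
  - move=> n x; rewrite ger0_norm ?expR_ge0// ler_expR.
    by case/andP: (FM n x).
  - by move=> x; apply: (continuous_cvg _ (@continuous_expR R m)); exact: cvg.
rewrite [X in _ --> X](_ : _ = (expR m)%:E) in cvgI; last first.
  by rewrite integral_cst_probability.
rewrite addrC expRD EFinM.
have e1 : ((expR (K * S))%:E * \int[mu]_x (expR (iter n (transfer c) f x))%:E
    @[n --> \oo] --> (expR (K * S))%:E * (expR m)%:E)%E.
  by apply: cvgeM => //; exact: cvg_cst.
rewrite -(cvg_lim _ e1)//; apply: lime_ge; first by apply/cvg_ex; eexists; exact: e1.
apply: nearW => n.
apply: le_trans (integral_exp_iter_transfer cb cw n mf fM step) _.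
apply: lee_wpmul2r; last by rewrite lee_fin ler_expR.
by apply: integral_ge0 => x _; rewrite lee_fin expR_ge0.
Qed.

End one_sided.

(** * Exponential moments of bounded random variables *)

Section concentrated.
Context {R : realType} {d : measure_display} {X : measurableType d}.
Variable mu : probability X R.
Implicit Types (F G : X -> R) (k q D : R).

Definition mean F : R := fine (\int[mu]_x (F x)%:E)%E.

Definition concentrated F q :=
  (\int[mu]_x (expR (F x))%:E <= (expR (mean F + q))%:E)%E.

Definition bounded_measurable F :=
  measurable_fun setT F /\ exists M, forall x, `|F x| <= M.

Lemma bounded_measurable_integrable F :
  bounded_measurable F -> mu.-integrable setT (EFin \o F).
Proof.
move=> [mF [M FM]]; apply: measurable_bounded_integrable => //.
  by apply: le_lt_trans (probability_le1 mu measurableT) _; exact: ltry.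
exists M; split; first exact: num_real.
by move=> r Mr x _; apply: le_trans (FM x) (ltW Mr).
Qed.

Lemma meanE F : bounded_measurable F -> (\int[mu]_x (F x)%:E = (mean F)%:E)%E.
Proof.
move=> /bounded_measurable_integrable iF; rewrite /mean fineK//.
exact: integrable_fin_num.
Qed.

Lemma le_mean F G : bounded_measurable F -> bounded_measurable G ->
  (forall x, F x <= G x) -> mean F <= mean G.
Proof.
move=> bF bG FG; rewrite -lee_fin -!meanE//; apply: le_integral => //.
- exact: bounded_measurable_integrable.
- exact: bounded_measurable_integrable.
- by move=> x _; rewrite lee_fin.
Qed.

Lemma bounded_measurableD F k :
  bounded_measurable F -> bounded_measurable (fun x => F x + k).
Proof.
move=> [mF [M FM]]; split; first exact: measurable_funD.
exists (M + `|k|) => x; apply: le_trans (ler_normD _ _) _.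
by rewrite lerD2r.
Qed.

Lemma meanD F k : bounded_measurable F -> mean (fun x => F x + k) = mean F + k.
Proof.
move=> bF; apply: EFin_inj; rewrite -meanE; last exact: bounded_measurableD.
rewrite EFinD -meanE//.
rewrite -[X in (_ = _ + X)%E](integral_cst_probability mu).
rewrite -integralD_EFin//; first exact: bounded_measurable_integrable.
exact: (@finite_measure_integrable_cst _ _ _ mu setT k).
Qed.

Lemma measurable_expR_comp F : measurable_fun setT F ->
  measurable_fun setT (fun x => (expR (F x))%:E).
Proof.
by move=> mF; apply/measurable_EFinP; apply: measurableT_comp.
Qed.

Lemma concentrated_shift F k q : bounded_measurable F ->
  concentrated (fun x => F x + k) q -> concentrated F q.
Proof.
move=> bF; rewrite /concentrated meanD//.
under eq_integral do rewrite expRD mulrC EFinM.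
rewrite ge0_integralZl//; last by apply: measurable_expR_comp; case: bF.
have -> : mean F + k + q = k + (mean F + q) by ring.
rewrite expRD EFinM lee_pmul2l//; first by rewrite lte_fin expR_gt0.
Qed.

Lemma concentrated_compare F G q D : bounded_measurable F -> bounded_measurable G ->
  (forall x, `|F x - G x| <= D) ->
  concentrated G q -> concentrated F (q + 2 * D).
Proof.
move=> bF bG FGD cG.
have FG x : F x <= G x + D by have := FGD x; rewrite ler_norml; lra.
have GF x : G x <= F x + D by have := FGD x; rewrite ler_norml; lra.
rewrite /concentrated.
apply: (@le_trans _ _ (\int[mu]_x ((expR D)%:E * (expR (G x))%:E))%E).
  apply: ge0_le_integral => //.
  - by apply: measurable_expR_comp; case: bF.
  - by apply: measurable_funeM; apply: measurable_expR_comp; case: bG.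
  by move=> x _; rewrite -EFinM -expRD lee_fin ler_expR addrC.
rewrite ge0_integralZl//; last by apply: measurable_expR_comp; case: bG.
apply: (@le_trans _ _ ((expR D)%:E * (expR (mean G + q))%:E)%E).
  by apply: lee_wpmul2l => //; rewrite lee_fin expR_ge0.
rewrite -EFinM -expRD lee_fin ler_expR.
have := le_mean bG (bounded_measurableD D bF) GF; rewrite meanD//.
lra.
Qed.

Lemma concentrated_limit F q : bounded_measurable F ->
  (forall e, 0 < e -> concentrated F (q + e)) -> concentrated F q.
Proof.
move=> bF H; have [mF [M FM]] := bF.
have iE : (\int[mu]_x (expR (F x))%:E)%E \is a fin_num.
  rewrite ge0_fin_numE; last by apply: integral_ge0 => x _; rewrite lee_fin expR_ge0.
  by apply: le_lt_trans (H 1 ltr01) _; exact: ltry.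
have E0 : 0 < fine (\int[mu]_x (expR (F x))%:E)%E.
  apply: (@lt_le_trans _ _ (expR (- M))); first exact: expR_gt0.
  rewrite -lee_fin fineK// -(integral_cst_probability mu).
  apply: ge0_le_integral => //.
  - exact: measurable_expR_comp.
  by move=> x _; rewrite lee_fin ler_expR; have := FM x; rewrite ler_norml => /andP[].
rewrite /concentrated -(fineK iE) lee_fin -ler_ln ?posrE ?expR_gt0// expRK.
apply/ler_addgt0Pr => e e0; have := H e e0.
rewrite /concentrated -{1}(fineK iE) lee_fin -ler_ln ?posrE ?expR_gt0// expRK.
by rewrite addrA.
Qed.

End concentrated.

Section image_measure.
Context {R : realType} {d d' : measure_display}.
Context {X : measurableType d} {Z : measurableType d'}.
Variables (mu : probability X R) (nu : probability Z R) (phi : Z -> X).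
Hypothesis mphi : measurable_fun setT phi.
Hypothesis law : forall A, measurable A -> nu (phi @^-1` A) = mu A.

Lemma integral_image (u : X -> R) : measurable_fun setT u -> (forall x, 0 <= u x) ->
  (\int[nu]_z (u (phi z))%:E = \int[mu]_x (u x)%:E)%E.
Proof.
move=> mu_ u0; transitivity (\int[pushforward nu phi]_x (u x)%:E)%E.
  rewrite ge0_integral_pushforward//; first exact/measurable_EFinP.
  by move=> x _; rewrite lee_fin.
by apply: eq_measure_integral => A mA _; exact: law.
Qed.

Lemma concentrated_image (u : X -> R) q : measurable_fun setT u ->
  (forall x, 0 <= u x) -> concentrated mu u q -> concentrated nu (u \o phi) q.
Proof.
move=> mu_ u0; rewrite /concentrated /mean integral_image//.
by rewrite (integral_image (u := fun x => expR (u x)))//; exact: measurableT_comp.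
Qed.

End image_measure.

(** * Separately Lipschitz functions on the natural extension *)

(** The coordinates are changed one at a time. *)
Lemma separately_lipschitz_sum {R : realType} (X : Type) (dist : X -> X -> R) n
  (K : ('I_n -> X) -> R) (Lip : 'I_n -> R) : separately_lipschitz dist K Lip ->
  forall x y, `|K x - K y| <= \sum_(i < n) Lip i * dist (x i) (y i).
Proof.
move=> KL x y; pose mix m (i : 'I_n) := if (i < m)%N then y i else x i.
have mixP m : (m <= n)%N ->
    `|K x - K (mix m)| <= \sum_(i < n | (i < m)%N) Lip i * dist (x i) (y i).
  elim: m => [_|m IH mn].
    by rewrite (_ : mix 0%N = x)// subrr normr0 big_pred0.
  pose i0 := Ordinal mn; have im := KL i0 (mix m) (mix m.+1).
  rewrite (bigD1 i0)//=.
  rewrite (_ : K x - K (mix m.+1) = (K (mix m) - K (mix m.+1)) + (K x - K (mix m))); last by ring.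
  apply: le_trans (ler_normD _ _) _; apply: lerD.
    have e1 : mix m i0 = x i0 by rewrite /mix /= ltnn.
    have e2 : mix m.+1 i0 = y i0 by rewrite /mix /= ltnSn.
    move: im; rewrite e1 e2; apply => j ji.
    rewrite /mix ltnS [in RHS]leq_eqVlt.
    by rewrite -[(j : nat) == m]/(j == i0) (negbTE ji).
  rewrite [leRHS](eq_bigl (fun i : 'I_n => (i < m)%N)); first exact: IH (ltnW mn).
  move=> i /=; rewrite ltnS leq_eqVlt -[(i : nat) == m]/(i == i0).
  by have [->|_] := eqVneq i i0; rewrite ?ltnn ?andbT ?andbF.
rewrite (_ : y = mix n); last by apply/funext => i; rewrite /mix ltn_ord.
apply: le_trans (mixP n (leqnn _)) _.
rewrite le_eqVlt; apply/orP; left; apply/eqP; apply: eq_big => [i|i _].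
  by rewrite ltn_ord.
by rewrite /mix ltn_ord.
Qed.

Section natural_extension.
Context {R : realType} {d : measure_display} {X : measurableType d}.
Variable Y : uniform_young_tower R X.
Local Notation T := (tmap Y).
Local Notation mu := (tmeas Y).
Local Notation idx := (cell_index Y).
Local Notation D := (tower_index (height Y)).
Local Notation Z := (natural_extension Y).
Local Notation coord := Defs.coord.

Lemma tmap_coord k (z : Z) : T (coord k z) = coord (k + 1) z.
Proof. exact: (set_mem (valP z) k). Qed.

Lemma iter_tmap_coord n k (z : Z) : iter n T (coord k z) = coord (k + n%:Z) z.
Proof.
elim: n => [|n IH]; first by rewrite addr0.
by rewrite iterS IH tmap_coord -addrA -[n.+1]addn1 PoszD.
Qed.

Lemma coord_shiftZ j k (z : Z) : coord j (shiftZ k z) = coord (j + k) z.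
Proof. by []. Qed.

Lemma measurable_coord k : measurable_fun setT (coord k : Z -> X).
Proof.
move=> _ A mA; apply: sub_sigma_algebra; exists k => //.
by exists A.
Qed.

Lemma exists_biorbit k x : exists z : Z, coord k z = x.
Proof.
have [S TS] := choice (@tmap_surj _ _ _ Y).
have zP : biorbits Y (fun k : int => match k with
  | Posz n => iter n T x
  | Negz n => iter n.+1 S x end).
  case=> [n|[|n]].
  - by rewrite [Posz n + 1]addrC.
  - by rewrite /= TS.
  - have -> : Negz n.+1 + 1 = Negz n.
      by rewrite !NegzE -[n.+2]addn1 PoszD opprD addrNK.
    by rewrite /= TS.
exists (shiftZ (- k) (mk_biorbit zP : Z)); rewrite coord_shiftZ subrr.
by [].
Qed.

Definition letter k (z : Z) := idx (coord k z).

Variable be : R.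
Hypothesis be01 : 0 < be < 1.
Let be0 : 0 < be. Proof. by case/andP: be01. Qed.
Let be1 : be < 1. Proof. by case/andP: be01. Qed.
Local Notation dist := (distZ Y be).

Lemma distZ_le (z z' : Z) b : 0 <= b ->
  (forall k, letter k z <> letter k z' -> be ^+ `|k|%N <= b) -> dist z z' <= b.
Proof.
move=> b0 H; rewrite /distZ /separation_timeZ /first_time.
case: pselect => [ex|//] /=; case: ex_minnP => n /asboolP[k <- nk] _.
apply: H => e; apply: nk.
have := (same_cellE Y (coord k z) (coord k z')).2 e.
by case=> i [Di iz iz']; exists i; split => //; rewrite /cellZ /= coord_shiftZ add0r.
Qed.

Lemma distZ_ge0 z z' : 0 <= dist z z'.
Proof.
by rewrite /distZ; case: separation_timeZ => //= n; rewrite exprn_ge0// ltW.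
Qed.

Lemma distZ_le1 z z' : dist z z' <= 1.
Proof. by apply: distZ_le => // k _; rewrite exprn_ile1// ltW. Qed.

Definition gap (j k : nat) : nat := (j - k + (k - j))%N.

Lemma sum_gap_le n s a : \sum_(i < n) be ^+ gap (i + s) a <= 2 / (1 - be).
Proof.
have be_itv : 0 <= be < 1 by rewrite be1 ltW.
have g0 k : 0 <= be ^+ k by rewrite exprn_ge0// ltW.
apply: (@le_trans _ _ (\sum_(k < n + s) be ^+ gap k a)).
  rewrite -(big_mkord xpredT (fun k => be ^+ gap k a)).
  rewrite [leRHS](big_cat_nat (leq0n s) (leq_addl n s))/=.
  have -> : \sum_(i < n) be ^+ gap (i + s) a = \sum_(s <= k < n + s) be ^+ gap k a.
    by rewrite -{2}[s]add0n big_addn addnK big_mkord.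
  by rewrite lerDr; apply: sumr_ge0.
apply: (@le_trans _ _ (\sum_(k < n + s | (k <= a)%N) be ^+ (a - k) +
                       \sum_(k < n + s | (a <= k)%N) be ^+ (k - a))).
  rewrite [X in _ <= X + _]big_mkcond [X in _ <= _ + X]big_mkcond -big_split/=; apply: ler_sum => k _.
  rewrite /gap; case: (ltngtP k a) => ka.
  - by rewrite (eqP (ltnW ka : (k - a)%N == 0%N)) add0n addr0.
  - by rewrite (eqP (ltnW ka : (a - k)%N == 0%N)) addn0 add0r.
  - by rewrite ka subnn expr0 lerDl.
have h := sum_geometric_le.
apply: (@le_trans _ _ ((1 - be)^-1 + (1 - be)^-1)); last by lra.
apply: lerD.
  apply: le_trans (sum_convolution_le (u := fun k => be ^+ k) (n + s) a g0) _.
  exact: sum_geometric_le.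
apply: le_trans (sum_shift_le (u := fun k => be ^+ k) a (n + s) g0) _.
exact: sum_geometric_le.
Qed.

Section window.
Variables (n : nat) (K : ('I_n -> Z) -> R) (Lip : 'I_n -> R) (M : R).
Hypothesis Lip0 : forall i, 0 <= Lip i.
Hypothesis K_lip : separately_lipschitz dist K Lip.

Definition along_orbit (z : Z) : R := K (fun i => iter i (tmapZ Y) z).
Local Notation F := along_orbit.
Local Notation S := (\sum_(i < n) Lip i).

Let S0 : 0 <= S. Proof. exact: sumr_ge0. Qed.

Lemma along_orbit_lipschitz z z' :
  F z - F z' <= \sum_(i < n) Lip i * dist (shiftZ i%:Z z) (shiftZ i%:Z z').
Proof.
apply: le_trans (ler_norm _) _.
apply: le_trans (separately_lipschitz_sum K_lip _ _) _.
by under eq_bigr do rewrite !iter_tmapZ.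
Qed.

Lemma along_orbit_osc z z' : F z - F z' <= S.
Proof.
apply: le_trans (along_orbit_lipschitz z z') _; apply: ler_sum => i _.
by apply: ler_piMr => //; exact: distZ_le1.
Qed.

(** The number of letters from time [-m] to time [m + n]; they include those at
    distance at most [m] from each of the [n] first times. *)
Definition window (m : nat) : nat := (2 * m + n).+1.

Definition same_window m (x : X) (z : Z) := forall j, (j < window m)%N ->
  letter (j%:Z - m%:Z) z = idx (iter j T x).

(** The choice depends on the letters of the window only, which makes [windowed]
    below a function of finitely many letters of a one-sided orbit. *)
Definition representative m x : Z := get [set z | same_window m x z].
Local Notation rep := representative.

Definition windowed m x : R := F (rep m x).

Lemma letter_coord m z j :
  idx (iter j T (coord (- m%:Z) z)) = letter (j%:Z - m%:Z) z.
Proof. by rewrite iter_tmap_coord addrC. Qed.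

Lemma representativeP m x : same_window m x (rep m x).
Proof.
suff : [set z | same_window m x z] (rep m x) by [].
have [z zx] := exists_biorbit (- m%:Z) x.
by apply: getPex; exists z => j _; rewrite -letter_coord zx.
Qed.

Lemma eq_representative m x y :
  (forall j, (j < window m)%N -> idx (iter j T x) = idx (iter j T y)) ->
  rep m x = rep m y.
Proof.
move=> xy; rewrite /rep; congr get; apply/seteqP.
by split => z zx j jm; rewrite (zx j jm) xy.
Qed.

Lemma outside_window m (i : 'I_n) (k : int) :
  ~ (exists2 j, (j < window m)%N & j%:Z - m%:Z = k + i%:Z) -> (m <= `|k|)%N.
Proof.
move=> out; rewrite leqNgt; apply/negP => km; apply: out.
have in_ := ltn_ord i; rewrite /window.
by exists `|(k + i%:Z + m%:Z)%R|%N; lia.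
Qed.

Lemma windowed_near m z : `|F z - windowed m (coord (- m%:Z) z)| <= S * be ^+ m.
Proof.
rewrite /windowed; set z' := rep m _.
have le1 u u' : (forall j, (j < window m)%N -> letter (j%:Z - m%:Z) u = letter (j%:Z - m%:Z) u') ->
    F u - F u' <= S * be ^+ m.
  move=> uu; apply: le_trans (along_orbit_lipschitz u u') _.
  rewrite mulr_suml; apply: ler_sum => i _; apply: ler_wpM2l => //.
  apply: distZ_le => [|k]; first by rewrite exprn_ge0// ltW.
  rewrite /letter !coord_shiftZ => kk.
  apply: ler_wiXn2l; [exact: ltW|exact: ltW|].
  by apply: (@outside_window m i) => -[j jm jk]; apply: kk; rewrite -jk; exact: uu.
have zz' j : (j < window m)%N -> letter (j%:Z - m%:Z) z' = letter (j%:Z - m%:Z) z.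
  by move=> jm; rewrite (representativeP _ jm) letter_coord.
rewrite ler_norml; apply/andP; split; last first.
  by apply: le1 => j /zz'.
rewrite lerNl opprB; exact: le1.
Qed.

(** The term [be ^+ m] accounts for the letters outside of the window, where two
    representatives may differ arbitrarily. *)
Definition letter_weight m (j : nat) : R :=
  \sum_(i < n) Lip i * (be ^+ gap (i + m) j + be ^+ m).

Lemma letter_weight_ge0 m j : 0 <= letter_weight m j.
Proof.
apply: sumr_ge0 => i _; apply: mulr_ge0 => //.
by rewrite addr_ge0// exprn_ge0// ltW.
Qed.

(** A difference outside of the window costs at most [be ^+ m], which is charged to
    some differing letter of the window: if there were none, then the
    representatives would be the same. *)
Lemma windowed_letterwise m x y :
  windowed m x <= windowed m y +
  \sum_(j < window m) letter_weight m j * (idx (iter j T x) != idx (iter j T y))%:R.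
Proof.
set dif := fun j => idx (iter j T x) != idx (iter j T y).
have b0 k : 0 <= be ^+ k by rewrite exprn_ge0// ltW.
have [/existsP[j0 dj0]|/existsPn same] := boolP [exists j : 'I_(window m), dif j]; last first.
  rewrite /windowed (@eq_representative m x y); last first.
    by move=> j jm; have := same (Ordinal jm); rewrite /dif negbK => /eqP.
  by rewrite lerDl; apply: sumr_ge0 => j _; rewrite mulr_ge0// letter_weight_ge0.
rewrite addrC -lerBlDr; apply: le_trans (along_orbit_lipschitz _ _) _.
have -> : \sum_(j < window m) letter_weight m j * (dif j)%:R =
  \sum_(i < n) Lip i * \sum_(j < window m) (be ^+ gap (i + m) j + be ^+ m) * (dif j)%:R.
  under eq_bigr do rewrite /letter_weight mulr_suml.
  rewrite exchange_big/=; apply: eq_bigr => i _; rewrite mulr_sumr.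
  by apply: eq_bigr => j _; rewrite mulrA.
apply: ler_sum => i _; apply: ler_wpM2l => //.
have term0 (j : 'I_(window m)) : 0 <= (be ^+ gap (i + m) j + be ^+ m) * (dif j)%:R.
  by rewrite mulr_ge0// addr_ge0.
have pick (j : 'I_(window m)) : dif j ->
    be ^+ gap (i + m) j + be ^+ m <=
    \sum_(j < window m) (be ^+ gap (i + m) j + be ^+ m) * (dif j)%:R.
  move=> dj; rewrite (bigD1 j)//= dj mulr1 lerDl.
  by apply: sumr_ge0 => k _; exact: term0.
apply: distZ_le => [|k]; first by apply: sumr_ge0 => j _; exact: term0.
rewrite /letter !coord_shiftZ => kk.
have [[j jm jk]|out] := pselect (exists2 j, (j < window m)%N & j%:Z - m%:Z = k + i%:Z).
  have dj : dif j.
    apply/eqP => e; apply: kk; rewrite -jk.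
    have ex := @representativeP m x j jm.
    have ey := @representativeP m y j jm.
    by rewrite /letter in ex ey; rewrite ex ey.
  apply: le_trans (pick (Ordinal jm) dj) => /=.
  have -> : gap (i + m) j = `|k|%N by rewrite /gap; lia.
  by rewrite lerDl.
apply: le_trans (pick j0 dj0).
rewrite -[leLHS]add0r; apply: lerD => //.
apply: ler_wiXn2l; [exact: ltW|exact: ltW|exact: (@outside_window m i)].
Qed.

Lemma measurable_idx i : measurable [set x | idx x = i].
Proof.
have [Di|nDi] := pselect (D i).
  by rewrite -(cell_index_setE Di); exact: cell_measurable.
rewrite (_ : [set x | _] = set0)//; apply/seteqP; split => // x /= xi.
by apply: nDi; rewrite -xi; have [] := cell_indexP Y x.
Qed.

Lemma measurable_iter_tmap j : measurable_fun setT (iter j T).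
Proof.
have [mT _] := tmeas_invariant Y.
elim: j => [|j IH]; first exact: measurable_id.
by rewrite (_ : iter j.+1 T = T \o iter j T)//; exact: measurableT_comp.
Qed.

Lemma measurable_windowed m : measurable_fun setT (windowed m).
Proof.
move=> _ B mB; rewrite setTI.
pose word x := [tuple idx (iter j T x) | j < window m].
have -> : windowed m @^-1` B = \bigcup_(w in [set: (window m).-tuple (nat * nat)])
    (if `[< exists2 x, word x = w & B (windowed m x) >] then
       \bigcap_j (if insub j is Some j' then [set x | idx (iter j T x) = tnth w j'] else setT)
     else set0).
  apply/seteqP; split => [x Bx|x [w _]].
    exists (word x) => //; rewrite asboolT; last by exists x.
    by move=> j _; case: insubP => // j' _ <- /=; rewrite tnth_mktuple.
  case: asboolP => // -[y <- By] xw /=; rewrite (_ : windowed m x = windowed m y)//.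
  rewrite /windowed; congr F; apply: eq_representative => j jm.
  by have := xw j I; rewrite insubT /= tnth_mktuple.
apply: countable_bigcupT_measurable => // w; case: asboolP => // _.
apply: bigcapT_measurable => j; case: insubP => // j' _ _.
have := @measurable_iter_tmap j measurableT _ (measurable_idx (tnth w j')).
by rewrite setTI.
Qed.

End window.

End natural_extension.

Section letter_weights.
Context {R : realType} (be : R) (n : nat) (Lip : 'I_n -> R).
Hypothesis be01 : 0 < be < 1.
Hypothesis Lip0 : forall i, 0 <= Lip i.
Local Notation S := (\sum_(i < n) Lip i).
Local Notation L := (\sum_(i < n) Lip i ^+ 2).
Local Notation B := (2 / (1 - be)).
Let be0 : 0 < be. Proof. by case/andP: be01. Qed.
Let be1 : be < 1. Proof. by case/andP: be01. Qed.
Let B0 : 0 < B. Proof. by rewrite divr_gt0// subr_gt0. Qed.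
Let b0 k : 0 <= be ^+ k. Proof. by rewrite exprn_ge0// ltW. Qed.

Lemma gapC j k : gap j k = gap k j. Proof. by rewrite /gap addnC. Qed.

Lemma letter_weightE m j : letter_weight be Lip m j =
  \sum_(i < n) be ^+ gap (i + m) j * Lip i + S * be ^+ m.
Proof.
rewrite /letter_weight mulr_suml -big_split/=; apply: eq_bigr => i _.
by rewrite mulrDr mulrC.
Qed.

Lemma letter_weight_le m j (e : R) : 0 <= e -> (forall i, Lip i <= e) ->
  letter_weight be Lip m j <= e * B + S * be ^+ m.
Proof.
move=> e0 Le; rewrite letter_weightE lerD2r.
apply: (@le_trans _ _ (e * \sum_(i < n) be ^+ gap (i + m) j)).
  by rewrite mulr_sumr; apply: ler_sum => i _; rewrite mulrC ler_wpM2r.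
by apply: ler_wpM2l => //; exact: sum_gap_le.
Qed.

Lemma sum_letter_weight_sq m N : \sum_(j < N) letter_weight be Lip m j ^+ 2 <=
  2 * B ^+ 2 * L + 2 * N%:R * (S * be ^+ m) ^+ 2.
Proof.
pose A (j : nat) := \sum_(i < n) be ^+ gap (i + m) j * Lip i.
apply: (@le_trans _ _ (\sum_(j < N) (2 * A j ^+ 2 + 2 * (S * be ^+ m) ^+ 2))).
  apply: ler_sum => j _; rewrite letter_weightE -/(A j).
  rewrite -subr_ge0; set s := S * _.
  rewrite (_ : _ - _ = (A j - s) ^+ 2); first exact: sqr_ge0.
  by ring.
rewrite big_split/= sumr_const card_ord -[X in _ + X]mulr_natl.
apply: lerD; last by rewrite mulrA [N%:R * 2]mulrC.
rewrite -mulr_sumr -[leRHS]mulrA; apply: ler_wpM2l => //.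
apply: (@le_trans _ _ (\sum_(j < N) B * \sum_(i < n) be ^+ gap (i + m) j * Lip i ^+ 2)).
  apply: ler_sum => j _; apply: le_trans (weighted_cauchy _ _ _) _ => //.
  apply: ler_wpM2r; first by apply: sumr_ge0 => i _; rewrite mulr_ge0// sqr_ge0.
  exact: sum_gap_le.
rewrite -mulr_sumr -[leRHS]mulrA; apply: ler_wpM2l; first exact: ltW.
rewrite exchange_big/= mulr_sumr; apply: ler_sum => i _.
rewrite -mulr_suml; apply: ler_wpM2r; first exact: sqr_ge0.
under eq_bigr do rewrite gapC -[X in gap X]addn0.
exact: sum_gap_le.
Qed.

(** Letting the window grow, the truncation errors vanish. *)
Lemma window_errors_small (K e : R) : 0 <= K -> 0 < e -> exists m,
  S * be ^+ m <= e /\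
  K * (2 * (window n m)%:R * (S * be ^+ m) ^+ 2) + 2 * (S * be ^+ m) <= e.
Proof.
move=> K0 e0; have S0 : 0 <= S by exact: sumr_ge0.
have bi : 0 <= be < 1 by rewrite be1 ltW.
pose Q := B + n.+1%:R.
have Q0 : 0 <= Q by rewrite addr_ge0// ltW.
have wQ m : (window n m)%:R * be ^+ m <= Q.
  have bm1 : be ^+ m <= 1 by rewrite exprn_ile1// ltW.
  have : m%:R * be ^+ m <= (1 - be)^-1.
    apply: le_trans (sum_geometric_le m bi).
    rewrite -[m in m%:R]card_ord mulr_natl -sumr_const; apply: ler_sum => k _.
    by apply: ler_wiXn2l; [exact: ltW|exact: ltW|exact: ltnW].
  rewrite /window -addnS natrD natrM mulrDl.
  have : n.+1%:R * be ^+ m <= n.+1%:R by apply: ler_piMr.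
  by rewrite /Q; lra.
have T0 : 0 <= K * 2 * Q * S ^+ 2 + 2 * S.
  by rewrite addr_ge0 ?mulr_ge0// ?sqr_ge0.
have [m1 h1] := geometric_small bi S0 e0.
have [m2 h2] := geometric_small bi T0 e0.
exists (maxn m1 m2); set m := maxn _ _; split; first by apply: h1; exact: leq_maxl.
apply: le_trans (h2 m (leq_maxr _ _)).
have -> : K * (2 * (window n m)%:R * (S * be ^+ m) ^+ 2) + 2 * (S * be ^+ m) =
  K * 2 * ((window n m)%:R * be ^+ m) * S ^+ 2 * be ^+ m + 2 * S * be ^+ m by ring.
rewrite [leRHS]mulrDl lerD2r; apply: ler_wpM2r => //; apply: ler_wpM2r; first exact: sqr_ge0.
by apply: ler_wpM2l; [rewrite mulr_ge0|exact: wQ].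
Qed.

End letter_weights.

Section natural_extension_concentration.
Context {R : realType} {d : measure_display} {X : measurableType d}.
Variable Y : uniform_young_tower R X.
Local Notation T := (tmap Y).
Local Notation mu := (tmeas Y).
Local Notation Z := (natural_extension Y).
Local Notation coord := Defs.coord.
Variable muZ : probability Z R.
Hypothesis muZP : natural_extension_measure muZ.
Variable be : R.
Hypothesis be01 : 0 < be < 1.
Local Notation dist := (distZ Y be).
Let be0 : 0 < be. Proof. by case/andP: be01. Qed.
Let be1 : be < 1. Proof. by case/andP: be01. Qed.

Lemma coord_law m A : measurable A -> muZ (coord (- m%:Z) @^-1` A) = mu A.
Proof.
move=> mA; have [[_ inv] law] := muZP.
elim: m => [|m <-]; first by rewrite oppr0; exact: law.
have -> : coord (- m%:Z) @^-1` A = tmapZ Y @^-1` (coord (- m.+1%:Z) @^-1` A) :> set Z.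
  apply/seteqP; split => z /=; rewrite /tmapZ coord_shiftZ.
    by rewrite (_ : - m.+1%:Z + 1 = - m%:Z)//; lia.
  by rewrite (_ : - m.+1%:Z + 1 = - m%:Z)//; lia.
rewrite inv//; have := @measurable_coord _ _ _ Y (- m.+1%:Z) measurableT _ mA.
by rewrite setTI.
Qed.

Section lipschitz.
Variables (n : nat) (K : ('I_n -> Z) -> R) (Lip : 'I_n -> R).
Hypothesis Lip0 : forall i, 0 <= Lip i.
Hypothesis K_lip : separately_lipschitz dist K Lip.
Local Notation F := (along_orbit K).
Local Notation S := (\sum_(i < n) Lip i).

Lemma bounded_along_orbit : exists M, forall z, `|F z| <= M.
Proof.
exists (`|F point| + S) => z.
have := along_orbit_osc be01 Lip0 K_lip z point.
have := along_orbit_osc be01 Lip0 K_lip point z.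
have := ler_norm (F point); have := ler_norm (- F point); rewrite normrN.
by rewrite [`|F z| <= _]ler_norml; lra.
Qed.

(** A separately Lipschitz function is a uniform limit of functions of finitely
    many letters. *)
Lemma measurable_along_orbit : measurable_fun setT F.
Proof.
apply: (@measurable_fun_cvg _ _ _ setT (fun m (z : Z) => windowed K m (coord (- m%:Z) z))) => //.
  move=> m; apply: measurableT_comp; first exact: measurable_windowed.
  exact: measurable_coord.
move=> z _; apply/cvgrPdist_le => e e0.
have S0 : 0 <= S by exact: sumr_ge0.
have bi : 0 <= be < 1 by rewrite be1 ltW.
have [m0 hm0] := geometric_small bi S0 e0.
exists m0 => // m /hm0; apply: le_trans.
exact: (windowed_near be01 Lip0 K_lip).
Qed.

Lemma bounded_measurable_along_orbit : bounded_measurable F.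
Proof. by split; [exact: measurable_along_orbit|exact: bounded_along_orbit]. Qed.

End lipschitz.

Section small.
Variables eps K0 : R.
Hypothesis eps0 : 0 < eps.
Hypothesis K00 : 0 < K0.
Hypothesis one_sided :
  forall (N : nat) (delta : nat -> R) (M : R) (f : X -> R),
    (forall j, 0 <= delta j <= eps) -> bounded_by M f -> measurable_fun setT f ->
    (forall x y, f x <= f y +
       \sum_(j < N) delta j * (cell_index Y (iter j T x) != cell_index Y (iter j T y))%:R) ->
    concentrated mu f (K0 * \sum_(j < N) delta j ^+ 2).
Local Notation B := (2 / (1 - be)).
Local Notation eps1 := (eps / (2 * B)).

Let B0 : 0 < B. Proof. by rewrite divr_gt0// subr_gt0. Qed.
Let eps10 : 0 < eps1. Proof. by rewrite divr_gt0// mulr_gt0. Qed.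

Lemma small_lipschitz_concentration n (K : ('I_n -> Z) -> R) (Lip : 'I_n -> R) :
  (forall i, 0 <= Lip i <= eps1) -> separately_lipschitz dist K Lip ->
  concentrated muZ (along_orbit K) (2 * K0 * B ^+ 2 * \sum_(i < n) Lip i ^+ 2).
Proof.
move=> LipE KL.
have Lip0 i : 0 <= Lip i by case/andP: (LipE i).
have Lip1 i : Lip i <= eps1 by case/andP: (LipE i).
pose S := \sum_(i < n) Lip i.
have S0 : 0 <= S by exact: sumr_ge0.
(* Adding this constant makes the function nonnegative. *)
apply: (@concentrated_shift _ _ _ muZ _ (S - along_orbit K point)).
  exact: bounded_measurable_along_orbit KL.
pose K' (x : 'I_n -> Z) := K x + (S - along_orbit K point).
have K'L : separately_lipschitz dist K' Lip.
  by move=> i x x' xx; rewrite /K' opprD addrACA subrr addr0; exact: KL.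
rewrite -/(along_orbit K').
have F0 z : 0 <= along_orbit K' z <= 2 * S.
  have := along_orbit_osc be01 Lip0 KL z point.
  have := along_orbit_osc be01 Lip0 KL point z.
  by rewrite /along_orbit/= /K' /along_orbit -/S; lra.
have bF := bounded_measurable_along_orbit Lip0 K'L.
apply: concentrated_limit => // e e0.
have [m [hm1 hm2]] : exists m, S * be ^+ m <= Num.min e (eps / 2) /\
  K0 * (2 * (window n m)%:R * (S * be ^+ m) ^+ 2) + 2 * (S * be ^+ m) <= Num.min e (eps / 2).
  by apply: window_errors_small => //; [exact: ltW|rewrite lt_min e0 divr_gt0].
rewrite !le_min in hm1 hm2; case/andP: hm1 => _ hm1; case/andP: hm2 => hm2 _.
have cf : concentrated mu (windowed K' m)
    (K0 * \sum_(j < window n m) letter_weight be Lip m j ^+ 2).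
  apply: (@one_sided _ _ (2 * S)) => //.
  - move=> j; rewrite letter_weight_ge0//=.
    apply: le_trans (letter_weight_le be01 m j (ltW eps10) Lip1) _.
    rewrite (_ : eps1 * B = eps / 2); first by rewrite -/S; lra.
    by field; rewrite !gt_eqF// subr_gt0.
  - by move=> x; exact: F0.
  - exact: measurable_windowed.
  - exact: (windowed_letterwise be01 Lip0 K'L).
have mc := @measurable_coord _ _ _ Y (- m%:Z).
have mw := measurable_windowed K' m.
have := concentrated_image (nu := muZ) mc (coord_law m) mw (fun x => proj1 (andP (F0 _))) cf.
have bG : bounded_measurable (windowed K' m \o coord (- m%:Z) : Z -> R).
  split; first exact: measurableT_comp.
  by exists (2 * S) => z; have := F0 (representative Y n m (coord (- m%:Z) z));
    rewrite ler_norml /windowed /=; lra.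
move=> /(concentrated_compare bF bG (windowed_near be01 Lip0 K'L m)) /le_trans; apply.
rewrite lee_fin ler_expR lerD2l.
have := ler_wpM2l (ltW K00) (sum_letter_weight_sq Lip be01 m (window n m)).
by rewrite -/S in hm2 *; lra.
Qed.

(** The coordinates with a large Lipschitz constant are fixed: each of them
    changes the function by at most [Lip i], hence by at most
    [Lip i ^+ 2 / eps1]. *)
Lemma lipschitz_concentration n (K : ('I_n -> Z) -> R) (Lip : 'I_n -> R) :
  separately_lipschitz dist K Lip ->
  concentrated muZ (along_orbit K)
    ((2 / eps1 + 2 * K0 * B ^+ 2) * \sum_(i < n) Lip i ^+ 2).
Proof.
move=> KL0; pose aLip i := `|Lip i|.
have KL : separately_lipschitz dist K aLip.
  move=> i x y xy; apply: le_trans (KL0 i x y xy) _.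
  by apply: ler_wpM2r; [exact: distZ_ge0|exact: ler_norm].
have aLip0 i : 0 <= aLip i by exact: normr_ge0.
pose small i := aLip i <= eps1.
pose froze (x : 'I_n -> Z) i := if small i then x i else point.
pose K' x := K (froze x).
pose Lip' i := if small i then aLip i else 0.
have Lip'0 i : 0 <= Lip' i by rewrite /Lip'; case: ifP.
have K'L : separately_lipschitz dist K' Lip'.
  move=> i x y xy; rewrite /Lip'; case: ifPn => si.
    have -> : x i = froze x i by rewrite /froze si.
    have -> : y i = froze y i by rewrite /froze si.
    by apply: KL => j ji; rewrite /froze; case: ifP => // _; exact: xy.
  rewrite mul0r /K' (_ : froze x = froze y) ?subrr ?normr0//.
  apply/funext => j; rewrite /froze; case: ifP => // sj; apply: xy.
  by apply/eqP => ji; move: si; rewrite -ji sj.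
have c' : concentrated muZ (along_orbit K')
    (2 * K0 * B ^+ 2 * \sum_(i < n) Lip' i ^+ 2).
  apply: small_lipschitz_concentration => // i.
  by rewrite Lip'0 /Lip'; case: ifP => // _; exact: ltW.
have price z : `|along_orbit K z - along_orbit K' z| <=
    eps1^-1 * \sum_(i < n) Lip i ^+ 2.
  apply: le_trans (separately_lipschitz_sum KL _ _) _.
  rewrite mulr_sumr; apply: ler_sum => i _.
  have sq0 : 0 <= eps1^-1 * Lip i ^+ 2.
    by rewrite mulr_ge0 ?sqr_ge0// invr_ge0 ltW.
  rewrite /froze; case: ifPn => [_|].
    rewrite (_ : dist _ _ = 0) ?mulr0//; apply/eqP; rewrite eq_le distZ_ge0// andbT.
    exact: distZ_le.
  rewrite /small -ltNge => /ltW big.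
  apply: (@le_trans _ _ (aLip i)); first by apply: ler_piMr => //; exact: distZ_le1.
  rewrite ler_pdivlMl// -[Lip i ^+ 2]real_normK ?num_real// expr2.
  exact: ler_wpM2r.
have bF := bounded_measurable_along_orbit aLip0 KL.
have bF' := bounded_measurable_along_orbit Lip'0 K'L.
have := concentrated_compare bF bF' price c' => /le_trans; apply.
rewrite lee_fin ler_expR lerD2l [leRHS]mulrDl [leRHS]addrC; apply: lerD; last first.
  by rewrite [leLHS]mulrA.
apply: ler_wpM2l; first by rewrite mulr_ge0 ?sqr_ge0// mulr_ge0// ltW.
apply: ler_sum => i _; rewrite /Lip'; case: ifP => _.
  by rewrite real_normK ?num_real.
by rewrite expr0n/= sqr_ge0.
Qed.

End small.

End natural_extension_concentration.

Theorem theorem3p4 (R : realType) (d : measure_display) (X : measurableType d)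
    (Y : uniform_young_tower R X) (tails : exponential_tails Y)
    (betaZ : R) (betaZ_itv : 0 < betaZ < 1)
    (muZ : probability (natural_extension Y) R)
    (muZP : natural_extension_measure muZ) :
  exists2 C : R, 0 < C &
    forall (n : nat) (K : ('I_n -> natural_extension Y) -> R)
      (Lip : 'I_n -> R), (1 <= n)%N ->
      separately_lipschitz (distZ Y betaZ) K Lip ->
      (\int[muZ]_x expeR (K (fun i => iter i (tmapZ Y) x))%:E
       <= expeR (\int[muZ]_x (K (fun i => iter i (tmapZ Y) x))%:E)
          * (expR (C * (\sum_(i < n) Lip i ^+ 2)%R))%:E)%E.
Proof.
have [eps [K0 [eps0 K00 one]]] := one_sided_concentration tails.
have b1 : 0 < 1 - betaZ by rewrite subr_gt0; case/andP: betaZ_itv.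
exists (2 / (eps / (2 * (2 / (1 - betaZ)))) + 2 * K0 * (2 / (1 - betaZ)) ^+ 2).
  have B0 : 0 < 2 / (1 - betaZ) by rewrite divr_gt0.
  apply: addr_gt0; first by rewrite divr_gt0// divr_gt0// mulr_gt0.
  by rewrite mulr_gt0 ?exprn_gt0// mulr_gt0.
move=> n K Lip _ KL.
have := lipschitz_concentration muZP betaZ_itv eps0 K00 one KL.
have KLa : separately_lipschitz (distZ Y betaZ) K (fun i => `|Lip i|).
  move=> i x y xy; apply: le_trans (KL i x y xy) _.
  by apply: ler_wpM2r; [exact: distZ_ge0|exact: ler_norm].
have bF := bounded_measurable_along_orbit betaZ_itv (fun i => normr_ge0 (Lip i)) KLa.
by rewrite /concentrated expRD EFinM (meanE muZ bF).
Qed.
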